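(* Let $\mathfrak{s}$ be either $B_n=\mathfrak{so}(2n+1)$ or $C_n=\mathfrak{sp}(2n)$, and let $\mathfrak{g}\subseteq\mathfrak{s}$ be a seaweed subalgebra which is Frobenius. Let $\widehat{F}$ be a principal element of $\mathfrak{g}$. Then every eigenvalue of $\mathrm{ad}\,\widehat{F}:\mathfrak{g}\to\mathfrak{g}$ is an integer, and the set of eigenvalues is an unbroken set of integers centered at one-half, i.e. it equals $\{1-m,2-m,\dots,m-1,m\}$ for some integer $m\ge 1$. Moreover, the dimensions of the eigenspaces form a symmetric distribution: for every integer $i$, the dimension of the $i$-eigenspace of $\mathrm{ad}\,\widehat{F}$ equals the dimension of its $(1-i)$-eigenspace.
   Context: All Lie algebras are finite-dimensional over $\mathbb{C}$. Let $\mathfrak{s}$ be a simple Lie algebra with Cartan subalgebra $\mathfrak{h}$, root system $\Delta$, positive roots $\Delta_+$, negative roots $\Delta_-=-\Delta_+$, simple roots $\Pi$ and root spaces $\mathfrak{s}_\beta$. For subsets $\pi_1,\pi_2\subseteq\Pi$, the (standard) seaweed (biparabolic) subalgebra is $\mathfrak{p}(\pi_1|\pi_2)=\mathfrak{h}\oplus\bigoplus_{\beta}\mathfrak{s}_\beta$, the sum over $\beta\in\Delta_+$ that are nonnegative integer combinations of $\pi_1$ and $\beta\in\Delta_-$ that are nonpositive integer combinations of $\pi_2$; it is the intersection of two weakly opposite parabolic subalgebras. A seaweed subalgebra is any subalgebra conjugate to a standard one. For a Lie algebra $\mathfrak{g}$ and $F\in\mathfrak{g}^*$, the Kirillov form is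 $B_F(x,y)=F([x,y])$; $\mathfrak{g}$ is Frobenius if $B_F$ is nondegenerate for some $F$ (a Frobenius functional). Then there is a unique $\widehat{F}\in\mathfrak{g}$ with $F([\widehat{F},x])=F(x)$ for all $x\in\mathfrak{g}$; it is called a principal element. (The spectrum of $\mathrm{ad}\,\widehat{F}$ does not depend on the choice of Frobenius functional.) *)

(* Defs.v *)
From HB Require Import structures.
From mathcomp Require Import all_boot all_order all_algebra.
From mathcomp Require Import reals complex.
Set Implicit Arguments. Unset Strict Implicit. Unset Printing Implicit Defensive.
Import Order.TTheory GRing.Theory Num.Theory.
Local Open Scope ring_scope.

Section MatrixLie.
Variables (F : fieldType) (N : nat) (J : 'M[F]_N).

Definition lie (A B : 'M[F]_N) : 'M[F]_N := A *m B - B *m A.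

Definition cls : {vspace 'M[F]_N} := lker (linfun (fun X : 'M[F]_N => X^T *m J + J *m X)).

Definition cartan (H : 'M[F]_N) : Prop := H \in cls /\ is_diag_mx H.

Definition supper (X : 'M[F]_N) : Prop := forall i j : 'I_N, (j <= i)%N -> X i j = 0.

(* weights are represented by functions on matrices; only their values on h matter *)
Definition weight := 'M[F]_N -> F.

Definition rootsp (beta : weight) (X : 'M[F]_N) : Prop :=
  X \in cls /\ forall H, cartan H -> lie H X = beta H *: X.

Definition is_root (beta : weight) : Prop :=
  (exists H, cartan H /\ beta H != 0) /\ (exists X, X != 0 /\ rootsp beta X).

(* positive roots: those whose root spaces lie in the Borel subalgebra
   s ∩ (upper triangular matrices) *)
Definition pos_root (beta : weight) : Prop :=
  is_root beta /\ forall X, rootsp beta X -> supper X.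

Definition neg_root (beta : weight) : Prop := pos_root (fun H => - beta H).

Definition simple_root (alpha : weight) : Prop :=
  pos_root alpha /\
  ~ (exists beta gamma, pos_root beta /\ pos_root gamma /\
       forall H, cartan H -> alpha H = beta H + gamma H).

Definition simple_subset (pi : weight -> Prop) : Prop :=
  forall alpha, pi alpha -> simple_root alpha.

Definition ncomb (pi : weight -> Prop) (beta : weight) : Prop :=
  exists (k : nat) (a : 'I_k -> weight) (c : 'I_k -> nat),
    (forall i, pi (a i)) /\
    forall H, cartan H -> beta H = \sum_(i < k) (c i)%:R * a i H.

Definition std_seaweed (pi1 pi2 : weight -> Prop) (X : 'M[F]_N) : Prop :=
  exists (H : 'M[F]_N) (k : nat) (b : 'I_k -> weight) (Y : 'I_k -> 'M[F]_N),
    cartan H /\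
    (forall i, rootsp (b i) (Y i) /\
       ((pos_root (b i) /\ ncomb pi1 (b i)) \/
        (neg_root (b i) /\ ncomb pi2 (fun H => - b i H)))) /\
    X = H + \sum_(i < k) Y i.

Definition seaweed (g : {vspace 'M[F]_N}) : Prop :=
  exists (pi1 pi2 : weight -> Prop) (P : 'M[F]_N),
    [/\ simple_subset pi1, simple_subset pi2, P^T *m J *m P = J &
      forall X, X \in g <-> exists Y, std_seaweed pi1 pi2 Y /\ X = P *m Y *m invmx P].

Definition frobenius_functional (g : {vspace 'M[F]_N}) (f : 'M[F]_N -> F) : Prop :=
  (forall (a : F) x y, x \in g -> y \in g -> f (a *: x + y) = a * f x + f y) /\
  (forall x, x \in g -> (forall y, y \in g -> f (lie x y) = 0) -> x = 0).

Definition principal_element (g : {vspace 'M[F]_N}) (f : 'M[F]_N -> F) (Fhat : 'M[F]_N) : Prop :=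
  Fhat \in g /\ forall x, x \in g -> f (lie Fhat x) = f x.

Definition ad_eigenvalue (g : {vspace 'M[F]_N}) (Fhat : 'M[F]_N) (l : F) : Prop :=
  exists x, [/\ x \in g, x != 0 & lie Fhat x = l *: x].

Definition ad_eigenspace (g : {vspace 'M[F]_N}) (Fhat : 'M[F]_N) (l : F) : {vspace 'M[F]_N} :=
  (g :&: lker (linfun (fun x : 'M[F]_N => lie Fhat x - l *: x)))%VS.

Definition spectrum_claim : Prop :=
  forall (g : {vspace 'M[F]_N}) (f : 'M[F]_N -> F) (Fhat : 'M[F]_N),
    seaweed g -> frobenius_functional g f -> principal_element g f Fhat ->
    (exists m : nat, (1 <= m)%N /\
       forall l : F, ad_eigenvalue g Fhat l <->
         exists i : int, (1 - m%:Z <= i <= m%:Z) /\ l = i%:~R) /\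
    (forall i : int,
       \dim (ad_eigenspace g Fhat i%:~R) = \dim (ad_eigenspace g Fhat (1 - i)%:~R)).

End MatrixLie.

Definition J_so (F : fieldType) (n : nat) : 'M[F]_(n.*2.+1) :=
  \matrix_(i, j) ((i + j)%N == n.*2)%:R.

Definition J_sp (F : fieldType) (n : nat) : 'M[F]_(n.*2) :=
  \matrix_(i, j) (if ((i + j).+1 == n.*2)%N then (if (i < n)%N then 1 else -1) else 0).

(* Main.v *)
Require Import Defs.
From HB Require Import structures.
From mathcomp Require Import all_boot all_order all_algebra.
From mathcomp Require Import reals complex.
From mathcomp Require Import ring zify.
From Stdlib Require Import Classical.
Set Implicit Arguments. Unset Strict Implicit. Unset Printing Implicit Defensive.
Import Order.TTheory GRing.Theory Num.Theory.
Local Open Scope ring_scope.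

(* For a principal element h, the identity F([[h,x],y]) + F([x,[h,y]]) = F([x,y])
   makes the l- and (1-l)-eigenspaces of ad h dual to each other, so the real
   issue is that the spectrum is an interval of integers.

   A seaweed subalgebra is the set of elements of so(W) or sp(W) that preserve
   two chains U and T of isotropic subspaces of W in weakly opposite position.
   Let V be an abelian ideal of g that is isotropic for the Kirillov form, and
   suppose that a subalgebra g' complements V in the orthogonal of V.  Then g'
   is again Frobenius, h is a principal element of g' up to a correction, and
   spec g = spec V + (1 - spec V) + spec g' (as sets).  Along the induction on
   dim W one keeps track of the eigenvalues of h on the successive quotients of
   both chains: they form intervals of integers (orthogonal case) or of
   half-integers (symplectic case) that meet a fixed neighbourhood of 0, and
   spec V is a set of differences of two such intervals.

   If both chains are nonempty, their first members are in duality on one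
   side, and g is isomorphic to an algebra of block-triangular matrices built
   on a smaller W, which is reduced by the ideal V = Hom(F^c, T1).  If one
   chain is empty, explicit elements of the kernel of the Kirillov form show
   that the first member of the other chain is a line <t> with prescribed
   h-eigenvalue (in the orthogonal case, dim T2 = 2 as well), and one passes to
   the orthogonal of the nondegenerate space T_i + A T_i, where A is the matrix
   representing the Frobenius functional by the trace form. *)

(** * Linear algebra *)

(** The absence of gaps is delicate because spec V is a difference set: differences of sets with
    gaps can have gaps. So the induction must control the quotients of both chains and not only the
    spectrum of g. The constant 1 enters through diag(-1, 0), which already satisfies the identity
    of a principal element against V = Hom(F^c, T1). Hence the block [a] of a principal element is a
    matrix coming from the reduced algebra minus the identity, spec a + 1 meets spec T1, and 1
    belongs to spec V; its reflection contains 0, so the two intervals join. The reduction by V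
    behaves like Euclid's algorithm. On V the functional is a matrix [M] from T1 to F^c, and
    nondegeneracy forces M to be onto or injective. If it is onto, its kernel is a new first member
    of the chain; if it is injective, c drops by dim T1. In the orthogonal case every passage to a
    smaller W removes an even-dimensional space, so dim W stays odd. With one empty chain this
    parity supplies a vector of T1^perp outside T1 and bounds T2. *)

Section LinAlg.
Variable F : fieldType.

Lemma linfun_linE (E E' : vectType F) (g : E -> E') :
  (forall a x y, g (a *: x + y) = a *: g x + g y) -> forall x, linfun g x = g x.
Proof.
move=> gl x.
pose g' := HB.pack_for {linear E -> E'} g (GRing.isLinear.Build F E E' _ g gl).
exact: (lfunE g').
Qed.

Lemma linear_fun_exists (E E' : vectType F) (g : E -> E') :
  (forall a x y, g (a *: x + y) = a *: g x + g y) ->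
  exists f : 'Hom(E, E'), forall x, f x = g x.
Proof.
by move=> gl; exists (linfun g) => x; rewrite linfun_linE.
Qed.

Lemma dim_add_line (E : vectType F) (V : {vspace E}) x :
  x \notin V -> (\dim V < \dim (V + <[x]>))%N.
Proof.
move=> xV; have le := dimv_leqif_sup (addvSl V <[x]>).
by rewrite ltn_neqAle le.2 le.1 andbT subv_add subvv /= -memvE.
Qed.

(** A subspace on which P holds is enlarged by a vector of P as long as one is missing; the
    codimension bounds the number of steps. The case distinction is classical, so P may be any
    proposition. *)
Lemma subspace_exists (E : vectType F) (P : E -> Prop) :
  P 0 -> (forall a x y, P x -> P y -> P (a *: x + y)) ->
  exists V : {vspace E}, forall x, x \in V <-> P x.
Proof.
move=> P0 Pl.
suff H : forall k (V : {vspace E}), (\dim {:E} - \dim V <= k)%N ->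
    (forall x, x \in V -> P x) -> exists V : {vspace E}, forall x, x \in V <-> P x.
  apply: (H (\dim {:E}) 0%VS); first by rewrite leq_subr.
  by move=> x; rewrite memv0 => /eqP ->.
elim=> [|k IH] V dV VP.
  have VE : V = fullv.
    apply/eqP; rewrite eqEdim subvf /=.
    by move: dV; rewrite leqn0 subn_eq0.
  by exists V => x; split=> [/VP //|_]; rewrite VE memvf.
case: (classic (forall x, P x -> x \in V)) => [h|].
  by exists V => x; split=> [/VP|/h].
move=> h; have [x {}h] := not_all_ex_not _ _ h; have [Px xV] := imply_to_and _ _ h.
apply: (IH (V + <[x]>)%VS).
  have lt : (\dim V < \dim (V + <[x]>))%N.
    by apply: dim_add_line; apply/negP.
  have := dimvS (subvf (V + <[x]>)); lia.
move=> y /memv_addP [v vV [w /vlineP [a ->] ->]].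
by rewrite addrC; apply: Pl => //; apply: VP.
Qed.

(** An injective endomorphism of the finite-dimensional quotient Y / X is onto; a dimension count
    for the image of Y replaces the quotient. *)
Lemma surj_of_inj_mod (E : vectType F) (phi : 'End(E)) (X Y : {vspace E}) :
  (X <= Y)%VS -> (forall x, x \in X -> phi x \in X) ->
  (forall y, y \in Y -> phi y \in Y) ->
  (forall y, y \in Y -> phi y \in X -> y \in X) ->
  forall y, y \in Y -> exists2 y', y' \in Y & y - phi y' \in X.
Proof.
move=> sXY pX pY inj.
have dY := limg_ker_dim phi Y.
have sK : (Y :&: lker phi <= X)%VS.
  apply/subvP => y; rewrite memv_cap memv_ker => /andP[yY /eqP py].
  by apply: inj => //; rewrite py mem0v.
have KE : (Y :&: lker phi = X :&: lker phi)%VS.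
  apply/eqP; rewrite eqEsubv subv_cap sK capvSr capvS //.
have dX := limg_ker_dim phi X.
have sub1 : (phi @: Y :&: X <= phi @: X)%VS.
  apply/subvP => z; rewrite memv_cap => /andP[/memv_imgP [y yY ->] h].
  by apply: memv_img; apply: inj.
have dd := dimv_sum_cap (phi @: Y)%VS X.
have YE : (phi @: Y + X)%VS = Y.
  apply/eqP; rewrite eqEdim; apply/andP; split.
    rewrite subv_add sXY andbT; apply/subvP => z /memv_imgP [y yY ->].
    exact: pY.
  have := dimvS sub1. rewrite -KE in dX; lia.
move=> y; rewrite -{1}YE => /memv_addP [z /memv_imgP [y' y'Y ->] [x xX ->]].
by exists y' => //; rewrite addrAC subrr add0r.
Qed.

(** Inside G, P is cut out by dim U linear conditions, one for each vector of a basis of U. *)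
Lemma perp_dim_ge (E : vectType F) (b : E -> E -> F) (G U P : {vspace E}) :
  (forall y a x x', b (a *: x + x') y = a * b x y + b x' y) ->
  (forall y a x x', b y (a *: x + x') = a * b y x + b y x') ->
  (forall y, y \in P <-> (y \in G /\ forall v, v \in U -> b y v = 0)) ->
  (\dim G <= \dim P + \dim U)%N.
Proof.
move=> bl br hP.
have b0r y : b y 0 = 0.
  by have := br y (-1) 0 0; rewrite scaler0 addr0 mulN1r addrC subrr.
have span0r y : (forall i : 'I_(\dim U), b y (vbasis U)`_i = 0) -> forall v, v \in U -> b y v = 0.
  move=> h v /coord_vbasis ->.
  elim/big_ind: _ => //; first by move=> x z hx hz; have := br y 1 x z; rewrite scale1r mul1r hx hz addr0.
  by move=> i _; have := br y (coord (vbasis U) i v) (vbasis U)`_i 0; rewrite addr0 => ->; rewrite h b0r mulr0 addr0.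
have [f fE] : exists f : 'Hom(E, 'rV[F]_(\dim U)), forall x, f x = \row_i b x (vbasis U)`_i.
  by apply: linear_fun_exists => a x y; apply/rowP => i; rewrite !mxE bl.
have <- : (G :&: lker f = P)%VS.
  apply/eqP; rewrite eqEsubv; apply/andP; split; apply/subvP => y; rewrite memv_cap memv_ker fE.
    case/andP => yG /eqP/rowP h; apply/hP; split=> //; apply: span0r => i.
    by have := h i; rewrite !mxE.
  move/hP => [-> h] /=; apply/eqP/rowP => i; rewrite !mxE; apply: h; exact/vbasis_mem/mem_nth/(leq_trans (ltn_ord i))/eq_leq/esym/size_tuple.
rewrite -(limg_ker_dim f G) leq_add2l.
by apply: leq_trans (dimvS (subvf _)) _; rewrite dimvf /dim /= mul1n.
Qed.

(** If v0 were outside V, then V and V + <[v0]> would have the same orthogonal, of dimension at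
    least dim G - dim V by [perp_dim_ge] and smaller than that by nondegeneracy. *)
Lemma double_perp (E : vectType F) (b : E -> E -> F) (G V : {vspace E}) :
  (forall y a x x', b (a *: x + x') y = a * b x y + b x' y) ->
  (forall y a x x', b y (a *: x + x') = a * b y x + b y x') ->
  (V <= G)%VS ->
  (forall v, v \in G -> (forall y, y \in G -> b y v = 0) -> v = 0) ->
  forall v0, v0 \in G ->
  (forall y, y \in G -> (forall v, v \in V -> b y v = 0) -> b y v0 = 0) ->
  v0 \in V.
Proof.
move=> bl br sVG nd v0 v0G h0.
have b0r y : b y 0 = 0.
  by have := br y (-1) 0 0; rewrite scaler0 addr0 mulN1r addrC subrr.
have b0l y : b 0 y = 0.
  by have := bl y (-1) 0 0; rewrite scaler0 addr0 mulN1r addrC subrr.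
pose perp (U P : {vspace E}) := forall y, y \in P <-> (y \in G /\ forall v, v \in U -> b y v = 0).
have span0l (U : {vspace E}) y : (forall i : 'I_(\dim U), b (vbasis U)`_i y = 0) -> forall v, v \in U -> b v y = 0.
  move=> h v /coord_vbasis ->.
  elim/big_ind: _ => //; first by move=> x z hx hz; have := bl y 1 x z; rewrite scale1r mul1r hx hz addr0.
  by move=> i _; have := bl y (coord (vbasis U) i v) (vbasis U)`_i 0; rewrite addr0 => ->; rewrite h b0l mulr0 addr0.
(* The opposite bound: by nondegeneracy, U embeds in the dual of a complement Z of P. *)
have up (U P : {vspace E}) : (U <= G)%VS -> perp U P -> (\dim P + \dim U <= \dim G)%N.
  move=> sU hP; set Z := (G :\: P)%VS.
  have sP : (P <= G)%VS by apply/subvP => y /hP [].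
  have dG : (\dim P + \dim Z)%N = \dim G.
    by have := dimv_cap_compl G P; rewrite (capv_idPr sP).
  have GE : (Z + P)%VS = G by have := addv_diff_cap G P; rewrite (capv_idPr sP).
  rewrite -dG leq_add2l.
  have [f fE] : exists f : 'Hom(E, 'rV[F]_(\dim Z)), forall x, f x = \row_i b (vbasis Z)`_i x.
    by apply: linear_fun_exists => a x y; apply/rowP => i; rewrite !mxE br.
  have k0 : (U :&: lker f = 0)%VS.
    apply/eqP; rewrite -subv0; apply/subvP => u; rewrite memv_cap memv_ker fE memv0.
    case/andP => uU /eqP/rowP h; apply/eqP; apply: nd; first exact: (subvP sU).
    move=> y; rewrite -GE => /memv_addP [z zZ [p pP ->]].
    have := bl u 1 z p; rewrite scale1r mul1r => ->.
    rewrite (span0l Z u _ z zZ); last by move=> i; have := h i; rewrite !mxE.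
    by rewrite add0r; apply: (proj2 (proj1 (hP p) pP)).
  rewrite -(limg_ker_dim f U) k0 dimv0 add0n.
  by apply: leq_trans (dimvS (subvf _)) _; rewrite dimvf /dim /= mul1n.
have exP (U : {vspace E}) : exists P, perp U P.
  apply: subspace_exists; first by split; [exact: mem0v | move=> v _; rewrite b0l].
  move=> a x y [xG xh] [yG yh]; split; first by rewrite memvD ?memvZ.
  by move=> v vU; rewrite bl xh // yh // mulr0 addr0.
apply/negPn/negP => v0V.
have [P hP] := exP V; have l1 := perp_dim_ge bl br hP.
have hP1 : perp (V + <[v0]>)%VS P.
  move=> y; rewrite hP; split=> [[yG h]|[yG h]]; split=> //.
    move=> v /memv_addP [x xV [w /vlineP [a ->] ->]].
    have := br y a v0 x; rewrite addrC => ->.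
    by rewrite (h0 _ yG h) (h _ xV) mulr0 addr0.
  by move=> v vV; apply: h; apply: (subvP (addvSl _ _)).
have s1 : (V + <[v0]> <= G)%VS by rewrite subv_add sVG -memvE.
have := up _ _ s1 hP1.
have lt : (\dim V < \dim (V + <[v0]>))%N.
  exact: dim_add_line.
lia.
Qed.

End LinAlg.

(** * Frobenius functionals and reduction *)

Section Frobenius.
Variable F : fieldType.

(** Functionals are stored as matrices through the trace form, so that A may be replaced by any
    matrix with the same traces against g. *)
Definition frob n (g : {vspace 'M[F]_n}) (A : 'M[F]_n) :=
  forall x, x \in g -> (forall y, y \in g -> \tr (A *m lie x y) = 0) -> x = 0.

Definition prin n (g : {vspace 'M[F]_n}) (A h : 'M[F]_n) :=
  h \in g /\ forall x, x \in g -> \tr (A *m lie h x) = \tr (A *m x).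

Definition lie_closed n (g : {vspace 'M[F]_n}) :=
  forall x y, x \in g -> y \in g -> lie x y \in g.

Lemma lieDl n (x y z : 'M[F]_n) : lie (x + y) z = lie x z + lie y z.
Proof. by rewrite /lie mulmxDl mulmxDr opprD addrACA. Qed.

Lemma lieDr n (x y z : 'M[F]_n) : lie x (y + z) = lie x y + lie x z.
Proof. by rewrite /lie mulmxDl mulmxDr opprD addrACA. Qed.

Lemma lieZl n a (x y : 'M[F]_n) : lie (a *: x) y = a *: lie x y.
Proof. by rewrite /lie -scalemxAl -scalemxAr scalerBr. Qed.

Lemma lieZr n a (x y : 'M[F]_n) : lie x (a *: y) = a *: lie x y.
Proof. by rewrite /lie -scalemxAl -scalemxAr scalerBr. Qed.

Lemma lieC n (x y : 'M[F]_n) : lie x y = - lie y x.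
Proof. by rewrite /lie opprB. Qed.

Lemma lieNr n (x y : 'M[F]_n) : lie x (- y) = - lie x y.
Proof. by rewrite /lie mulmxN mulNmx opprK opprB addrC. Qed.

Lemma lieBr n (x y z : 'M[F]_n) : lie x (y - z) = lie x y - lie x z.
Proof. by rewrite lieDr lieNr. Qed.

Lemma lie0r n (x : 'M[F]_n) : lie x 0 = 0.
Proof. by rewrite /lie mulmx0 mul0mx subr0. Qed.

Lemma lie0l n (x : 'M[F]_n) : lie 0 x = 0.
Proof. by rewrite lieC lie0r oppr0. Qed.

Lemma jacobi n (h x y : 'M[F]_n) : lie h (lie x y) = lie (lie h x) y + lie x (lie h y).
Proof.
rewrite /lie !(mulmxBl, mulmxBr) !mulmxA.
by apply/matrixP => i j; rewrite !mxE; ring.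
Qed.

Lemma trlieC n (A x y : 'M[F]_n) : \tr (A *m lie x y) = - \tr (A *m lie y x).
Proof. by rewrite lieC mulmxN raddfN. Qed.

Lemma trlieDl n (A x y z : 'M[F]_n) :
  \tr (A *m lie (x + y) z) = \tr (A *m lie x z) + \tr (A *m lie y z).
Proof. by rewrite lieDl mulmxDr raddfD. Qed.

Lemma trlieDr n (A x y z : 'M[F]_n) :
  \tr (A *m lie x (y + z)) = \tr (A *m lie x y) + \tr (A *m lie x z).
Proof. by rewrite lieDr mulmxDr raddfD. Qed.

Lemma trlieZr n (A x y : 'M[F]_n) a :
  \tr (A *m lie x (a *: y)) = a * \tr (A *m lie x y).
Proof. by rewrite lieZr -scalemxAr mxtraceZ. Qed.

Lemma trlieZl n (A x y : 'M[F]_n) a :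
  \tr (A *m lie (a *: x) y) = a * \tr (A *m lie x y).
Proof. by rewrite lieZl -scalemxAr mxtraceZ. Qed.

Lemma prin_deriv n (g : {vspace 'M[F]_n}) A h x y :
  lie_closed g -> prin g A h -> x \in g -> y \in g ->
  \tr (A *m lie (lie h x) y) + \tr (A *m lie x (lie h y)) = \tr (A *m lie x y).
Proof.
move=> gl [hg hp] xg yg.
by rewrite -raddfD /= -mulmxDr -jacobi hp //; apply: gl.
Qed.

Definition shift_ad n (h : 'M[F]_n) l : 'End('M[F]_n) :=
  linfun (fun x => lie h x - l *: x).

Lemma shift_adE n (h : 'M[F]_n) l x : shift_ad h l x = lie h x - l *: x.
Proof.
rewrite /shift_ad linfun_linE // => a {}x y.
by rewrite lieDr lieZr; apply/matrixP => i j; rewrite !mxE; ring.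
Qed.

(** If 1 - l is not an eigenvalue on V, then ad h - (1 - l) is onto V, and by [prin_deriv] its
    values pair to zero with an l-eigenvector. *)
Lemma eig_dual n (g V : {vspace 'M[F]_n}) A h l x v :
  lie_closed g -> prin g A h -> (V <= g)%VS ->
  (forall w, w \in V -> lie h w \in V) ->
  x \in g -> lie h x = l *: x -> v \in V -> \tr (A *m lie x v) != 0 ->
  ad_eigenvalue V h (1 - l).
Proof.
move=> gl hp sV hV xg xl vV nz.
apply: NNPP => no; case/negP: nz; apply/eqP.
pose phi := shift_ad h (1 - l).
have sphi y : y \in V -> phi y \in V.
  by move=> yV; rewrite shift_adE memvB ?memvZ // hV.
have [|y yV|v' v'V] := @surj_of_inj_mod _ _ phi 0%VS V (sub0v _) _ sphi _ v vV.
- by move=> y; rewrite !memv0 => /eqP ->; rewrite linear0.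
- rewrite !memv0 => /eqP py; apply/negPn/negP => y0; apply: no; exists y.
  by split=> //; apply/eqP; rewrite -subr_eq0 -shift_adE; apply/eqP.
rewrite memv0 subr_eq0 => /eqP ->; rewrite shift_adE.
have := prin_deriv gl hp xg (subvP sV _ v'V); rewrite xl trlieZl => e.
rewrite lieBr mulmxBr raddfB /= trlieZr.
have -> : \tr (A *m lie x (lie h v')) = \tr (A *m lie x v') - l * \tr (A *m lie x v').
  by rewrite -[X in X - _]e addrAC subrr add0r.
by ring.
Qed.

Lemma eig_sym n (g : {vspace 'M[F]_n}) A h l :
  lie_closed g -> frob g A -> prin g A h ->
  ad_eigenvalue g h l -> ad_eigenvalue g h (1 - l).
Proof.
move=> gl fr hp [x [xg x0 xl]].
apply: NNPP => no; case/negP: x0; apply/eqP; apply: fr => // y yg.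
apply/eqP/negPn/negP => nz; apply: no.
apply: (eig_dual gl hp (subvv g) _ xg xl yg nz) => w wg; apply: gl => //; exact: hp.1.
Qed.

(** The eigenvector is h itself; were it zero, the functional would vanish on all brackets. *)
Lemma frob_eig0 n (g : {vspace 'M[F]_n}) A h x : lie_closed g -> frob g A -> prin g A h ->
  x \in g -> x != 0 -> ad_eigenvalue g h 0.
Proof.
move=> gl fr hp xg x0; exists h; split; first exact: hp.1.
  apply: contra x0 => /eqP h0; apply/eqP/(fr _ xg) => y yg.
  by rewrite -(hp.2 _ (gl _ _ xg yg)) h0 lie0l mulmx0 raddf0.
by rewrite /lie subrr scale0r.
Qed.

(** For the Kirillov form, ad h - l and -(ad h - (1 - l)) are adjoint, so the kernel of the first is
    the orthogonal of the image of the second. Applied to l and to 1 - l, the inequality gives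
    equality. *)
Lemma eigenspace_sym n (g : {vspace 'M[F]_n}) A h l :
  lie_closed g -> frob g A -> prin g A h ->
  (\dim (ad_eigenspace g h (1 - l)) <= \dim (ad_eigenspace g h l))%N.
Proof.
move=> gl fr hp.
have E m : ad_eigenspace g h m = (g :&: lker (shift_ad h m))%VS by [].
have st m x : x \in g -> shift_ad h m x \in g.
  by move=> xg; rewrite shift_adE memvB ?memvZ // gl //; exact: hp.1.
rewrite !E.
have key x y : x \in g -> y \in g ->
    \tr (A *m lie (shift_ad h l x) y) = - \tr (A *m lie x (shift_ad h (1 - l) y)).
  move=> xg yg; have := prin_deriv gl hp xg yg.
  rewrite !shift_adE !trlieDl !trlieDr -!scaleNr !trlieZl !trlieZr => <-.
  by ring.
have le : (\dim g <= \dim (g :&: lker (shift_ad h l)) + \dim (shift_ad h (1 - l) @: g))%N.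
  apply: (@perp_dim_ge _ _ (fun x y => \tr (A *m lie x y))) => [y a x x'|y a x x'|x].
  - by rewrite trlieDl trlieZl.
  - by rewrite trlieDr trlieZr.
  rewrite memv_cap memv_ker; split.
    case/andP=> xg /eqP x0; split=> // v /memv_imgP [y yg ->].
    by apply: oppr_inj; rewrite -key // x0 lie0l mulmx0 raddf0 oppr0.
  case=> xg hx; rewrite xg /=; apply/eqP; apply: fr; first exact: st.
  by move=> y yg; rewrite key // hx ?oppr0 //; apply: memv_img.
by rewrite -(leq_add2r (\dim (shift_ad h (1 - l) @: g))) limg_ker_dim.
Qed.

Lemma trace_repr n (phi : 'M[F]_n -> F) :
  (forall a x y, phi (a *: x + y) = a * phi x + phi y) ->
  exists A, forall x, \tr (A *m x) = phi x.
Proof.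
move=> pl.
have p0 : phi 0 = 0 by have := pl (-1) 0 0; rewrite scaler0 addr0 mulN1r addrC subrr.
exists (\matrix_(i, j) phi (delta_mx j i)) => x.
rewrite [in RHS](matrix_sum_delta x) /mxtrace.
have psum (I : finType) (E : I -> 'M[F]_n) : phi (\sum_i E i) = \sum_i phi (E i).
  elim/big_ind2: _ => // a b c d ab cd.
  by have := pl 1 b d; rewrite scale1r mul1r => ->; rewrite ab cd.
rewrite psum; transitivity (\sum_i \sum_j phi (x i j *: delta_mx i j)); last first.
  by apply: eq_bigr => i _; rewrite psum.
rewrite exchange_big; apply: eq_bigr => i _; rewrite mxE; apply: eq_bigr => j _.
by have := pl (x j i) (delta_mx j i) 0; rewrite !addr0 p0 addr0 mxE mulrC => ->.
Qed.

(* Reduction by the ideal V, isotropic for the Kirillov form, with V^perp = g' + V;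
   h0 is the part of h that acts on V. *)
Lemma reduction n n' (g V : {vspace 'M[F]_n}) (g' : {vspace 'M[F]_n'})
    (iota : 'M[F]_n' -> 'M[F]_n) A h h0 :
  (forall a x y, iota (a *: x + y) = a *: iota x + iota y) ->
  lie_closed g -> lie_closed g' ->
  (forall x, x \in g' -> iota x \in g) ->
  (forall x, x \in g' -> iota x \in V -> x = 0) ->
  (forall x y, x \in g' -> y \in g' -> iota (lie x y) = lie (iota x) (iota y)) ->
  (V <= g)%VS ->
  (forall x v, x \in g -> v \in V -> lie x v \in V) ->
  (forall v w, v \in V -> w \in V -> \tr (A *m lie v w) = 0) ->
  (forall x v, x \in g' -> v \in V -> \tr (A *m lie (iota x) v) = 0) ->
  (forall x, x \in g -> (forall v, v \in V -> \tr (A *m lie x v) = 0) ->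
     exists x' v, [/\ x' \in g', v \in V & x = iota x' + v]) ->
  h0 \in g ->
  (forall v, v \in V -> \tr (A *m lie h0 v) = \tr (A *m v)) ->
  (forall x, x \in g' -> \tr (A *m lie h0 (iota x)) = 0) ->
  (forall x, x \in g' -> lie h0 (iota x) \in V) ->
  frob g A -> prin g A h ->
  exists A' h' v0, [/\ frob g' A', prin g' A' h', v0 \in V, h = h0 + iota h' + v0 &
    forall l, ad_eigenvalue g h l <->
      [\/ ad_eigenvalue V h l, ad_eigenvalue V h (1 - l) | ad_eigenvalue g' h' l]].
Proof.
move=> il gl gl' ig ij ilie sV gV iso iV Vp h0g h0V h0i h0iV fr hp.
have [A' A'E] : exists A', forall x, \tr (A' *m x) = \tr (A *m iota x).
  by apply: trace_repr => a x y; rewrite il mulmxDr -scalemxAr raddfD /= mxtraceZ.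
have hg := hp.1.
have [h' [v0 [h'g v0V hE]]] : exists x' v, [/\ x' \in g', v \in V & h - h0 = iota x' + v].
  apply: Vp; first exact: memvB.
  move=> v vV; rewrite trlieDl -scaleN1r trlieZl h0V // hp.2 ?(subvP sV) //.
  by rewrite mulN1r subrr.
have hE' : h = h0 + iota h' + v0 by rewrite -addrA -hE addrC subrK.
have iB x y : iota (x - y) = iota x - iota y.
  by rewrite -scaleN1r addrC il scaleN1r addrC.
have iZ a x : iota (a *: x) = a *: iota x.
  have i0 : iota 0 = 0 by have := il (-1) 0 0; rewrite scaler0 addr0 scaleN1r addrC subrr.
  by have := il a x 0; rewrite !addr0 i0 addr0.
exists A', h', v0; split=> //.
(* An x in the radical for g' has iota x orthogonal to iota g' and to V, that is to all of V^perp;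
   [double_perp] puts iota x in V. *)
- move=> x xg' xB; apply: ij => //.
  apply: (@double_perp _ _ (fun x y => \tr (A *m lie x y)) g V) => //.
  + by move=> y a z z'; rewrite trlieDl trlieZl.
  + by move=> y a z z'; rewrite trlieDr trlieZr.
  + move=> v vg vB; apply: fr => // y yg.
    by rewrite trlieC vB // oppr0.
  + exact: ig.
  move=> y yg yV; have [x' [v [x'g vV ->]]] := Vp y yg yV.
  rewrite trlieDl trlieC -ilie // -A'E xB // oppr0 add0r.
  by rewrite trlieC iV // oppr0.
- split=> // x xg'.
  rewrite !A'E ilie // -(hp.2 _ (ig _ xg')) hE' !trlieDl h0i // add0r.
  by rewrite [\tr (A *m lie v0 _)]trlieC (iV x v0) // oppr0 addr0.
(* Modulo V, h acts on iota g' as h' acts on g'. *)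
have lieh x' : x' \in g' -> lie h (iota x') - iota (lie h' x') \in V.
  move=> x'g; rewrite hE' !lieDl -ilie // addrAC addrK memvD ?h0iV //.
  by rewrite lieC memvN gV // ig.
have hV w : w \in V -> lie h w \in V by move=> wV; exact: gV.
move=> l; split.
  case=> x [xg x0 xl].
  case: (boolP (x \in V)) => xV; first by constructor 1; exists x.
  (* An eigenvector outside V is either orthogonal to V, and then projects to an eigenvector of h',
     or it pairs with V, and then [eig_dual] applies. *)
  case: (classic (forall v, v \in V -> \tr (A *m lie x v) = 0)) => [xp|].
    constructor 3; have [x' [v [x'g vV xE]]] := Vp x xg xp.
    exists x'; split=> //.
      apply: contraNneq xV => x'0; rewrite xE x'0 memvD //.
      by rewrite -[0](scale0r 0) iZ scale0r mem0v.
    apply/eqP; rewrite -subr_eq0; apply/eqP; apply: ij.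
      by rewrite memvB ?memvZ // gl'.
    rewrite iB iZ.
    have -> : iota (lie h' x') - l *: iota x' = - (lie h (iota x') - iota (lie h' x')) - (lie h v - l *: v).
      have : lie h (iota x') + lie h v = l *: iota x' + l *: v by rewrite -lieDr -scalerDr -xE.
      move/eqP; rewrite -subr_eq => /eqP <-.
      by apply/matrixP => i j; rewrite !mxE; ring.
    by rewrite memvB ?memvN ?lieh // memvB ?memvZ // hV.
  move=> nn; have [v {}nn] := not_all_ex_not _ _ nn; have [vV nz] := imply_to_and _ _ nn.
  constructor 2; apply: (eig_dual gl hp sV hV xg xl vV); exact/eqP.
have VG m : ad_eigenvalue V h m -> ad_eigenvalue g h m.
  by case=> x [xV x0 xl]; exists x; split=> //; apply: (subvP sV).
case=> [/VG //|/VG /(eig_sym gl fr hp)|[x' [x'g x'0 x'l]]].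
  by rewrite subKr.
(* Unless l is already an eigenvalue on V, ad h - l is onto V, so the lift of an eigenvector of h'
   can be corrected inside V. *)
case: (classic (ad_eigenvalue V h l)) => [/VG //|no].
have sphi y : y \in V -> shift_ad h l y \in V.
  by move=> yV; rewrite shift_adE memvB ?memvZ // hV.
have pV : shift_ad h l (iota x') \in V.
  by have := lieh _ x'g; rewrite x'l iZ shift_adE.
have [|y yV|v' v'V] := @surj_of_inj_mod _ _ (shift_ad h l) 0%VS V (sub0v _) _ sphi _ _ pV.
- by move=> y; rewrite !memv0 => /eqP ->; rewrite linear0.
- rewrite !memv0 => /eqP py; apply/negPn/negP => y0; apply: no; exists y.
  by split=> //; apply/eqP; rewrite -subr_eq0 -shift_adE; apply/eqP.
rewrite memv0 -linearB /= => /eqP e0; exists (iota x' - v'); split.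
- by rewrite memvB ?ig // (subvP sV).
- apply: contra x'0 => e; apply/eqP; apply: ij => //.
  by move: e; rewrite subr_eq0 => /eqP ->.
- by apply/eqP; rewrite -subr_eq0 -shift_adE e0.
Qed.

End Frobenius.

(** * Eigenvalues on subquotients *)

Section Spectrum.
Variable F : numClosedFieldType.

(** Eigenvalues of the map induced by h on Y / X, with eigenvectors given by representatives. *)
Definition ev N (h : 'M[F]_N) (X Y : {vspace 'cV[F]_N}) (l : F) : Prop :=
  exists y, [/\ y \in Y, y \notin X & h *m y - l *: y \in X].

Definition stable N (h : 'M[F]_N) (X : {vspace 'cV[F]_N}) : Prop :=
  forall x, x \in X -> h *m x \in X.

Definition mxsh N (h : 'M[F]_N) l : 'End('cV[F]_N) := linfun (fun y => h *m y - l *: y).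

Lemma mxshE N (h : 'M[F]_N) l y : mxsh h l y = h *m y - l *: y.
Proof.
rewrite /mxsh linfun_linE // => a u v.
by rewrite mulmxDr -scalemxAr; apply/matrixP => i j; rewrite !mxE; ring.
Qed.

(** To lift an eigenvector from Z / Y to Z / X, correct it inside Y. This is possible when h - l is
    onto Y / X; otherwise l is already an eigenvalue on Y / X. *)
Lemma ev_split N (h : 'M[F]_N) X Y Z l :
  (X <= Y)%VS -> (Y <= Z)%VS -> stable h X -> stable h Y ->
  ev h X Z l <-> ev h X Y l \/ ev h Y Z l.
Proof.
move=> XY YZ sX sY; split.
  case=> z [zZ zX zl]; case: (boolP (z \in Y)) => zY; first by left; exists z.
  by right; exists z; split=> //; apply: (subvP XY).
case=> [[y [yY yX yl]]|[z [zZ zY zl]]].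
  by exists y; split=> //; apply: (subvP YZ).
case: (classic (ev h X Y l)) => [[y [yY yX yl]]|no].
  by exists y; split=> //; apply: (subvP YZ).
have [||y yY yX|y' y'Y y'X] := surj_of_inj_mod (phi := mxsh h l) XY _ _ _ zl.
- by move=> x xX; rewrite mxshE memvB ?memvZ // sX.
- by move=> x xY; rewrite mxshE memvB ?memvZ // sY.
- by apply/negPn/negP => yX'; apply: no; exists y; split=> //; rewrite -mxshE.
exists (z - y'); split.
- by rewrite memvB // (subvP YZ).
- apply: contra zY => h0; rewrite -(subrK y' z) memvD //; exact: (subvP XY).
- by move: y'X; rewrite -!mxshE -linearB.
Qed.

(** By Cayley-Hamilton the product of all h - z, for z a root of the characteristic polynomial,
    sends y into X. Applying the factors one after the other, the first step that enters X exhibits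
    an eigenvector. *)
Lemma ev_exists N (h : 'M[F]_N) (X Y : {vspace 'cV[F]_N}) :
  ~~ (Y <= X)%VS -> stable h X -> stable h Y -> exists l, ev h X Y l.
Proof.
case: N h X Y => [|N] h X Y.
  case/negP; apply/subvP => y _; have -> : y = 0 by apply/matrixP => -[].
  exact: mem0v.
case/subvPn => y yY yX sX sY.
have [r rE] := closed_field_poly_normal (char_poly h).
have := Cayley_Hamilton h.
rewrite rE linearZ /= rmorph_prod /= (monicP (char_poly_monic h)) scale1r.
rewrite (eq_bigr (fun z => h - z%:M)) => [|z _]; last first.
  by rewrite rmorphB /= horner_mx_X horner_mx_C.
move=> p0.
have {p0} : (\prod_(z <- r) (h - z%:M)) *m y \in X by rewrite p0 mul0mx mem0v.
elim: r {rE} y yY yX => [|z r IH] y yY yX.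
  by rewrite big_nil mul1mx (negPf yX).
have -> : \prod_(j <- z :: r) (h - j%:M) = \prod_(j <- r) (h - j%:M) *m (h - z%:M).
  rewrite big_cons; set q := \prod_(j <- r) _.
  suff : GRing.comm (h - z%:M) q by [].
  apply: commr_prod => i _; apply: commrB; last exact: comm_mx_scalar.
  by apply/commr_sym/commrB => //; exact: comm_mx_scalar.
rewrite -mulmxA => hX.
case: (boolP ((h - z%:M) *m y \in X)) => hz.
  by exists z, y; split=> //; move: hz; rewrite mulmxBl mul_scalar_mx.
by apply: (IH _ _ hz hX); rewrite mulmxBl mul_scalar_mx memvB ?memvZ ?sY.
Qed.

Definition evm n (a : 'M[F]_n) (l : F) : Prop := \det (a - l%:M) = 0.

Lemma evm_row n (a : 'M[F]_n) l :
  evm a l <-> exists2 w : 'rV_n, w != 0 & w *m a = l *: w.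
Proof.
rewrite /evm; split=> [/eqP/det0P [w w0 e]|[w w0 e]].
  by exists w => //; apply/eqP; rewrite -subr_eq0 -mul_mx_scalar -mulmxBr e.
by apply/eqP/det0P; exists w => //; rewrite mulmxBr mul_mx_scalar e subrr.
Qed.

Lemma evm_col n (a : 'M[F]_n) l :
  evm a l <-> exists2 v : 'cV_n, v != 0 & a *m v = l *: v.
Proof.
have -> : evm a l <-> evm a^T l by rewrite /evm -[in X in _ <-> X]det_tr !linearB /= trmxK tr_scalar_mx.
rewrite evm_row; split=> -[w w0 e]; exists w^T; rewrite ?trmx_eq0 //.
  by rewrite -(trmxK a) -trmx_mul e linearZ.
by rewrite -trmx_mul e linearZ.
Qed.

Lemma evm_sub1 n (a : 'M[F]_n) l : evm (a - 1%:M) l <-> evm a (l + 1).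
Proof.
rewrite /evm -addrA -opprD -raddfD /=.
by rewrite [1 + l]addrC.
Qed.

Lemma ev0_evm N k (x : 'M[F]_N) (T : {vspace 'cV[F]_N}) (Tb : 'M_(N, k)) xT l :
  (forall v, v \in T <-> exists c, v = Tb *m c) -> (forall c : 'cV_k, Tb *m c = 0 -> c = 0) ->
  x *m Tb = Tb *m xT -> ev x 0%VS T l <-> evm xT l.
Proof.
move=> TE Ti xE; rewrite evm_col; split.
  case=> y [/TE [c ->] ny]; rewrite memv0 in ny.
  rewrite memv0 mulmxA xE -mulmxA scalemxAr -mulmxBr => /eqP /Ti e.
  exists c; first by apply: contraNneq ny => ->; rewrite mulmx0.
  by apply/eqP; rewrite -subr_eq0 e.
case=> c c0 e; exists (Tb *m c); split; first by apply/TE; exists c.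
  by rewrite memv0; apply: contraNneq c0 => /Ti ->.
by rewrite memv0 mulmxA xE -mulmxA e scalemxAr subrr.
Qed.

(** Spectrum of the Sylvester operator eta -> x eta - eta a. A column eigenvector of x times a row
    eigenvector of a is an eigenvector. *)
Lemma evm_tensor t c (x : 'M[F]_t) (a : 'M[F]_c) l :
  (exists2 eta : 'M_(t, c), eta != 0 & x *m eta - eta *m a = l *: eta) <->
  exists al be, [/\ evm x al, evm a be & l = al - be].
Proof.
split; last first.
  case=> al [be [/evm_col [v v0 ve] /evm_row [w w0 we] ->]]; exists (v *m w).
    apply: contraNneq v0 => /matrixP e; have [j wj] : exists j, w 0 j != 0.
      by apply/existsP; move: w0; apply: contraNT => /existsPn h; apply/eqP/rowP => j; rewrite mxE; apply/eqP; move: (h j); rewrite negbK.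
    apply/eqP/colP => i; have := e i j; rewrite !mxE big_ord1 => /eqP.
    by rewrite mulf_eq0 (negPf wj) orbF => /eqP.
  by rewrite mulmxA ve -mulmxA we -scalemxAl -scalemxAr scalerBl.
case=> eta eta0 e.
have eE : eta *m a = (x - l%:M) *m eta.
  by rewrite mulmxBl mul_scalar_mx -e opprB addrC subrK.
(* Since eta a = (x - l) eta, the kernel of eta is stable under a. An eigenvector w of a modulo this
   kernel, of value be, has eta w as eigenvector of x, of value be + l. *)
pose X := lker (linfun (mulmx eta) : 'Hom('cV[F]_c, 'cV_t)).
have XE v : v \in X = (eta *m v == 0) by rewrite memv_ker lfunE.
have [|||be [w [_ wX]]] := @ev_exists _ a X fullv.
- apply: contraNN eta0 => /subvP h; apply/eqP/matrixP => i j.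
  have := h (delta_mx j 0) (memvf _); rewrite XE -colE => /eqP /colP /(_ i).
  by rewrite !mxE.
- by move=> v; rewrite !XE mulmxA eE -mulmxA => /eqP ->; rewrite mulmx0.
- by move=> v _; rewrite memvf.
rewrite XE mulmxBr mulmxA eE => hw; exists (be + l), be; split.
- apply/evm_col; exists (eta *m w); first by rewrite -XE.
  move: hw; rewrite subr_eq0 -scalemxAr mulmxBl mulmxBl mul_scalar_mx -scalemxAl subr_eq => /eqP.
  by rewrite mulmxA scalerDl => ->.
- have : ev a 0%VS fullv be.
    apply/(@ev_split _ a 0%VS X fullv be) => //; rewrite ?sub0v ?subvf //.
    + by move=> v; rewrite !memv0 => /eqP ->; rewrite mulmx0.
    + by move=> v; rewrite !XE mulmxA eE -mulmxA => /eqP ->; rewrite mulmx0.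
    right; exists w; split; rewrite ?memvf //.
    rewrite XE mulmxBr mulmxA eE //.
  case=> v [_]; rewrite !memv0 subr_eq0 => v0 /eqP ve.
  by apply/evm_col; exists v.
- by rewrite addrAC subrr add0r.
Qed.

End Spectrum.

(** * Intervals of eigenvalues *)

Section Intervals.
Variable F : numClosedFieldType.

(* Throughout, e = true is the symplectic case and e = false the orthogonal one. *)
Definition off (e : bool) : F := if e then 2^-1 else 0.
Definition bd (e : bool) : int := if e then 0 else 1.

(* [bd] is what makes differences of two good sets, united with their reflection
   under l -> 1 - l, an interval without gaps. *)
Definition good (e : bool) (P : F -> Prop) : Prop :=
  exists lo hi : int, [/\ lo <= bd e, 0 <= hi, lo <= hi &
    forall l, P l <-> exists i : int, lo <= i <= hi /\ l = off e + i%:~R].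

Definition unbroken (m : nat) (S : F -> Prop) : Prop :=
  forall l, S l <-> exists i : int, (1 - m%:Z <= i <= m%:Z) /\ l = i%:~R.

Lemma off_inj e (i j : int) : off e + i%:~R = off e + j%:~R -> i = j.
Proof. by move/addrI/intr_inj. Qed.

(** This fixes [bd]: the reflection l -> 1 - l sends off + i to off + (bd - i), so on indices it is
    i -> bd - i. *)
Lemma off2 e : off e + off e = (1 - bd e)%:~R.
Proof.
case: e => /=; last by rewrite addr0.
have n2 : (2 : F) != 0 by rewrite pnatr_eq0.
by rewrite subr0; field.
Qed.

Lemma good_ext e P Q : (forall l, P l <-> Q l) -> good e P -> good e Q.
Proof.
move=> PQ [lo [hi [a b c h]]]; exists lo, hi; split=> // l.
by rewrite -PQ.
Qed.

(** Each index interval contains 0 or [bd e], and these are equal or consecutive, so the union has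
    no gap. *)
Lemma good_union e P Q : good e P -> good e Q -> good e (fun l => P l \/ Q l).
Proof.
move=> [lo [hi [a b c h]]] [lo' [hi' [a' b' c' h']]].
have bde : bd e <= 1 by case: (e).
exists (Num.min lo lo'), (Num.max hi hi'); split; try lia.
move=> l; rewrite h h'; split.
  by case=> -[i [hi1 ->]]; exists i; split=> //; lia.
case=> i [hi1 ->].
case: (boolP (lo <= i <= hi)) => hh; first by left; exists i.
by right; exists i; split=> //; lia.
Qed.

Lemma good_refl e P : good e P -> good e (fun l => P (1 - l)).
Proof.
move=> [lo [hi [a b c h]]]; exists (bd e - hi), (bd e - lo); split; try lia.
move=> l; rewrite h; have o2 := off2 e; rewrite rmorphB /= in o2.
have E (i : int) : 1 - (off e + i%:~R) = off e + (bd e - i)%:~R.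
  rewrite rmorphB /=; apply: (addrI (off e + i%:~R)).
  have -> : off e + i%:~R + (off e + ((bd e)%:~R - i%:~R)) = off e + off e + (bd e)%:~R by ring.
  by rewrite o2; ring.
split=> -[i [ii]].
  move=> li; exists (bd e - i); split; first lia.
  by rewrite -E -li subKr.
by move=> ->; exists (bd e - i); split; [lia | rewrite E].
Qed.

Lemma good_single e P (i : int) :
  (exists l, P l) -> (forall l, P l -> l = off e + i%:~R) -> 0 <= i <= bd e -> good e P.
Proof.
move=> [l0 Pl0] h ib; exists i, i; split; try lia.
move=> l; split=> [/h ->|[j [ji ->]]]; first by exists i; split=> //; lia.
have -> : j = i by lia.
by rewrite -(h _ Pl0).
Qed.

(** For G the spectrum on T1 and P the one on T1 / K, where spec a = P - 1. As P lies in G, the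
    shifted set adds at most the index just below G. *)
Lemma good_shift_l e G P : good e G -> good e P -> (forall l, P l -> G l) ->
  good e (fun l => P (l + 1) \/ G l).
Proof.
move=> [lo [hi [a b c h]]] [l0 [h0 [a' b' c' h']]] PG.
have sub i : l0 <= i <= h0 -> lo <= i <= hi.
  move=> ii; have /PG/h [j [jj /off_inj ->]] // : P (off e + i%:~R) by apply/h'; exists i.
have s1 := sub l0; have s2 := sub h0.
exists (Num.min lo (l0 - 1)), hi; split; try lia.
move=> l; rewrite h h'; split.
  case=> -[i [ii]]; last by exists i; split=> //; lia.
  move=> li; exists (i - 1); split; first lia.
  by rewrite rmorphB /= addrA -li addrK.
case=> i [ii ->].
case: (boolP (lo <= i <= hi)) => hh; first by right; exists i.
left; exists (i + 1); split; first by lia.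
by rewrite rmorphD /= addrA.
Qed.

(** For P the spectrum on T1 when spec a = G - 1. As P lies in G, it adds at most the top index of
    G. *)
Lemma good_shift_r e G P : good e G -> good e P -> (forall l, P l -> G l) ->
  good e (fun l => G (l + 1) \/ P l).
Proof.
move=> [lo [hi [a b c h]]] [l0 [h0 [a' b' c' h']]] PG.
have sub i : l0 <= i <= h0 -> lo <= i <= hi.
  move=> ii; have /PG/h [j [jj /off_inj ->]] // : P (off e + i%:~R) by apply/h'; exists i.
have s1 := sub l0; have s2 := sub h0.
exists (lo - 1), (Num.max (hi - 1) h0); split; try lia.
move=> l; rewrite h h'; split.
  case=> -[i [ii]]; last by exists i; split=> //; lia.
  move=> li; exists (i - 1); split; first lia.
  by rewrite rmorphB /= addrA -li addrK.
case=> i [ii ->].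
case: (boolP (l0 <= i <= h0)) => hh; first by right; exists i.
left; exists (i + 1); split; first by lia.
by rewrite rmorphD /= addrA.
Qed.

(** On indices P = [lo, hi] and Q + 1 = [lo', hi'], so SV = [p, q], and a common value of P and Q +
    1 gives p <= 1 <= q. Thus SV contains 1 and its reflection contains 0: together they form an
    interval symmetric about 1/2, and of two such intervals one contains the other. *)
Lemma unbroken_union e (P Q SV S S' : F -> Prop) m :
  good e P -> good e (fun l => Q (l - 1)) ->
  (exists l, P l /\ Q (l - 1)) ->
  (forall l, SV l <-> exists al be, [/\ P al, Q be & l = al - be]) ->
  unbroken m S' ->
  (forall l, S l <-> [\/ SV l, SV (1 - l) | S' l]) ->
  exists m', unbroken m' S.
Proof.
move=> [lo [hi [a b c h]]] [lo' [hi' [a' b' c' h']]] [l0 [Pl0 Ql0]] hSV uS' hS.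
pose p : int := lo - hi' + 1; pose q : int := hi - lo' + 1.
have hQ l : Q l <-> exists i : int, lo' <= i <= hi' /\ l + 1 = off e + i%:~R.
  by rewrite -h' addrK.
have [p1 q1] : p <= 1 /\ 1 <= q.
  move/h: Pl0 => [i [ii li]]; move/h': Ql0 => [j [jj lj]].
  have ij : i = j by apply: (@off_inj e); rewrite -li -lj.
  rewrite /p /q; lia.
have SVE l : SV l <-> exists i : int, p <= i <= q /\ l = i%:~R.
  rewrite hSV; split.
    case=> al [be [/h [i [ii ->]] /hQ [j [jj bj]] ->]]; exists (i - j + 1); split.
      rewrite /p /q; lia.
    have -> : be = off e + j%:~R - 1 by rewrite -bj addrK.
    by rewrite rmorphD rmorphB /=; ring.
  case=> k [kk ->].
  have [i [j [ii jj ijk]]] : exists i j : int, [/\ lo <= i <= hi, lo' <= j <= hi' & k = i - j + 1].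
    case: (lerP (k - 1 + hi') hi) => hh.
      by exists (k - 1 + hi'), hi'; rewrite /p /q in kk; split; lia.
    by exists hi, (hi - k + 1); rewrite /p /q in kk; split; lia.
  exists (off e + i%:~R), (off e + j%:~R - 1); split.
  - by apply/h; exists i.
  - by apply/hQ; exists j; rewrite subrK.
  - by rewrite ijk rmorphD rmorphB /=; ring.
exists (maxn (maxn (absz q) (absz (1 - p))) m) => l.
rewrite hS; split.
  case=> [/SVE [i [ii ->]]|/SVE [i [ii li]]|/uS' [i [ii ->]]].
  - by exists i; split=> //; lia.
  - exists (1 - i); split; first by lia.
    by rewrite rmorphB /= -li subKr.
  - by exists i; split=> //; lia.
case=> i [ii ->].
case: (boolP (p <= i <= q)) => i1; first by constructor 1; apply/SVE; exists i.
case: (boolP (p <= 1 - i <= q)) => i2.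
  by constructor 2; apply/SVE; exists (1 - i); rewrite rmorphB.
by constructor 3; apply/uS'; exists i; split=> //; lia.
Qed.

(** Reflection sends -2 to 3, which is out of range, so -2 does not occur; -1 and 2 occur together
    or not at all. *)
Lemma unbroken_small (S : F -> Prop) :
  S 0 -> (forall l, S l -> S (1 - l)) ->
  (forall l, S l -> exists i : int, - 2 <= i <= 2 /\ l = i%:~R) ->
  exists m, unbroken m S.
Proof.
move=> S0 Ssym Sint.
have S1 : S 1 by have := Ssym _ S0; rewrite subr0.
have neg2 : ~ S (- 2).
  move=> /Ssym /Sint [i [ii]] e.
  have : (3 : int) = i by apply: (@intr_inj F); rewrite -e; ring.
  lia.
case: (classic (S 2)) => S2.
  have Sm : S (- 1) by have := Ssym _ S2; congr S; ring.
  exists 2%N => l; split.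
    move=> Sl; have [i [ii li]] := Sint _ Sl; exists i; split=> //.
    suff : i <> - 2 by lia.
    by move=> e; apply: neg2; rewrite e in li; rewrite -[- 2]/((- 2)%:~R) -li.
  case=> i [ii ->].
  have : [\/ i = -1, i = 0, i = 1 | i = 2].
    by case: (i =P -1) => ?; [constructor 1|case: (i =P 0) => ?; [constructor 2|case: (i =P 1)=> ?; [constructor 3|constructor 4; lia]]].
  by case=> ->.
exists 1%N => l; split.
  move=> Sl; have [i [ii li]] := Sint _ Sl; exists i; split=> //.
  suff : i <> - 2 /\ i <> 2 /\ i <> -1 by lia.
  split; [|split] => e; rewrite e in li.
  - by apply: neg2; rewrite -[- 2]/((- 2)%:~R) -li.
  - by apply: S2; rewrite -[2]/((2)%:~R) -li.
  - by apply: S2; have := Ssym _ Sl; rewrite li; congr S; ring.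
case=> i [ii ->].
have : i = 0 \/ i = 1 by lia.
by case=> ->.
Qed.

End Intervals.

(** * Bilinear forms and isotropic chains *)

Section Forms.
Variable F : numClosedFieldType.

Lemma mx_ext m n (A B : 'M[F]_(m, n)) : (forall v : 'cV_n, A *m v = B *m v) -> A = B.
Proof.
move=> h; apply/matrixP => i j.
by have /colP/(_ i) := h (delta_mx j 0); rewrite -!colE !mxE.
Qed.

Lemma col_basis N (Y : {vspace 'cV[F]_N}) :
  exists (B : 'M[F]_(N, \dim Y)) (L : 'M[F]_(\dim Y, N)),
    L *m B = 1%:M /\ (forall v, v \in Y <-> exists c, v = B *m c).
Proof.
pose B : 'M[F]_(N, \dim Y) := \matrix_(i, j) (vbasis Y)`_j i 0.
have BE (c : 'cV_(\dim Y)) : B *m c = \sum_j c j 0 *: (vbasis Y)`_j.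
  apply/colP => i; rewrite summxE !mxE; apply: eq_bigr => j _; rewrite !mxE mulrC //.
have Binj (c : 'cV_(\dim Y)) : B *m c = 0 -> c = 0.
  rewrite BE => e; apply/colP => j; rewrite mxE.
  have /freeP fr := basis_free (vbasisP Y); exact: (fr (fun j => c j 0) e j).
have /row_freeP [L LE] : row_free B^T.
  rewrite -kermx_eq0; apply/eqP/row_matrixP => i; rewrite row0.
  apply: (can_inj (@trmxK _ _ _)); rewrite trmx0; apply: Binj.
  by rewrite -{1}[B]trmxK -trmx_mul -row_mul mulmx_ker row0 trmx0.
exists B, L^T; split; first by rewrite -{1}[B]trmxK -trmx_mul LE trmx1.
move=> v; split=> [vY|[c ->]].
  exists (\col_j coord (vbasis Y) j v); rewrite BE {1}(coord_vbasis vY).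
  by apply: eq_bigr => j _; rewrite mxE.
rewrite BE memv_suml // => j _; apply: memvZ.
by apply/vbasis_mem/mem_nth; rewrite size_tuple.
Qed.

Definition sg (e : bool) : F := if e then -1 else 1.

Variables (e : bool) (N : nat) (J : 'M[F]_N).
Local Notation eps := (sg e).
Hypothesis JT : J^T = eps *: J.
Hypothesis Ju : J \in unitmx.

Lemma eps2 : eps * eps = 1.
Proof. by rewrite /sg; case: e; rewrite ?mulrNN mulr1. Qed.

Definition w (a b : 'cV[F]_N) : F := (a^T *m J *m b) 0 0.

Lemma wDl a b c : w (a + b) c = w a c + w b c.
Proof. by rewrite /w linearD /= !mulmxDl mxE. Qed.
Lemma wDr a b c : w a (b + c) = w a b + w a c.
Proof. by rewrite /w mulmxDr mxE. Qed.
Lemma wZl k a b : w (k *: a) b = k * w a b.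
Proof. by rewrite /w linearZ /= -!scalemxAl mxE. Qed.
Lemma wZr k a b : w a (k *: b) = k * w a b.
Proof. by rewrite /w -!scalemxAr mxE. Qed.
Lemma w0l a : w 0 a = 0.
Proof. by rewrite /w trmx0 !mul0mx mxE. Qed.
Lemma w0r a : w a 0 = 0.
Proof. by rewrite /w mulmx0 mxE. Qed.
Lemma wNl a b : w (- a) b = - w a b.
Proof. by rewrite -scaleN1r wZl mulN1r. Qed.
Lemma wNr a b : w a (- b) = - w a b.
Proof. by rewrite -scaleN1r wZr mulN1r. Qed.
Lemma wBl a b c : w (a - b) c = w a c - w b c.
Proof. by rewrite wDl wNl. Qed.
Lemma wBr a b c : w a (b - c) = w a b - w a c.
Proof. by rewrite wDr wNr. Qed.

Lemma wC a b : w a b = eps * w b a.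
Proof.
rewrite /w; have -> : (a^T *m J *m b) 0 0 = (a^T *m J *m b)^T 0 0 by rewrite [RHS]mxE.
by rewrite !trmx_mul trmxK JT -!scalemxAl -!scalemxAr mxE mulmxA.
Qed.

Lemma wC0 a b : w a b = 0 -> w b a = 0.
Proof. by move=> h; rewrite wC h mulr0. Qed.

Lemma w_nondeg a : (forall b, w a b = 0) -> a = 0.
Proof.
move=> h; have : a^T *m J = 0.
  apply: mx_ext => v; rewrite mul0mx; apply/matrixP => i j.
  by rewrite !ord1; have := h v; rewrite /w => ->; rewrite mxE.
move/(congr1 (mulmx^~ (invmx J))); rewrite mulmxK // mul0mx => /(congr1 trmx).
by rewrite trmxK trmx0.
Qed.

Lemma clsP x : x \in cls J <-> x^T *m J = - (J *m x).
Proof.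
rewrite memv_ker linfun_linE.
  by rewrite addr_eq0; split=> [/eqP|->].
move=> a y z; rewrite linearD linearZ /= mulmxDl mulmxDr -scalemxAl -scalemxAr scalerDr.
by rewrite addrACA.
Qed.

Lemma cls_w x a b : x \in cls J -> w (x *m a) b = - w a (x *m b).
Proof.
move/clsP => xE; rewrite /w trmx_mul -(mulmxA a^T) xE mulmxN mulNmx mxE.
by rewrite !mulmxA.
Qed.

Lemma cls_of_w x : (forall a b, w (x *m a) b = - w a (x *m b)) -> x \in cls J.
Proof.
move=> h; apply/clsP; apply: mx_ext => v; apply/colP => i.
have := h (delta_mx i 0) v; rewrite /w trmx_mul trmx_delta -!mulmxA -!rowE.
by rewrite [LHS]mxE [X in - X]mxE mulNmx -mulmxA => ->; rewrite [RHS]mxE.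
Qed.

Lemma lie_cls x y : x \in cls J -> y \in cls J -> lie x y \in cls J.
Proof.
move=> xc yc; apply: cls_of_w => a b.
by rewrite /lie !mulmxBl wBl wBr -!mulmxA !cls_w // !opprK opprB.
Qed.

(** The second clause makes x vanish on W^perp. For nondegenerate W this is the stabiliser of the
    chains in the algebra of W, extended by zero, so that all smaller W are handled with matrices of
    one size. *)
Definition Reg (W : {vspace 'cV[F]_N}) (U T : seq {vspace 'cV[F]_N}) (x : 'M[F]_N) : Prop :=
  [/\ x \in cls J,
      forall v, (forall w0, w0 \in W -> w v w0 = 0) -> x *m v = 0,
      forall Y, Y \in U -> stable x Y & forall Y, Y \in T -> stable x Y].

Fixpoint chain (X : {vspace 'cV[F]_N}) (s : seq {vspace 'cV[F]_N}) : Prop :=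
  if s is Y :: s' then [/\ (X <= Y)%VS, ~~ (Y <= X)%VS & chain Y s'] else True.

(** The pairing is perfect on one side only, because Y and Z may have different dimensions. *)
Definition transv (Y Z : {vspace 'cV[F]_N}) : Prop :=
  (forall u, u \in Y -> (forall z, z \in Z -> w u z = 0) -> u = 0) \/
  (forall z, z \in Z -> (forall u, u \in Y -> w u z = 0) -> z = 0).

Definition nondeg (W : {vspace 'cV[F]_N}) : Prop :=
  forall v, v \in W -> (forall w0, w0 \in W -> w v w0 = 0) -> v = 0.

Definition isotropic (Y : {vspace 'cV[F]_N}) : Prop :=
  forall a b, a \in Y -> b \in Y -> w a b = 0.

Definition wf W U T : Prop :=
  [/\ nondeg W,
      (forall Y, Y \in U ++ T -> (Y <= W)%VS /\ isotropic Y),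
      chain 0 U /\ chain 0 T,
      (forall Y Z, Y \in U -> Z \in T -> transv Y Z) &
      (e = false -> odd (\dim W))].

Fixpoint allgood (h : 'M[F]_N) (X : {vspace 'cV[F]_N}) (s : seq {vspace 'cV[F]_N}) : Prop :=
  if s is Y :: s' then good e (ev h X Y) /\ allgood h Y s' else True.

Lemma Reg_sub W U T a x y : Reg W U T x -> Reg W U T y -> Reg W U T (a *: x + y).
Proof.
move=> [x1 x2 x3 x4] [y1 y2 y3 y4]; split.
- by rewrite memvD ?memvZ.
- by move=> v vW; rewrite mulmxDl -scalemxAl x2 // y2 // scaler0 addr0.
- by move=> Y YU v vY; rewrite mulmxDl -scalemxAl memvD ?memvZ // ?(x3 Y) ?(y3 Y).
- by move=> Y YU v vY; rewrite mulmxDl -scalemxAl memvD ?memvZ // ?(x4 Y) ?(y4 Y).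
Qed.

Lemma Reg0 W U T : Reg W U T 0.
Proof.
split=> [|v _|Y _ v _|Y _ v _]; rewrite ?mul0mx ?mem0v //.
Qed.

Lemma Reg_exists W U T : exists g : {vspace 'M[F]_N}, forall x, x \in g <-> Reg W U T x.
Proof. by apply: subspace_exists; [exact: Reg0 | move=> *; exact: Reg_sub]. Qed.

Lemma Reg_lie W U T x y : Reg W U T x -> Reg W U T y -> Reg W U T (lie x y).
Proof.
move=> [x1 x2 x3 x4] [y1 y2 y3 y4]; split.
- exact: lie_cls.
- by move=> v vW; rewrite /lie mulmxBl -!mulmxA (x2 v vW) (y2 v vW) !mulmx0 subr0.
- by move=> Y YU v vY; rewrite /lie mulmxBl -!mulmxA memvB // ?(x3 Y) ?(y3 Y) ?(x3 Y).
- by move=> Y YU v vY; rewrite /lie mulmxBl -!mulmxA memvB // ?(x4 Y) ?(y4 Y) ?(x4 Y).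
Qed.

Lemma Reg_swap W U T x : Reg W U T x <-> Reg W T U x.
Proof. by split=> -[]; split. Qed.

(** [p] is the orthogonal projection onto the span of the columns of B; the last equation is its
    self-adjointness. *)
Lemma nondeg_gram k (B : 'M[F]_(N, k)) :
  B^T *m J *m B \in unitmx ->
  let p := B *m invmx (B^T *m J *m B) *m B^T *m J in
  [/\ p *m B = B, (B^T *m J) *m p = B^T *m J & p^T *m J = J *m p].
Proof.
move=> Gu p; split.
- by rewrite /p -!mulmxA (mulmxA B^T) mulVmx // mulmx1.
- by rewrite /p !mulmxA mulmxV // mul1mx.
rewrite /p; set G := B^T *m J *m B.
have GT : G^T = eps *: G by rewrite /G !trmx_mul trmxK JT -scalemxAl -scalemxAr mulmxA.
have GiT : (invmx G)^T = eps *: invmx G.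
  rewrite trmx_inv GT; apply: (can_inj (mulKmx Gu)).
  have e2 := eps2.
  have Gu' : eps *: G \in unitmx.
    by rewrite unitmxZ // unitfE; apply/eqP => e0; move: e2; rewrite e0 mul0r => /eqP; rewrite eq_sym oner_eq0.
  rewrite -[G in G *m invmx _]scale1r -e2 -scalerA -scalemxAl mulmxV //.
  by rewrite -scalemxAr mulmxV.
by rewrite !trmx_mul trmxK GiT JT -!scalemxAl -!scalemxAr -!scalemxAl scalerA eps2 scale1r !mulmxA.
Qed.

End Forms.

(** * Splitting off a nondegenerate subspace *)

Section Split.
Variables (F : numClosedFieldType) (e : bool) (N : nat) (J : 'M[F]_N).
Local Notation eps := (sg F e).
Hypothesis JT : J^T = eps *: J.
Hypothesis Ju : J \in unitmx.
Local Notation w := (w J).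
Local Notation wC := (wC JT).
Local Notation wC0 := (wC0 JT).

Lemma wE k l (B : 'M[F]_(N, k)) (D : 'M[F]_(N, l)) (c : 'cV_k) (d : 'cV_l) :
  w (B *m c) (D *m d) = (c^T *m (B^T *m J *m D) *m d) 0 0.
Proof. by rewrite /w trmx_mul !mulmxA. Qed.

Lemma mx_bilin0 k l (M : 'M[F]_(k, l)) :
  (forall (c : 'cV_k) (d : 'cV_l), (c^T *m M *m d) 0 0 = 0) -> M = 0.
Proof.
move=> h; apply/matrixP => i j; rewrite [RHS]mxE -[RHS](h (delta_mx i 0) (delta_mx j 0)).
by rewrite trmx_delta -rowE -colE !mxE.
Qed.

Lemma mx_w0 k l (B : 'M[F]_(N, k)) (D : 'M[F]_(N, l)) :
  (forall c d, w (B *m c) (D *m d) = 0) -> B^T *m J *m D = 0.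
Proof. by move=> h; apply: mx_bilin0 => c d; rewrite -wE. Qed.

Lemma mx_w0v k (B : 'M[F]_(N, k)) v :
  (forall c, w (B *m c) v = 0) -> B^T *m J *m v = 0.
Proof.
move=> h; apply: mx_w0 => c d; rewrite [d]mx11_scalar mul_mx_scalar.
by rewrite wZr h mulr0.
Qed.

Lemma w_mx0v k (B : 'M[F]_(N, k)) v c : B^T *m J *m v = 0 -> w (B *m c) v = 0.
Proof. by move=> h; rewrite /w trmx_mul -!mulmxA (mulmxA _ J) h mulmx0 mxE. Qed.

Lemma gram_unit k (B : 'M[F]_(N, k)) :
  (forall c, (forall d, w (B *m c) (B *m d) = 0) -> c = 0) -> B^T *m J *m B \in unitmx.
Proof.
move=> h; rewrite unitmxE unitfE; apply/negP => /det0P [v v0 e0].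
case/negP: v0; rewrite -trmx_eq0; apply/eqP/h => d.
by rewrite wE trmxK e0 mul0mx mxE.
Qed.

Section OneSplit.
Variables (W : {vspace 'cV[F]_N}) (k : nat) (B : 'M[F]_(N, k)).
Hypothesis Wn : nondeg J W.
Hypothesis BW : forall c, B *m c \in W.
Hypothesis Bu : B^T *m J *m B \in unitmx.

Definition gproj : 'M[F]_N := B *m invmx (B^T *m J *m B) *m B^T *m J.
Definition cperp : {vspace 'cV[F]_N} :=
  (W :&: lker (linfun (mulmx (B^T *m J)) : 'Hom('cV[F]_N, 'cV[F]_k)))%VS.
Local Notation p := gproj.
Local Notation W2 := cperp.

Lemma cperpE v : v \in W2 = (v \in W) && (B^T *m J *m v == 0).
Proof. by rewrite memv_cap memv_ker lfunE. Qed.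

Lemma cperpP v : v \in W2 <-> v \in W /\ B^T *m J *m v = 0.
Proof. by rewrite cperpE; split=> [/andP[? /eqP]|[-> ->]] //; rewrite eqxx. Qed.

Lemma cperp_sub : (W2 <= W)%VS.
Proof. exact: capvSl. Qed.

Lemma gprojB : p *m B = B. Proof. by case: (nondeg_gram JT Bu). Qed.
Lemma gprojBT : B^T *m J *m p = B^T *m J. Proof. by case: (nondeg_gram JT Bu). Qed.
Lemma gprojT : p^T *m J = J *m p. Proof. by case: (nondeg_gram JT Bu). Qed.

Lemma gprojE (v : 'cV[F]_N) : p *m v = B *m (invmx (B^T *m J *m B) *m (B^T *m J *m v)).
Proof. by rewrite /gproj !mulmxA. Qed.

Lemma gprojW (v : 'cV[F]_N) : p *m v \in W.
Proof. by rewrite gprojE. Qed.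

Lemma capWE v (Y : {vspace 'cV[F]_N}) : (v \in (Y :&: W2)%VS) = (v \in Y) && (v \in W2).
Proof. exact: memv_cap. Qed.

Lemma gproj_cperp v : v \in W2 -> p *m v = 0.
Proof. by move/cperpP => [_ h]; rewrite gprojE h !mulmx0. Qed.

Lemma w_gproj a b : w (p *m a) b = w a (p *m b).
Proof. by rewrite /w trmx_mul -(mulmxA a^T) gprojT !mulmxA. Qed.

Lemma w_cperpB v c : v \in W2 -> w (B *m c) v = 0.
Proof. by move/cperpP => [_ h]; exact: w_mx0v. Qed.

Lemma w_Bcperp v c : v \in W2 -> w v (B *m c) = 0.
Proof. by move=> h; apply: wC0; exact: w_cperpB. Qed.

Lemma compl_cperp v : v \in W -> v - p *m v \in W2.
Proof.
move=> vW; apply/cperpP; split; first by rewrite memvB ?gprojW.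
by rewrite mulmxBr mulmxA gprojBT subrr.
Qed.

Lemma cperp_nondeg : nondeg J W2.
Proof.
move=> v vW2 h; apply: Wn; first exact: (subvP cperp_sub).
move=> w0 w0W; rewrite -(subrK (p *m w0) w0) wDr h ?compl_cperp // add0r.
by rewrite gprojE w_Bcperp.
Qed.

Lemma cperp_dim : (\dim W2 + k)%N = \dim W.
Proof.
have := limg_ker_dim (linfun (mulmx (B^T *m J)) : 'Hom('cV[F]_N, 'cV[F]_k)) W.
suff -> : (linfun (mulmx (B^T *m J)) @: W)%VS = (fullv : {vspace 'cV[F]_k}).
  by rewrite dimvf /dim /= muln1.
apply/eqP; rewrite eqEsubv subvf /=; apply/subvP => c _.
apply/memv_imgP; exists (B *m invmx (B^T *m J *m B) *m c); first by rewrite -mulmxA.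
by rewrite lfunE /= !mulmxA mulmxV // mul1mx.
Qed.

(** Compression of x to [W2], which x need not preserve; it stays in the algebra because 1 - p is
    self-adjoint. *)
Definition cpr (x : 'M[F]_N) : 'M[F]_N := (1%:M - p) *m x *m (1%:M - p).

Lemma cprE x (v : 'cV[F]_N) : cpr x *m v = x *m (v - p *m v) - p *m (x *m (v - p *m v)).
Proof. by rewrite /cpr; move: p => q; rewrite -!mulmxA !mulmxBl !mul1mx. Qed.

Lemma cpr_cperp x v : v \in W2 -> cpr x *m v = x *m v - p *m (x *m v).
Proof. by move=> vW; rewrite cprE gproj_cperp // subr0. Qed.

Lemma w_compl a b : w (a - p *m a) b = w a (b - p *m b).
Proof. by rewrite wBl wBr w_gproj. Qed.

Lemma cpr_cls x : x \in cls J -> cpr x \in cls J.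
Proof.
move=> xc; apply: cls_of_w => a b; rewrite !cprE.
by rewrite w_compl cls_w // w_compl.
Qed.

Lemma cpr_kill x (v : 'cV[F]_N) : (forall u, (forall w0, w0 \in W -> w u w0 = 0) -> x *m u = 0) ->
  (forall w0, w0 \in W2 -> w v w0 = 0) -> cpr x *m v = 0.
Proof.
move=> xW vW; rewrite cprE xW ?mulmx0 ?subr0 // => w0 w0W.
by rewrite w_compl vW // compl_cperp.
Qed.

Definition capW (s : seq {vspace 'cV[F]_N}) := [seq (Y :&: W2)%VS | Y <- s].

Lemma cpr_stable x Y : (Y <= W)%VS -> stable x Y -> (forall y, y \in Y -> p *m y \in Y) ->
  stable (cpr x) (Y :&: W2)%VS.
Proof.
move=> YW sx sp v; rewrite !capWE => /andP [vY vW].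
rewrite cpr_cperp // compl_cperp ?andbT; last by apply: (subvP YW); apply: sx.
by rewrite memvB ?sp ?sx.
Qed.

Lemma chain_mem (X Y : {vspace 'cV[F]_N}) (s : seq {vspace 'cV[F]_N}) : chain X s -> Y \in s -> (X <= Y)%VS.
Proof.
elim: s X => [|Z s IH] X //= [XZ _ cs]; rewrite inE => /predU1P [->|] //.
by move/(IH _ cs); apply: subv_trans.
Qed.

(** When p sends the members into X, each vector y of a member is y - p y, which lies in [W2], plus
    an element of X. So strict inclusions survive the intersection with [W2]. *)
Lemma chain_cap (X : {vspace 'cV[F]_N}) (s : seq {vspace 'cV[F]_N}) : (forall Y y, Y \in s -> y \in Y -> p *m y \in X) ->
  (forall Y, Y \in s -> (Y <= W)%VS) ->
  chain X s -> chain (X :&: W2)%VS (capW s).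
Proof.
elim: s X => [|Y s IH] X //= sp sW [XY YX cs]; split.
- exact: capvS.
- apply: contra YX => /subvP h; apply/subvP => y yY.
  have pX : p *m y \in X by apply: (sp Y); rewrite ?inE ?eqxx.
  rewrite -(subrK (p *m y) y) memvD //.
  have /h : y - p *m y \in (Y :&: W2)%VS.
    have YW : (Y <= W)%VS by apply: sW; rewrite inE eqxx.
    have pY := subvP XY _ pX.
    by rewrite capWE compl_cperp ?(subvP YW) // andbT memvB.
  by rewrite capWE => /andP[].
apply: IH => // [Z y Zs yZ|Z Zs].
  by apply: (subvP XY); apply: (sp Z); rewrite // inE Zs orbT.
by apply: sW; rewrite inE Zs orbT.
Qed.

Lemma transv_cap Y Z : (Y <= W)%VS -> (Z <= W)%VS ->
  (forall y, y \in Y -> p *m y \in Y) -> (forall y, y \in Z -> p *m y \in Z) ->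
  transv J Y Z -> transv J (Y :&: W2)%VS (Z :&: W2)%VS.
Proof.
move=> YW ZW pY pZ [h|h]; [left|right].
  move=> u; rewrite capWE => /andP[uY uW] uZ; apply: h => // z zZ.
  rewrite -(subrK (p *m z) z) wDr uZ ?add0r; first by rewrite gprojE w_Bcperp.
  by rewrite capWE compl_cperp ?(subvP ZW) // andbT memvB ?pZ.
move=> u; rewrite capWE => /andP[uY uW] uZ; apply: h => // z zZ.
rewrite -(subrK (p *m z) z) wDl uZ ?add0r; first by rewrite gprojE w_cperpB.
by rewrite capWE compl_cperp ?(subvP YW) // andbT memvB ?pY.
Qed.

(** As p Y lies in X, the map v -> v - p v identifies Y / X with the quotient of the intersections
    with [W2], and there h and x agree modulo X. *)
Lemma ev_cap h x X Y l : (X <= Y)%VS -> (Y <= W)%VS -> stable h X ->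
  (forall y, y \in Y -> p *m y \in X) ->
  (forall v, v \in Y -> v \in W2 -> h *m v - x *m v \in X) ->
  (forall v, v \in W2 -> x *m v \in W2) ->
  ev h X Y l <-> ev x (X :&: W2)%VS (Y :&: W2)%VS l.
Proof.
move=> XY YW sX pX hx xW; split.
  case=> y [yY yX yl].
  have y'W : y - p *m y \in W2 by rewrite compl_cperp // (subvP YW).
  have y'Y : y - p *m y \in Y by rewrite memvB // (subvP XY) // pX.
  exists (y - p *m y); split.
  - by rewrite capWE y'Y.
  - apply: contra yX; rewrite capWE => /andP[yX' _].
    by rewrite -(subrK (p *m y) y) memvD ?pX.
  rewrite capWE; apply/andP; split; last by rewrite memvB ?memvZ ?xW.
  have -> : x *m (y - p *m y) - l *: (y - p *m y) = (h *m y - l *: y) - (h *m (p *m y) - l *: (p *m y))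
      - (h *m (y - p *m y) - x *m (y - p *m y)).
    rewrite (mulmxBr h); set a := h *m y; set b := h *m (p *m y); set c := x *m _.
    by apply/matrixP => i j; rewrite !mxE; ring.
  by rewrite memvB ?hx // memvB ?yl // memvB ?memvZ ?sX ?pX.
case=> y [yYW yX yl]; move: yYW yX yl; rewrite !capWE => /andP[yY yW]; rewrite yW andbT => yX /andP[yl _].
exists y; split=> //.
have -> : h *m y - l *: y = (x *m y - l *: y) + (h *m y - x *m y).
  set a := h *m y; set b := x *m y.
  by apply/matrixP => i j; rewrite !mxE; ring.
by rewrite memvD ?hx.
Qed.

Lemma allgood_cap h x (X : {vspace 'cV[F]_N}) (s : seq {vspace 'cV[F]_N}) : chain X s -> stable h X ->
  (forall Y, Y \in s -> stable h Y) -> (forall Y, Y \in s -> (Y <= W)%VS) ->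
  (forall Y y, Y \in s -> y \in Y -> p *m y \in X) ->
  (forall Y v, Y \in s -> v \in Y -> v \in W2 -> h *m v - x *m v \in X) ->
  (forall v, v \in W2 -> x *m v \in W2) ->
  allgood e x (X :&: W2)%VS (capW s) -> allgood e h X s.
Proof.
elim: s X => [|Y s IH] X //= [XY YX cs] sX sY YW pX hx xW [gY gs].
have YY : Y \in Y :: s by rewrite inE eqxx.
have Ys Z : Z \in s -> Z \in Y :: s by rewrite inE orbC => ->.
split.
  apply: good_ext gY => l; apply: iff_sym; apply: ev_cap => //.
  - exact: YW.
  - by move=> y; apply: pX.
  - by move=> v; apply: hx.
apply: IH => //; first exact: sY.
- by move=> Z /Ys; apply: sY.
- by move=> Z /Ys; apply: YW.
- by move=> Z y /Ys Zs yZ; apply: (subvP XY); apply: (pX Z).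
- by move=> Z v /Ys Zs vZ vW; apply: (subvP XY); apply: (hx Z).
Qed.

End OneSplit.

Lemma nondeg_proj W : nondeg J W -> exists q : 'M[F]_N,
  [/\ forall v, q *m v \in W, forall v, v \in W -> q *m v = v & q^T *m J = J *m q].
Proof.
move=> Wn; have [B [L [LB BE]]] := col_basis W.
have Bu : B^T *m J *m B \in unitmx.
  apply: gram_unit => c h; have : B *m c = 0.
    by apply: Wn; [apply/BE; exists c | move=> w0 /BE [d ->]].
  by move/(congr1 (mulmx L)); rewrite mulmxA LB mul1mx mulmx0.
have [p1 p2 p3] := nondeg_gram JT Bu.
exists (gproj B); split=> //.
  by move=> v; apply/BE; exists (invmx (B^T *m J *m B) *m B^T *m J *m v); rewrite /gproj !mulmxA.
by move=> v /BE [c ->]; rewrite mulmxA p1.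
Qed.

(** A skew operator that kills W^perp has its image orthogonal to W^perp, so the image is fixed by
    the projection onto W. *)
Lemma Reg_im W U T x : nondeg J W -> Reg J W U T x -> forall v, x *m v \in W.
Proof.
move=> Wn [xc xW _ _] v; have [q [q1 q2 q3]] := nondeg_proj Wn.
have wq a b : w (q *m a) b = w a (q *m b) by rewrite /w trmx_mul -(mulmxA a^T) q3 !mulmxA.
suff -> : x *m v = q *m (x *m v) by [].
apply/eqP; rewrite -subr_eq0; apply/eqP; apply: (w_nondeg Ju) => u.
rewrite wBl wq -wBr cls_w // xW ?w0r ?oppr0 // => w0 w0W.
by rewrite wBl wq (q2 _ w0W) subrr.
Qed.

Lemma perp_perp W (Y : {vspace 'cV[F]_N}) v :
  nondeg J W -> (Y <= W)%VS -> v \in W ->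
  (forall u, u \in W -> (forall y, y \in Y -> w u y = 0) -> w u v = 0) -> v \in Y.
Proof.
move=> Wn YW vW h; apply: (@double_perp _ _ (fun a b => w a b) W Y) => //.
- by move=> y a x x'; rewrite wDl wZl.
- by move=> y a x x'; rewrite wDr wZr.
- by move=> u uW uh; apply: Wn => // w0 w0W; apply: wC0; exact: uh.
Qed.

End Split.

(** * Two nonempty chains *)

Section GStep.
Variables (F : numClosedFieldType) (e : bool) (N : nat) (J : 'M[F]_N).
Local Notation eps := (sg F e).
Hypothesis JT : J^T = eps *: J.
Hypothesis Ju : J \in unitmx.
Local Notation w := (w J).
Local Notation vs := ({vspace 'cV[F]_N}).

Definition claim_state (W : vs) (U T : seq vs) : Prop :=
  forall (g : {vspace 'M[F]_N}) A h,
    (forall x, x \in g <-> Reg J W U T x) -> frob g A -> prin g A h ->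
    [/\ allgood e h 0%VS U, allgood e h 0%VS T & exists m, unbroken m (ad_eigenvalue g h)].

Definition Gc c (W : vs) (U : seq vs) (T1 : vs) (T : seq vs) (z : 'M[F]_(c + N)) : Prop :=
  exists a y x, [/\ z = block_mx a 0 y x, Reg J W U (T1 :: T) x & forall v, y *m v \in T1].

(* [Gc c] is the algebra to which a state with two nonempty chains is isomorphic;
   the good sets here are the ones recovered on both chains through that isomorphism. *)
Definition claim_G c (W : vs) (U : seq vs) (T1 : vs) (T : seq vs) : Prop :=
  forall (g : {vspace 'M[F]_(c + N)}) A a y x,
    (forall z, z \in g <-> Gc W U T1 T z) -> frob g A -> prin g A (block_mx a 0 y x) ->
    [/\ allgood e x 0%VS U, allgood e x 0%VS (T1 :: T),
        good e (fun l => evm a (l - 1)), good e (fun l => evm a l \/ ev x 0%VS T1 l) &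
        exists m, unbroken m (ad_eigenvalue g (block_mx a 0 y x))].

Lemma good_nonempty (P : F -> Prop) : good e P -> exists l, P l.
Proof.
move=> [lo [hi [_ _ le h]]]; exists (off F e + lo%:~R); apply/h; exists lo.
by rewrite lexx le.
Qed.

Lemma tr_mul0 m n (X : 'M[F]_(m, n)) : (forall Y, \tr (X *m Y) = 0) -> X = 0.
Proof.
move=> h; apply/matrixP => i j; rewrite [RHS]mxE -(h (delta_mx j i)).
rewrite /mxtrace (bigD1 i) //= big1 => [|k ki].
  rewrite addr0 mxE (bigD1 j) //= big1 => [|k kj]; last by rewrite !mxE (negPf kj) mulr0.
  by rewrite !mxE !eqxx mulr1 addr0.
by rewrite mxE big1 // => l _; rewrite !mxE (negPf ki) andbF mulr0.
Qed.

Lemma full_of_annihilator c (S : {vspace 'cV[F]_c}) :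
  (forall l : 'rV_c, (forall s, s \in S -> l *m s = 0) -> l = 0) -> forall v, v \in S.
Proof.
move=> h v; have [B [L [LB BE]]] := col_basis S.
have /row_freeP [R RE] : row_free B.
  rewrite -kermx_eq0; apply/eqP/row_matrixP => i; rewrite row0; apply: h => s /BE [k ->].
  by rewrite mulmxA -row_mul mulmx_ker row0 mul0mx.
by apply/BE; exists (R *m v); rewrite mulmxA RE mul1mx.
Qed.

Lemma lie_block c n (a a' : 'M[F]_c) (y y' : 'M_(n, c)) (x x' : 'M_n) :
  lie (block_mx a 0 y x) (block_mx a' 0 y' x') =
  block_mx (lie a a') 0 (y *m a' + x *m y' - (y' *m a + x' *m y)) (lie x x').
Proof.
rewrite /lie !mulmx_block !mul0mx !mulmx0 !addr0 !add0r.
by rewrite opp_block_mx add_block_mx oppr0 addr0.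
Qed.

Lemma tr_block c n (A : 'M[F]_(c + n)) (a : 'M[F]_c) y (x : 'M_n) :
  \tr (A *m block_mx a 0 y x) =
  \tr (ulsubmx A *m a) + \tr (ursubmx A *m y) + \tr (drsubmx A *m x).
Proof.
by rewrite -{1}(submxK A) mulmx_block mxtrace_block !mulmx0 add0r raddfD.
Qed.

(** * The ideal Hom(F^c, T1) and its orthogonal *)

Section Fix.
Variables (W : vs) (U : seq vs) (T1 : vs) (T : seq vs) (c : nat).
Hypothesis Wf : wf e J W U (T1 :: T).
Variables (g V : {vspace 'M[F]_(c + N)}) (A : 'M[F]_(c + N)).
Hypothesis gE : forall z, z \in g <-> Gc W U T1 T z.
Hypothesis VE : forall v, v \in V <-> exists2 y : 'M_(N, c), (forall u, y *m u \in T1) & v = block_mx 0 0 y 0.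
Variables (Tb : 'M[F]_(N, \dim T1)) (L : 'M[F]_(\dim T1, N)).
Hypothesis LTb : L *m Tb = 1%:M.
Hypothesis TbE : forall v, v \in T1 <-> exists k, v = Tb *m k.
Variable M : 'M[F]_(c, \dim T1).
Hypothesis ME : M = ursubmx A *m Tb.

Lemma Tb_inj (k : 'cV_(\dim T1)) : Tb *m k = 0 -> k = 0.
Proof. by move=> h; rewrite -[k]mul1mx -LTb -mulmxA h mulmx0. Qed.

Lemma T1_proj v : v \in T1 -> Tb *m (L *m v) = v.
Proof. by move/TbE => [k ->]; rewrite (mulmxA L) LTb mul1mx. Qed.

Lemma T1_cols (y : 'M_(N, c)) : (forall u, y *m u \in T1) -> y = Tb *m (L *m y).
Proof. by move=> h; apply: mx_ext => u; rewrite -!mulmxA T1_proj. Qed.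

Lemma stable_Tb x : stable x T1 -> x *m Tb = Tb *m (L *m x *m Tb).
Proof.
move=> sx; apply: mx_ext => u; rewrite -!mulmxA T1_proj //; apply: sx.
by apply/TbE; exists u.
Qed.

Lemma Gc_lie : lie_closed g.
Proof.
move=> z z' /gE [a [y [x [-> xR yT]]]] /gE [a' [y' [x' [-> xR' yT']]]].
apply/gE; rewrite lie_block; do 3 eexists; split; first by reflexivity.
  exact: Reg_lie.
have [_ _ _ sx] := xR; have [_ _ _ sx'] := xR'.
have T1T : T1 \in T1 :: T by rewrite inE eqxx.
move=> v; rewrite mulmxBl 2!mulmxDl -!mulmxA; apply: memvB; apply: memvD => //.
  exact: (sx _ T1T).
exact: (sx' _ T1T).
Qed.

Lemma Reg_T1 x : Reg J W U (T1 :: T) x -> stable x T1.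
Proof. by case=> _ _ _; apply; rewrite inE eqxx. Qed.

Lemma V_sub : (V <= g)%VS.
Proof.
apply/subvP => v /VE [y yT ->]; apply/gE; exists 0, y, 0; split=> //; exact: Reg0.
Qed.

Lemma V_ideal z v : z \in g -> v \in V -> lie z v \in V.
Proof.
move=> /gE [a [y [x [-> xR yT]]]] /VE [y' yT' ->]; rewrite lie_block.
apply/VE; exists (x *m y' - y' *m a); last first.
  by rewrite !lie0r !mulmx0 !mul0mx add0r addr0.
by move=> u; rewrite mulmxBl -!mulmxA memvB // (Reg_T1 xR).
Qed.

Lemma V_abel v v' : v \in V -> v' \in V -> \tr (A *m lie v v') = 0.
Proof.
move=> /VE [y yT ->] /VE [y' yT' ->]; rewrite lie_block !lie0r !mulmx0 !mul0mx !addr0 subrr.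
by rewrite tr_block !mulmx0 !raddf0 !addr0.
Qed.

(** Every element of V is of the form Tb eta, so V^perp is given by an intertwining condition: M x_T
    = a M, where x_T is the matrix of x on T1. *)
Lemma trV a y x eta : Reg J W U (T1 :: T) x ->
  \tr (A *m lie (block_mx a 0 y x) (block_mx 0 0 (Tb *m eta) 0)) =
  \tr ((M *m (L *m x *m Tb) - a *m M) *m eta).
Proof.
move=> xR; rewrite lie_block tr_block !lie0r !mulmx0 !raddf0 add0r addr0 mul0mx add0r addr0.
rewrite mulmxA (stable_Tb (Reg_T1 xR)) mulmxBr raddfB /= mulmxBl raddfB /= ME.
congr (_ - _); first by rewrite !mulmxA.
by rewrite !mulmxA mxtrace_mulC !mulmxA.
Qed.

Lemma V_eig a y x l : Reg J W U (T1 :: T) x ->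
  ad_eigenvalue V (block_mx a 0 y x) l <->
  exists al be, [/\ ev x 0%VS T1 al, evm a be & l = al - be].
Proof.
move=> xR; have sx := stable_Tb (Reg_T1 xR).
have E al : ev x 0%VS T1 al <-> evm (L *m x *m Tb) al by apply: ev0_evm TbE Tb_inj sx.
transitivity (exists2 eta : 'M_(\dim T1, c), eta != 0 & (L *m x *m Tb) *m eta - eta *m a = l *: eta).
  have lieE eta : lie (block_mx a 0 y x) (block_mx 0 0 (Tb *m eta) 0) =
       block_mx 0 0 (Tb *m ((L *m x *m Tb) *m eta - eta *m a)) 0.
    by rewrite lie_block !lie0r !mulmx0 !mul0mx add0r addr0 mulmxBr !mulmxA sx !mulmxA.
  have ZE (eta : 'M_(\dim T1, c)) : l *: (block_mx 0 0 (Tb *m eta) 0 : 'M_(c + N)) = block_mx 0 0 (Tb *m (l *: eta)) 0.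
    by rewrite scale_block_mx !scaler0 scalemxAr.
  split.
    case=> v [/VE [y' yT ->]]; rewrite (T1_cols yT) => v0; rewrite lieE ZE => /eq_block_mx [_ _ h _].
    exists (L *m y'); first by apply: contraNneq v0 => ->; rewrite mulmx0 block_mx0.
    by have := congr1 (mulmx L) h; rewrite !(mulmxA L Tb) LTb !mul1mx.
  case=> eta eta0 h; exists (block_mx 0 0 (Tb *m eta) 0); split.
  - by apply/VE; exists (Tb *m eta) => // u; apply/TbE; exists (eta *m u); rewrite mulmxA.
  - apply: contraNneq eta0; rewrite -(block_mx0 F c N c N) => /eq_block_mx [_ _ h' _].
    by rewrite -[eta]mul1mx -LTb -mulmxA h' mulmx0.
  by rewrite lieE h ZE.
rewrite evm_tensor; split=> -[al [be [h1 h2 h3]]]; exists al, be; split=> //; exact/E.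
Qed.

Hypothesis fr : frob g A.

(** By [trV], the rank one element Tb k l of V pairs with (a, y, x) to l (M x_T - a M) k up to sign,
    which is zero. So M has a trivial kernel on at least one side. *)
Lemma no_two_nulls (l : 'rV_c) (k : 'cV_(\dim T1)) : l *m M = 0 -> M *m k = 0 -> k *m l = 0.
Proof.
move=> lM Mk; have h : block_mx 0 0 (Tb *m (k *m l)) 0 = 0 :> 'M_(c + N).
  apply: fr.
    apply/(subvP V_sub)/VE; exists (Tb *m (k *m l)) => // u; apply/TbE.
    by exists (k *m l *m u); rewrite !mulmxA.
  move=> z /gE [a [y [x [-> xR yT]]]]; rewrite trlieC trV // mulmxA mxtrace_mulC.
  rewrite mulmxBl mulmxBr -!mulmxA Mk !mulmx0 subr0 (mulmxA l) lM mul0mx.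
  by rewrite raddf0 oppr0.
move: h; rewrite -(block_mx0 F c N c N) => /eq_block_mx [_ _ h _].
by rewrite -[k *m l]mul1mx -LTb -mulmxA h mulmx0.
Qed.

(** ad h0 is the identity on V and kills block-diagonal matrices. This is the [h0] of [reduction],
    and its corner -1 is the shift between spec a and the spectrum coming from the reduced
    algebra. *)
Lemma h0_facts :
  let h0 : 'M_(c + N) := block_mx (- 1%:M) 0 0 0 in
  [/\ h0 \in g, forall v, v \in V -> \tr (A *m lie h0 v) = \tr (A *m v) &
    forall a x, lie h0 (block_mx a 0 0 x) = 0].
Proof.
move=> h0; split.
- apply/gE; exists (- 1%:M), 0, 0; split=> //; first exact: Reg0.
  by move=> v; rewrite mul0mx mem0v.
- move=> v /VE [y yT ->]; rewrite lie_block !lie0r !mulmx0 !mul0mx !add0r !addr0.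
  by rewrite mulmxN opprK mulmx1.
- move=> a x; rewrite lie_block lie0l !mulmx0 !mul0mx !addr0 subrr.
  have -> : lie (- 1%:M) a = 0 by rewrite /lie mulmxN mulNmx mulmx1 mul1mx opprK addrC subrr.
  by rewrite block_mx0.
Qed.

(** * M is onto: its kernel K becomes the first member of the chain *)

Section NoLeftNull.
Hypothesis c0 : (0 < c)%N.
Variable Rr : 'M[F]_(\dim T1, c).
Hypothesis MR : M *m Rr = 1%:M.
Variable K : vs.
Hypothesis KE : forall v, v \in K <-> exists2 k, v = Tb *m k & M *m k = 0.

Lemma K_sub : (K <= T1)%VS.
Proof. by apply/subvP => v /KE [k -> _]; apply/TbE; exists k. Qed.

(** Otherwise some nonzero u in Y is orthogonal to K and some nonzero k0 in K is orthogonal to Y. If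
    a row l kills the image under M of T1 cap Y^perp, then Tb kap l is in the kernel of the Kirillov
    form, because x k0 stays in T1 cap Y^perp. So that image is all of F^c, hence T1 = K + (T1 cap
    Y^perp), and u is orthogonal to T1. Together u and k0 contradict the transversality of Y and
    T1. *)
Lemma K_transv Y : Y \in U -> transv J Y K.
Proof.
move=> YU; case: Wf => _ _ _ tv _.
have T1T : T1 \in T1 :: T by rewrite inE eqxx.
apply: NNPP => /not_or_and [n1 n2].
have [u {}n1] := not_all_ex_not _ _ n1; have [uY {}n1] := imply_to_and _ _ n1.
have [uK u0] := imply_to_and _ _ n1.
have [k0 {}n2] := not_all_ex_not _ _ n2; have [kK {}n2] := imply_to_and _ _ n2.
have [kY k0n] := imply_to_and _ _ n2.
have [kap kE Mkap] := (KE k0).1 kK.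
have [S SE] : exists S : {vspace 'cV[F]_c}, forall v, v \in S <->
    exists2 t, (t \in T1 /\ forall u, u \in Y -> w u t = 0) & v = M *m (L *m t).
  apply: subspace_exists.
    by exists 0; [split; [exact: mem0v | move=> *; exact: w0r] | rewrite !mulmx0].
  move=> a v v' [t [tT tY] ->] [t' [tT' tY'] ->]; exists (a *: t + t').
    split; first by rewrite memvD ?memvZ.
    by move=> u' uY'; rewrite wDr wZr tY // tY' // mulr0 addr0.
  by rewrite !mulmxDr -!scalemxAr.
have Sfull : forall v, v \in S.
  apply: full_of_annihilator => l lS.
  have h : block_mx 0 0 (Tb *m (kap *m l)) 0 = 0 :> 'M_(c + N).
    apply: fr.
      apply/(subvP V_sub)/VE; exists (Tb *m (kap *m l)) => // v; apply/TbE.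
      by exists (kap *m l *m v); rewrite !mulmxA.
    move=> z /gE [a [y [x [-> xR yT]]]]; rewrite trlieC trV // mulmxA mxtrace_mulC.
    rewrite mulmxBl -(mulmxA a) Mkap mulmx0 subr0.
    have xk : x *m k0 \in T1 by apply: (Reg_T1 xR); apply: (subvP K_sub).
    have -> : M *m (L *m x *m Tb) *m kap = M *m (L *m (x *m k0)) by rewrite kE !mulmxA.
    rewrite lS ?raddf0 ?oppr0 //; apply/SE; exists (x *m k0) => //; split=> // v vY.
    have [xc _ sU _] := xR.
    by apply: (wC0 JT); rewrite cls_w // (wC0 JT) ?oppr0 // kY // (sU Y).
  move: h; rewrite -(block_mx0 F c N c N) => /eq_block_mx [_ _ h _].
  have h' : kap *m l = 0 by rewrite -[kap *m l]mul1mx -LTb -mulmxA h mulmx0.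
  apply/eqP; apply/negPn/negP => l0; apply: k0n; rewrite kE.
  have [j lj] : exists j, l 0 j != 0.
    by apply/existsP; move: l0; apply: contraNT => /existsPn hh; apply/eqP/rowP => j; rewrite mxE; apply/eqP; move: (hh j); rewrite negbK.
  suff -> : kap = 0 by rewrite mulmx0.
  apply/colP => i; have /matrixP/(_ i j) := h'; rewrite !mxE big_ord1 => /eqP.
  by rewrite mulf_eq0 (negPf lj) orbF => /eqP.
have uT1 : forall z, z \in T1 -> w u z = 0.
  move=> z zT; have [t [tT tY] tE] := (SE (M *m (L *m z))).1 (Sfull _).
  rewrite -(subrK t z) wDr (tY _ uY) addr0; apply: uK; apply/KE; exists (L *m (z - t)).
    by rewrite T1_proj // memvB.
  by rewrite mulmxBr mulmxBr tE subrr.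
case: (tv Y T1 YU T1T) => h; first by apply: u0; apply: h.
by apply: k0n; apply: h => //; exact: (subvP K_sub).
Qed.

Lemma K_proper : ~~ (T1 <= K)%VS.
Proof.
apply/negP => /subvP h.
have M0 : M = 0.
  apply: mx_ext => k; rewrite mul0mx; have /h /KE [k' /eqP] : Tb *m k \in T1 by apply/TbE; exists k.
  by rewrite -subr_eq0 -mulmxBr => /eqP /Tb_inj /eqP; rewrite subr_eq0 => /eqP ->.
move: MR; rewrite M0 mul0mx => /matrixP /(_ (Ordinal c0) (Ordinal c0)) /eqP.
by rewrite !mxE eqxx eq_sym oner_eq0.
Qed.

Lemma wf_K : K != 0%VS -> wf e J W U (K :: T1 :: T).
Proof.
move=> K0; case: Wf => Wn iso [cU cT] tv par; split=> //.
- move=> Y; rewrite mem_cat inE orbCA => /predU1P [->|]; last first.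
    by rewrite -mem_cat; apply: iso.
  have T1T : T1 \in U ++ T1 :: T by rewrite mem_cat inE eqxx orbT.
  have [TW Ti] := iso _ T1T; split; first exact: subv_trans K_sub TW.
  by move=> a b aK bK; apply: Ti; apply: (subvP K_sub).
- split=> //=; split; [exact: sub0v | by rewrite subv0 | ].
  by case: cT => _ _ cT; split=> //; [exact: K_sub | exact: K_proper].
- move=> Y Z YU; rewrite inE => /predU1P [->|]; first exact: K_transv.
  exact: tv.
Qed.

Variable ia : 'M[F]_N -> 'M[F]_c.
Hypothesis iaE : forall x, ia x = M *m (L *m x *m Tb) *m Rr.

(** [ia x] is the action of x on T1 / K carried to F^c by M; it is well defined because x preserves
    K, the kernel of M. *)
Lemma ia_M x : Reg J W U (K :: T1 :: T) x -> ia x *m M = M *m (L *m x *m Tb).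
Proof.
move=> [_ _ _ sT]; have sK : stable x K by apply: sT; rewrite inE eqxx.
apply: mx_ext => v; rewrite !iaE -!mulmxA; apply/eqP; rewrite -subr_eq0 -!mulmxBr.
set k := Rr *m _ - v.
have Mk : M *m k = 0 by rewrite /k mulmxBr !mulmxA MR mul1mx subrr.
have /sK /KE [k' k'E Mk'] : Tb *m k \in K by apply/KE; exists k.
by rewrite k'E (mulmxA L) LTb mul1mx Mk'.
Qed.

Lemma ia_evm x l : Reg J W U (K :: T1 :: T) x -> evm (ia x) l <-> ev x K T1 l.
Proof.
move=> xR; have xM := ia_M xR.
have sT : stable x T1 by case: xR => _ _ _; apply; rewrite !inE eqxx orbT.
have key k : ia x *m (M *m k) - l *: (M *m k) = M *m (L *m (x *m (Tb *m k) - l *: (Tb *m k))).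
  rewrite mulmxA xM !(mulmxBr, =^~ scalemxAr) !mulmxA -(mulmxA M L Tb) LTb mulmx1.
  by [].
have inK t : t \in T1 -> (t \in K <-> M *m (L *m t) = 0).
  move/TbE => [k ->]; rewrite (mulmxA L) LTb mul1mx; split=> [/KE [k' /eqP]|h]; last by apply/KE; exists k.
  by rewrite -subr_eq0 -mulmxBr => /eqP /Tb_inj /eqP; rewrite subr_eq0 => /eqP ->.
rewrite evm_col; split.
  case=> v v0 ve; have vE : v = M *m (Rr *m v) by rewrite mulmxA MR mul1mx.
  have tT : Tb *m (Rr *m v) \in T1 by apply/TbE; exists (Rr *m v).
  exists (Tb *m (Rr *m v)); split=> //.
    apply: contra v0 => /(inK _ tT); rewrite (mulmxA L) LTb mul1mx -vE => ->; exact: eqxx.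
  apply/inK; first by rewrite memvB ?memvZ // sT.
  by rewrite -key -vE ve subrr.
case=> y [/[dup] yT /TbE [k yE] yK yl]; exists (M *m k).
  by apply: contraNneq yK => Mk; apply/KE; exists k.
apply/eqP; rewrite -subr_eq0 key -yE; apply/eqP; apply/inK => //.
by rewrite memvB ?memvZ // sT.
Qed.

(** For (a, y, x) orthogonal to V, the relation a M = M x_T says that x preserves K and that a is
    the induced action on T1 / K. So the reduced algebra belongs to the chain K :: T1 :: T on the
    same W. *)
Lemma step_no_left_null :
  (forall T', wf e J W U T' -> claim_state W U T') ->
  forall a y x, prin g A (block_mx a 0 y x) ->
  [/\ allgood e x 0%VS U, allgood e x 0%VS (T1 :: T),
        good e (fun l => evm a (l - 1)), good e (fun l => evm a l \/ ev x 0%VS T1 l) &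
        exists m, unbroken m (ad_eigenvalue g (block_mx a 0 y x))].
Proof.
move=> IH a y x hp.
have [g' g'E] := Reg_exists J W U (K :: T1 :: T).
have sub1 x' : Reg J W U (K :: T1 :: T) x' -> Reg J W U (T1 :: T) x'.
  by case=> h1 h2 h3 h4; split=> // Y YT; apply: h4; rewrite inE YT orbT.
pose iota x' : 'M_(c + N) := block_mx (ia x') 0 0 x'.
have [h0g h0V h0i] := h0_facts.
have [A' [x' [v0 [fr' hp' v0V hE eigE]]]] : exists A' h' v0,
   [/\ frob g' A', prin g' A' h', v0 \in V, block_mx a 0 y x = block_mx (- 1%:M) 0 0 0 + iota h' + v0 &
    forall l, ad_eigenvalue g (block_mx a 0 y x) l <->
      [\/ ad_eigenvalue V (block_mx a 0 y x) l, ad_eigenvalue V (block_mx a 0 y x) (1 - l) | ad_eigenvalue g' h' l]].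
  apply: (reduction (iota := iota) (V := V) _ Gc_lie) => //.
  - move=> k u v; rewrite /iota scale_block_mx add_block_mx !scaler0 !addr0; congr block_mx.
    by rewrite !iaE !(mulmxDr, mulmxDl) -!(scalemxAr, scalemxAl).
  - by move=> u v /g'E uR /g'E vR; apply/g'E; exact: Reg_lie.
  - move=> u /g'E uR; apply/gE; exists (ia u), 0, u; split=> //; first exact: sub1.
    by move=> v; rewrite mul0mx mem0v.
  - by move=> u /g'E uR /VE [y' _ /eq_block_mx []].
  - move=> u v /g'E uR /g'E vR; rewrite /iota lie_block; congr block_mx; last first.
      by rewrite !mulmx0 !mul0mx !addr0 subrr.
    have uM := ia_M uR; have vM := ia_M vR.
    have iaM p q : ia p *m M = M *m (L *m p *m Tb) -> stable q T1 -> ia (p *m q) = ia p *m ia q.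
      move=> pM qT; rewrite [ia q]iaE !mulmxA pM iaE; congr (_ *m Rr); rewrite -!mulmxA; congr (_ *m (_ *m _)).
      by rewrite {1}(stable_Tb qT) !mulmxA.
    have su := Reg_T1 (sub1 _ uR); have sv := Reg_T1 (sub1 _ vR).
    rewrite [RHS]/lie -(iaM _ _ uM sv) -(iaM _ _ vM su).
    by rewrite !iaE /lie !(mulmxBr, mulmxBl).
  - exact: V_sub.
  - exact: V_ideal.
  - exact: V_abel.
  - move=> u v /g'E uR /VE [y' yT ->]; rewrite (T1_cols yT) trV; last exact: sub1.
    by rewrite ia_M // subrr mul0mx raddf0.
  - move=> z /gE [a' [y' [u [-> uR yT]]]] h.
    have aM : M *m (L *m u *m Tb) = a' *m M.
      apply/eqP; rewrite -subr_eq0; apply/eqP; apply: tr_mul0 => eta.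
      rewrite -(trV a' y' eta uR); apply: h; apply/VE; exists (Tb *m eta) => // k.
      by apply/TbE; exists (eta *m k); rewrite mulmxA.
    have uR' : Reg J W U (K :: T1 :: T) u.
      case: (uR) => h1 h2 h3 h4; split=> // Y; rewrite inE => /predU1P [->|]; last exact: h4.
      move=> v /KE [k -> Mk]; apply/KE; exists (L *m u *m Tb *m k).
        by rewrite mulmxA (stable_Tb (Reg_T1 uR)) !mulmxA.
      by rewrite mulmxA aM -mulmxA Mk mulmx0.
    exists u, (block_mx 0 0 y' 0); split; [exact/g'E | by apply/VE; exists y' | ].
    rewrite /iota add_block_mx !addr0 add0r; congr block_mx.
    by rewrite !iaE aM -mulmxA MR mulmx1.
  - exact: h0V.
  - by move=> u _; rewrite /iota h0i mulmx0 raddf0.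
  - by move=> u _; rewrite /iota h0i mem0v.
  - exact: fr.
  - exact: hp.
have /VE [y0 _ v0E] := v0V.
move: hE; rewrite v0E /iota !add_block_mx !addr0 !add0r => /eq_block_mx [aE _ _ xE].
subst x.
have /g'E xR := hp'.1; have xR1 := sub1 _ xR.
case: (Wf) => Wn iso [cU cT] tv par.
have sT : stable x' T1 := Reg_T1 xR1.
have sK : stable x' K by case: xR => _ _ _; apply; rewrite !inE eqxx.
have s0 : stable x' 0%VS by move=> v; rewrite !memv0 => /eqP ->; rewrite mulmx0.
have [gU gT1 gK m]: [/\ allgood e x' 0%VS U, allgood e x' 0%VS (T1 :: T), good e (ev x' K T1) &
    exists m, unbroken m (ad_eigenvalue g' x')].
  (* For K = 0 the longer chain would not be strict, and the algebra is the one of T1 :: T. *)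
  case: (eqVneq K 0%VS) => [K0|Kn].
    have g'E' z : z \in g' <-> Reg J W U (T1 :: T) z.
      split=> [/g'E/sub1 //|[h1 h2 h3 h4]]; apply/g'E; split=> // Y.
      rewrite inE => /predU1P [->|]; last exact: h4.
      by rewrite K0 => v; rewrite !memv0 => /eqP ->; rewrite mulmx0.
    by have [] := IH _ Wf g' A' x' g'E' fr' hp'; rewrite K0 => h1 [h2 h3] h4; split.
  have [h1 [h2 [h3 h4]] h5] := IH _ (wf_K Kn) g' A' x' g'E fr' hp'; split=> //; split=> //.
  apply: good_ext (good_union h2 h3) => l; apply: iff_sym; apply: ev_split => //; rewrite ?sub0v ?K_sub //.
have PG l : ev x' K T1 l -> ev x' 0%VS T1 l.
  by move=> h; apply/(@ev_split _ _ _ 0%VS K T1) => //; rewrite ?sub0v ?K_sub //; right.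
have aev l : evm a l <-> ev x' K T1 (l + 1).
  by rewrite aE addrC evm_sub1 ia_evm.
have g1 : good e (fun l => evm a (l - 1)).
  by apply: good_ext gK => l; rewrite aev subrK.
split=> //.
  apply: good_ext (good_shift_l gT1.1 gK PG) => l.
  by rewrite aev.
case: m => m um; apply: (unbroken_union (e := e) gT1.1 g1 _ _ um eigE).
  have [l hl] := good_nonempty gK; exists l; split; first exact: PG.
  by rewrite aev subrK.
by move=> l; apply: V_eig.
Qed.

End NoLeftNull.

(** * M is injective: F^c loses a copy of T1 *)

Section NoRightNull.
Variables (c' : nat) (P1 : 'M[F]_(\dim T1, c)) (P2 : 'M[F]_(c', c)) (Q2 : 'M[F]_(c, c')).
Hypothesis P1M : P1 *m M = 1%:M.
Hypothesis P2M : P2 *m M = 0.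
Hypothesis P1Q : P1 *m Q2 = 0.
Hypothesis P2Q : P2 *m Q2 = 1%:M.
Hypothesis MQ1 : M *m P1 + Q2 *m P2 = 1%:M.

Variable ia : 'M[F]_c' -> 'M[F]_(N, c') -> 'M[F]_N -> 'M[F]_c.
Hypothesis iaE : forall d y x,
  ia d y x = M *m (L *m x *m Tb) *m P1 + M *m (L *m y) *m P2 + Q2 *m d *m P2.

(** In the decomposition F^c = im M + im Q2, the matrix [ia d y x] is block triangular: x_T on the
    image of M, d on the quotient, and y as off-diagonal block. *)
Lemma ia2_M d y x : ia d y x *m M = M *m (L *m x *m Tb).
Proof. by rewrite iaE !mulmxDl -!mulmxA P1M P2M !mulmx0 !addr0 mulmx1. Qed.

Lemma P2_ia2 d y x : P2 *m ia d y x = d *m P2.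
Proof. by rewrite iaE !mulmxDr !mulmxA P2M P2Q !mul0mx !add0r mul1mx. Qed.

Lemma ia2_evm d y x l : evm (ia d y x) l <-> evm (L *m x *m Tb) l \/ evm d l.
Proof.
split.
  move/evm_col => [v v0 ve]; case: (eqVneq (P2 *m v) 0) => [Pv|Pv]; last first.
    right; apply/evm_col; exists (P2 *m v) => //.
    by rewrite mulmxA -(P2_ia2 d y x) -mulmxA ve scalemxAr.
  left; have vE : v = M *m (P1 *m v).
    by rewrite -{1}[v]mul1mx -MQ1 mulmxDl -!mulmxA Pv mulmx0 addr0.
  apply/evm_col; exists (P1 *m v); first by apply: contraNneq v0 => h; rewrite vE h mulmx0.
  have h : M *m (L *m x *m Tb *m (P1 *m v) - l *: (P1 *m v)) = 0.
    by rewrite mulmxBr (mulmxA M) -(ia2_M d y x) -mulmxA -scalemxAr -vE ve subrr.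
  by apply/eqP; rewrite -subr_eq0 -[_ - _]mul1mx -P1M -(mulmxA P1) h mulmx0.
case=> [/evm_col [v v0 ve]|/evm_row [v v0 ve]].
  apply/evm_col; exists (M *m v); last by rewrite mulmxA ia2_M -mulmxA ve scalemxAr.
  by apply: contraNneq v0 => h; rewrite -[v]mul1mx -P1M -mulmxA h mulmx0.
apply/evm_row; exists (v *m P2); last by rewrite -mulmxA P2_ia2 mulmxA ve scalemxAl.
by apply: contraNneq v0 => h; rewrite -[v]mulmx1 -P2Q mulmxA h mul0mx.
Qed.

(** For (a, y, x) orthogonal to V, a preserves the image of M and acts there as x does on T1. What
    remains free in a is its action d on the quotient and a map from the quotient to T1, so the
    reduced algebra is again of the form [Gc], with c' in place of c. *)
Lemma step_no_right_null : claim_G c' W U T1 T ->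
  (0 < \dim T1)%N ->
  forall a y x, prin g A (block_mx a 0 y x) ->
  [/\ allgood e x 0%VS U, allgood e x 0%VS (T1 :: T),
        good e (fun l => evm a (l - 1)), good e (fun l => evm a l \/ ev x 0%VS T1 l) &
        exists m, unbroken m (ad_eigenvalue g (block_mx a 0 y x))].
Proof.
move=> IH T1n a y x hp.
have [g' g'E] : exists g' : {vspace 'M[F]_(c' + N)}, forall z, z \in g' <-> Gc W U T1 T z.
  apply: subspace_exists.
    exists 0, 0, 0; split; rewrite ?block_mx0 //; first exact: Reg0.
    by move=> v; rewrite mul0mx mem0v.
  move=> k z z' [a1 [y1 [x1 [-> xR1 yT1]]]] [a2 [y2 [x2 [-> xR2 yT2]]]].
  rewrite scale_block_mx add_block_mx scaler0 addr0; do 3 eexists; split; first by reflexivity.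
    exact: Reg_sub.
  by move=> v; rewrite mulmxDl -scalemxAl memvD ?memvZ.
have g'l : lie_closed g'.
  move=> z z' /g'E [a1 [y1 [x1 [-> xR1 yT1]]]] /g'E [a2 [y2 [x2 [-> xR2 yT2]]]].
  apply/g'E; rewrite lie_block; do 3 eexists; split; first by reflexivity.
    exact: Reg_lie.
  move=> v; rewrite mulmxBl 2!mulmxDl -!mulmxA; apply: memvB; apply: memvD => //.
    exact: (Reg_T1 xR1).
  exact: (Reg_T1 xR2).
have T1_cols' (u : 'M_(N, c')) : (forall k, u *m k \in T1) -> u = Tb *m (L *m u).
  by move=> h; apply: mx_ext => k; rewrite -!mulmxA T1_proj.
pose iota (z : 'M_(c' + N)) : 'M_(c + N) :=
  block_mx (ia (ulsubmx z) (dlsubmx z) (drsubmx z)) 0 0 (drsubmx z).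
have iotaE d u v : iota (block_mx d 0 u v) = block_mx (ia d u v) 0 0 v.
  by rewrite /iota block_mxKul block_mxKdl block_mxKdr.
have [h0g h0V h0i] := h0_facts.
have [A' [z' [v0 [fr' hp' v0V hE eigE]]]] : exists A' h' v0,
   [/\ frob g' A', prin g' A' h', v0 \in V, block_mx a 0 y x = block_mx (- 1%:M) 0 0 0 + iota h' + v0 &
    forall l, ad_eigenvalue g (block_mx a 0 y x) l <->
      [\/ ad_eigenvalue V (block_mx a 0 y x) l, ad_eigenvalue V (block_mx a 0 y x) (1 - l) | ad_eigenvalue g' h' l]].
  apply: (reduction (iota := iota) (V := V) _ Gc_lie) => //.
  - move=> k u v; rewrite /iota scale_block_mx add_block_mx !scaler0 !addr0.
    rewrite /ulsubmx /dlsubmx /drsubmx !linearD !linearZ /=; congr block_mx.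
    rewrite !iaE !(mulmxDr, mulmxDl) -!(scalemxAr, scalemxAl) !scalerDr.
    set b1 := k *: (_ *m P1); set b2 := k *: (_ *m P2); set b3 := k *: (_ *m P2).
    by rewrite (addrACA b1) (addrACA (b1 + b2)).
  - move=> u /g'E [d [u' [v [-> vR uT]]]]; rewrite iotaE; apply/gE; exists (ia d u' v), 0, v; split=> //.
    by move=> k; rewrite mul0mx mem0v.
  - move=> u /g'E [d [u' [v [-> vR uT]]]]; rewrite iotaE => /VE [y' _ /eq_block_mx [ia0 _ _ v00]].
    have d0 : d = 0 by rewrite -[d]mulmx1 -P2Q mulmxA -(P2_ia2 d u' v) ia0 mulmx0 mul0mx.
    have u0 : u' = 0.
      rewrite (T1_cols' _ uT) -[L *m u']mul1mx -P1M -mulmxA -[M *m _]mulmx1 -P2Q.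
      move: ia0; rewrite iaE v00 d0 !(mulmx0, mul0mx) add0r addr0 => h.
      by rewrite (mulmxA _ P2) h mul0mx !mulmx0.
    by rewrite d0 u0 v00 block_mx0.
  - move=> u1 u2 /g'E [d1 [w1 [v1 [-> vR1 uT1]]]] /g'E [d2 [w2 [v2 [-> vR2 uT2]]]].
    rewrite lie_block !iotaE lie_block; congr block_mx; last by rewrite !mulmx0 !mul0mx !addr0 subrr.
    (* [ia] is shown to be multiplicative, so that brackets follow by subtraction. *)
    have prodE p1 p2 p3 q1 q2 q3 : q3 *m Tb = Tb *m (L *m q3 *m Tb) -> q2 = Tb *m (L *m q2) ->
       ia (p1 *m q1) (p2 *m q1 + p3 *m q2) (p3 *m q3) = ia p1 p2 p3 *m ia q1 q2 q3.
      move=> qT qY; rewrite [ia q1 q2 q3]iaE !mulmxDr !mulmxA !ia2_M.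
      have -> : ia p1 p2 p3 *m Q2 = M *m (L *m p2) + Q2 *m p1.
        rewrite iaE !mulmxDl -!mulmxA P1Q P2Q !mulmx0 !mulmx1 add0r //.
      rewrite iaE !(mulmxDl, mulmxDr) !mulmxA.
      have -> : M *m L *m p3 *m Tb *m L *m q3 *m Tb = M *m L *m p3 *m q3 *m Tb.
        by rewrite -!mulmxA [in RHS]qT !mulmxA.
      have -> : M *m L *m p3 *m Tb *m L *m q2 = M *m L *m p3 *m q2.
        by rewrite -!mulmxA [in RHS]qY !mulmxA.
      by rewrite -!addrA; congr (_ + _); rewrite addrCA.
    have iaB p1 p2 p3 q1 q2 q3 : ia (p1 - q1) (p2 - q2) (p3 - q3) = ia p1 p2 p3 - ia q1 q2 q3.
      rewrite !iaE !(mulmxBl, mulmxBr) !opprD !addrA.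
      by apply/matrixP => i j; rewrite !mxE; ring.
    rewrite /lie iaB !prodE //; try exact: T1_cols'; apply: stable_Tb; exact: Reg_T1.
  - exact: V_sub.
  - exact: V_ideal.
  - exact: V_abel.
  - move=> u v /g'E [d [u' [u3 [-> vR uT]]]] /VE [y' yT ->]; rewrite iotaE (T1_cols yT) trV //.
    by rewrite ia2_M subrr mul0mx raddf0.
  - move=> z /gE [a' [y' [u [-> uR yT]]]] h.
    have aM : M *m (L *m u *m Tb) = a' *m M.
      apply/eqP; rewrite -subr_eq0; apply/eqP; apply: tr_mul0 => eta.
      rewrite -(trV a' y' eta uR); apply: h; apply/VE; exists (Tb *m eta) => // k.
      by apply/TbE; exists (eta *m k); rewrite mulmxA.
    exists (block_mx (P2 *m a' *m Q2) 0 (Tb *m (P1 *m a' *m Q2)) u), (block_mx 0 0 y' 0); split.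
    + apply/g'E; do 3 eexists; split; [reflexivity | exact: uR | move=> k; apply/TbE].
      by exists (P1 *m a' *m Q2 *m k); rewrite !mulmxA.
    + by apply/VE; exists y'.
    rewrite iotaE add_block_mx !addr0 add0r; congr block_mx.
    rewrite iaE aM (mulmxA L) LTb mul1mx.
    rewrite -{1}[a']mulmx1 -MQ1 mulmxDr -addrA; congr (_ + _); first by rewrite mulmxA.
    by rewrite -{1}[a']mul1mx -MQ1 !mulmxDl !mulmxA.
  - exact: h0V.
  - by move=> u _; rewrite /iota h0i mulmx0 raddf0.
  - by move=> u _; rewrite /iota h0i mem0v.
  - exact: fr.
  - exact: hp.
have /g'E [d [u [x' [z'E xR uT]]]] := hp'.1.
have /VE [y0 _ v0E] := v0V.
move: hE; rewrite v0E z'E iotaE !add_block_mx !addr0 !add0r => /eq_block_mx [aE _ _ xE].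
subst x z'.
have [gU gT g3 g4 [m um]] := IH _ _ _ _ _ g'E fr' hp'.
have PE l : ev x' 0%VS T1 l <-> evm (L *m x' *m Tb) l.
  apply: ev0_evm TbE Tb_inj _; exact: stable_Tb (Reg_T1 xR).
have aev l : evm a l <-> evm d (l + 1) \/ ev x' 0%VS T1 (l + 1).
  by rewrite aE addrC evm_sub1 ia2_evm PE; tauto.
have g1 : good e (fun l => evm a (l - 1)).
  by apply: good_ext g4 => l; rewrite aev subrK.
split=> //.
- have PG l : ev x' 0%VS T1 l -> evm d l \/ ev x' 0%VS T1 l by right.
  by apply: good_ext (good_shift_r g4 gT.1 PG) => l; rewrite aev.
apply: (unbroken_union (e := e) gT.1 g1 _ _ um eigE).
  have [l hl] := good_nonempty gT.1; exists l; split=> //.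
  by rewrite aev subrK; right.
by move=> l; apply: V_eig.
Qed.

End NoRightNull.
End Fix.
End GStep.

(** * States with two nonempty chains as block-triangular algebras *)

Section Iso.
Variables (F : numClosedFieldType) (e : bool) (N : nat) (J : 'M[F]_N).
Local Notation eps := (sg F e).
Hypothesis JT : J^T = eps *: J.
Hypothesis Ju : J \in unitmx.
Local Notation w := (w J).
Local Notation vs := ({vspace 'cV[F]_N}).

Lemma row_free_inj m n (M : 'M[F]_(m, n)) :
  (forall l : 'rV_m, l *m M = 0 -> l = 0) -> exists R, M *m R = 1%:M.
Proof.
move=> h; apply/row_freeP; rewrite -kermx_eq0; apply/eqP/row_matrixP => i; rewrite row0.
by apply: h; rewrite -row_mul mulmx_ker row0.
Qed.

(** Induction on c. If M has a trivial left kernel, the claim is about states on the same W.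
    Otherwise M is injective by [no_two_nulls], and c is replaced by the dimension of a complement
    of its image, which is positive because M has a nonzero left null vector. *)
Lemma claim_G_all W U T1 T :
  wf e J W U (T1 :: T) -> (forall T', wf e J W U T' -> claim_state e J W U T') ->
  forall c, (0 < c)%N -> claim_G e J c W U T1 T.
Proof.
move=> Wf IH c; have [n le_c] := ubnP c; elim: n c le_c => // n IHn c /ltnSE le_c c0.
move=> g A a y x gE fr hp.
have [Tb [L [LTb TbE]]] := col_basis T1.
have [V VE] : exists V : {vspace 'M[F]_(c + N)}, forall v, v \in V <->
    exists2 y : 'M_(N, c), (forall u, y *m u \in T1) & v = block_mx 0 0 y 0.
  apply: subspace_exists.
    by exists 0; [move=> u; rewrite mul0mx mem0v | rewrite block_mx0].
  move=> k u v [y1 h1 ->] [y2 h2 ->]; exists (k *: y1 + y2).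
    by move=> u'; rewrite mulmxDl -scalemxAl memvD ?memvZ.
  by rewrite scale_block_mx add_block_mx !scaler0 !addr0.
have [M ME] : exists M, M = ursubmx A *m Tb by exists (ursubmx A *m Tb).
have T1n : (0 < \dim T1)%N.
  case: Wf => _ _ [_ /= [_ T1n _]] _ _.
  by rewrite lt0n dimv_eq0 -subv0.
case: (classic (forall l : 'rV_c, l *m M = 0 -> l = 0)) => [inj|].
  have [Rr MR] := row_free_inj inj.
  have [K KE] : exists K : vs, forall v, v \in K <-> exists2 k, v = Tb *m k & M *m k = 0.
    apply: subspace_exists; first by exists 0; rewrite mulmx0.
    move=> k u v [k1 -> h1] [k2 -> h2]; exists (k *: k1 + k2); first by rewrite mulmxDr -scalemxAr.
    by rewrite mulmxDr -scalemxAr h1 h2 scaler0 addr0.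
  exact: (step_no_left_null JT Wf gE VE LTb TbE ME fr c0 MR KE (fun x => erefl) IH hp).
move=> nn; have [l {}nn] := not_all_ex_not _ _ nn; have [lM l0] := imply_to_and _ _ nn.
have [j lj] : exists j, l 0 j != 0.
  apply: NNPP => no; apply: l0; apply/rowP => j; rewrite mxE; apply/eqP/negPn/negP => lj.
  by apply: no; exists j.
have injr (k : 'cV_(\dim T1)) : M *m k = 0 -> k = 0.
  move=> Mk; have h := no_two_nulls gE VE LTb TbE ME fr lM Mk.
  apply/colP => i; have /matrixP/(_ i j) := h; rewrite !mxE big_ord1 => /eqP.
  by rewrite mulf_eq0 (negPf lj) orbF => /eqP.
have [P1 P1M] : exists P1, P1 *m M = 1%:M.
  have [l' h|R RE] := @row_free_inj _ _ M^T.
    by apply: (can_inj (@trmxK _ _ _)); rewrite trmx0; apply: injr; rewrite -[M]trmxK -trmx_mul h trmx0.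
  by exists R^T; rewrite -[M]trmxK -trmx_mul RE trmx1.
pose S := lker (linfun (mulmx P1) : 'Hom('cV[F]_c, 'cV_(\dim T1))).
have SE v : v \in S <-> P1 *m v = 0 by rewrite memv_ker lfunE; split=> /eqP.
have [Q2 [L2 [LQ QE]]] := col_basis S.
have [P2 P2E] : exists P2, P2 = L2 *m (1%:M - M *m P1) by eexists.
have P1Q : P1 *m Q2 = 0.
  by apply: mx_ext => v; rewrite mul0mx -mulmxA; apply/SE/QE; exists v.
have P2M : P2 *m M = 0 by rewrite P2E -mulmxA mulmxBl mul1mx -mulmxA P1M mulmx1 subrr mulmx0.
have P2Q : P2 *m Q2 = 1%:M by rewrite P2E -mulmxA mulmxBl mul1mx -mulmxA P1Q mulmx0 subr0.
have MQ : M *m P1 + Q2 *m P2 = 1%:M.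
  apply: mx_ext => v; rewrite mulmxDl mul1mx; set u := v - M *m P1 *m v.
  have /QE [k uE] : u \in S by apply/SE; rewrite /u mulmxBr !mulmxA P1M mul1mx subrr.
  have -> : Q2 *m P2 *m v = u.
    rewrite P2E -!mulmxA (mulmxBl 1%:M) mul1mx -/u uE (mulmxA L2) LQ mul1mx //.
  by rewrite /u addrC subrK.
have dS : (\dim S < c)%N.
  have := dimvS (subvf S); rewrite dimvf /dim /= muln1 leq_eqVlt => /predU1P [dE|//].
  have Sf : S = fullv by apply/eqP; rewrite eqEdim subvf dimvf /dim /= muln1 dE /=.
  have /SE : M *m (const_mx 1 : 'cV_(\dim T1)) \in S by rewrite Sf memvf.
  rewrite mulmxA P1M mul1mx => /colP /(_ (Ordinal T1n)) /eqP.
  by rewrite !mxE oner_eq0.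
have dS0 : (0 < \dim S)%N.
  rewrite lt0n dimv_eq0; apply/eqP => S0; apply: l0.
  have E : M *m P1 = 1%:M.
    apply: mx_ext => v; rewrite mul1mx; apply/eqP; rewrite eq_sym -subr_eq0 -memv0 -S0.
    by apply/SE; rewrite mulmxBr !mulmxA P1M mul1mx subrr.
  by rewrite -[l]mulmx1 -E mulmxA lM mul0mx.
have IHc := IHn _ (leq_trans dS le_c) dS0.
exact: (step_no_right_null gE VE LTb TbE ME fr P1M P2M P1Q P2Q MQ (fun _ _ _ => erefl) IHc T1n hp).
Qed.

Lemma evm_opp_tr n (a : 'M[F]_n) l : evm (- a^T) l <-> evm a (- l).
Proof.
rewrite evm_col evm_row; split=> -[v v0 ve]; exists v^T; rewrite ?trmx_eq0 //.
  rewrite -[a]trmxK -trmx_mul; have -> : a^T *m v = - (l *: v) by rewrite -ve mulNmx opprK.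
  by rewrite linearN linearZ /= scaleNr.
by rewrite mulNmx -trmx_mul ve linearZ /= scaleNr opprK.
Qed.

(** Used in [kap_mul] with b = Ub^T J, q = m^T J and q' = m'^T J. The product depends only on these
    eight relations, so the matrices are kept opaque. *)
Lemma kap_alg c (x x' : 'M[F]_N) (m m' Ub xm : 'M[F]_(N, c)) (b q q' r : 'M[F]_(c, N)) a a' :
  x *m m' = xm -> x *m Ub = 0 -> b *m x' = 0 -> b *m m' = a' -> b *m Ub = 0 ->
  q *m x' = - r -> q *m m' = 0 -> q *m Ub = eps *: a^T ->
  (x + m *m b - eps *: (Ub *m q)) *m (x' + m' *m b - eps *: (Ub *m q')) =
  x *m x' + (xm + m *m a') *m b + eps *: (Ub *m (r + a^T *m q')).
Proof.
move=> h1 h2 h3 h4 h5 h6 h7 h8.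
rewrite !(mulmxBl, mulmxBr, mulmxDl, mulmxDr) -!scalemxAl -!scalemxAr -!mulmxA.
rewrite (mulmxA x m') h1 (mulmxA x Ub) h2 h3 (mulmxA b m') h4 (mulmxA b Ub) h5 h6.
rewrite (mulmxA q m') h7 (mulmxA q Ub) h8 !(mul0mx, mulmx0, scaler0, subr0, add0r, addr0, oppr0).
rewrite mulmxN -(scalemxAl eps a^T q') -scalemxAr (scalerA eps eps) eps2 scale1r scalerN scalerDr.
by rewrite opprD !opprK !addrA.
Qed.

Lemma kap_surj_alg c (X : 'M[F]_N) (Ub Ud : 'M[F]_(N, c)) (b q r : 'M[F]_(c, N)) a' :
  X *m Ub = Ub *m a' -> b *m X = - (a'^T *m b) -> q *m X = - r ->
  b *m (X *m Ud) = - a'^T -> q *m (X *m Ud) = 0 ->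
  b *m Ub = 0 -> q *m Ub = eps *: 1%:M ->
  let p := Ud *m b + eps *: (Ub *m q) in
  X = (1%:M - p) *m X *m (1%:M - p) + X *m Ud *m b - eps *: (Ub *m r).
Proof.
move=> h1 h2 h3 h4 h5 h6 h7 p.
have pX : p *m X = - (Ud *m a'^T *m b) - eps *: (Ub *m r).
  by rewrite /p mulmxDl -scalemxAl -!mulmxA h2 h3 !mulmxN scalerN.
have Xp : X *m p = X *m Ud *m b + eps *: (Ub *m a' *m q).
  by rewrite /p mulmxDr -scalemxAr !mulmxA h1.
have pU : p *m Ub = Ub.
  by rewrite /p mulmxDl -scalemxAl -!mulmxA h6 h7 mulmx0 add0r -scalemxAr scalerA eps2 scale1r mulmx1.
have pXU : p *m (X *m Ud) = - (Ud *m a'^T).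
  by rewrite /p mulmxDl -scalemxAl -!(mulmxA _ _ (X *m Ud)) h4 h5 mulmx0 scaler0 addr0 mulmxN.
have pXp : p *m (X *m p) = - (Ud *m a'^T *m b) + eps *: (Ub *m a' *m q).
  by rewrite Xp mulmxDr -scalemxAr (mulmxA p) pXU !(mulmxA p) pU mulNmx.
have -> : (1%:M - p) *m X *m (1%:M - p) = X - X *m p - (p *m X - p *m (X *m p)).
  move: (p) => u; rewrite mulmxBl mul1mx mulmxBr mulmx1 mulmxBl -!mulmxA.
  set c1 := u *m X; set c2 := X *m u; set c3 := u *m _.
  by apply/matrixP => i j; rewrite !mxE; ring.
rewrite pX pXp Xp.
set b1 := Ud *m _ *m _; set b2 := Ub *m r; set b3 := X *m _ *m _; set b4 := Ub *m _ *m _.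
by apply/matrixP => i j; rewrite !mxE; ring.
Qed.

(** * The isomorphism and its effect on the chains *)

Section Kappa.
Variables (W : vs) (U1 T1 : vs) (U T : seq vs) (c : nat).
Hypothesis Wf : wf e J W (U1 :: U) (T1 :: T).
Hypothesis c0 : (0 < c)%N.
Variables (Ub Ud : 'M[F]_(N, c)).
Hypothesis UbE : forall v, v \in U1 <-> exists k, v = Ub *m k.
Hypothesis UdT : forall k, Ud *m k \in T1.
Hypothesis UbUd : Ub^T *m J *m Ud = 1%:M.

Let Wn : nondeg J W. Proof. by case: Wf. Qed.
Lemma U1W : (U1 <= W)%VS.
Proof. by case: Wf => _ iso _ _ _; case: (iso U1) => //; rewrite mem_cat inE eqxx. Qed.
Lemma TW Y : Y \in T1 :: T -> (Y <= W)%VS /\ isotropic J Y.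
Proof. by case: Wf => _ iso _ _ _ YT; apply: iso; rewrite mem_cat YT orbT. Qed.
Lemma UW Y : Y \in U1 :: U -> (Y <= W)%VS /\ isotropic J Y.
Proof. by case: Wf => _ iso _ _ _ YT; apply: iso; rewrite mem_cat YT. Qed.
Lemma T1T Y : Y \in T1 :: T -> (T1 <= Y)%VS.
Proof.
case: Wf => _ _ [_ /= [_ _ cT]] _ _; rewrite inE => /predU1P [->|YT]; first exact: subvv.
exact: chain_mem cT YT.
Qed.
Lemma U1U Y : Y \in U1 :: U -> (U1 <= Y)%VS.
Proof.
case: Wf => _ _ [/= [_ _ cT] _] _ _; rewrite inE => /predU1P [->|YT]; first exact: subvv.
exact: chain_mem cT YT.
Qed.

Lemma UbUb : Ub^T *m J *m Ub = 0.
Proof.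
apply: mx_w0 => k l; have [_ i] := UW (mem_head U1 U).
by apply: i; apply/UbE; [exists k | exists l].
Qed.

Lemma UdUd : Ud^T *m J *m Ud = 0.
Proof. by apply: mx_w0 => k l; have [_ i] := TW (mem_head T1 T); apply: i. Qed.

Lemma UdUb : Ud^T *m J *m Ub = eps *: 1%:M.
Proof.
have := congr1 trmx UbUd; rewrite !trmx_mul trmxK trmx1 JT -scalemxAl -scalemxAr !mulmxA => h.
by rewrite -h scalerA eps2 scale1r.
Qed.

Local Notation B := (row_mx Ub Ud).

Lemma BW (k : 'cV_(c + c)) : B *m k \in W.
Proof.
rewrite -[k]vsubmxK mul_row_col memvD //.
  by apply: (subvP U1W); apply/UbE; eexists.
by have [s _] := TW (mem_head T1 T); apply: (subvP s).
Qed.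

Lemma perpB (v : 'cV_N) : B^T *m J *m v = 0 <-> Ub^T *m J *m v = 0 /\ Ud^T *m J *m v = 0.
Proof.
rewrite tr_row_mx !mul_col_mx; split=> [|[-> ->]]; last by rewrite col_mx0.
by rewrite -[X in _ = X](col_mx0 F c c 1) => /eq_col_mx.
Qed.

Lemma Bu : B^T *m J *m B \in unitmx.
Proof.
apply: gram_unit => k h.
have E : B^T *m J *m (B *m k) = 0.
  apply: mx_w0v => d; have := h d; rewrite (wC JT) => h'.
  by rewrite (wC JT) -h' (wC JT) mulrA eps2 mul1r -(wC JT) (wC JT) h mulr0.
have [E1 E2] := (perpB _).1 E.
move: E1 E2; rewrite -[k]vsubmxK mul_row_col !mulmxDr !mulmxA UbUb UbUd UdUd UdUb !mul0mx !add0r !addr0.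
rewrite mul1mx -scalemxAl mul1mx => -> h2.
have -> : usubmx k = 0 by rewrite -[usubmx k]scale1r -(eps2 F e) -scalerA h2 scaler0.
exact: col_mx0.
Qed.

Local Notation p := (gproj J B).
Local Notation W2 := (cperp J W B).

Lemma W2P (v : 'cV_N) : v \in W2 <-> [/\ v \in W, Ub^T *m J *m v = 0 & Ud^T *m J *m v = 0].
Proof.
split=> [/cperpP [vW /perpB []] //|[vW h1 h2]].
by apply/cperpP; split=> //; apply/perpB.
Qed.

Lemma pE (v : 'cV_N) : p *m v = Ud *m (Ub^T *m J *m v) + eps *: (Ub *m (Ud^T *m J *m v)).
Proof.
set q := _ + _; have qB : exists k, q = B *m k.
  exists (col_mx (eps *: (Ud^T *m J *m v)) (Ub^T *m J *m v)).
  by rewrite mul_row_col -scalemxAr addrC.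
have pq : p *m q = q by have [k ->] := qB; rewrite mulmxA (gprojB JT Bu).
have qv : B^T *m J *m (v - q) = 0.
  apply/perpB; rewrite !mulmxBr /q !mulmxDr -!scalemxAr !(mulmxA (_ *m J)) UbUb UbUd UdUd UdUb.
  by rewrite !mul0mx scaler0 mul1mx -scalemxAl scalerA eps2 scale1r mul1mx addr0 add0r !subrr.
rewrite -{1}(subrK q v) mulmxDr pq; set d := v - q in qv *.
by rewrite gprojE qv !mulmx0 add0r.
Qed.

(** Y is isotropic and contains U1, so v is orthogonal to U1 and only the Ub component of its
    projection is left. *)
Lemma pU Y (v : 'cV_N) : Y \in U1 :: U -> v \in Y -> p *m v \in U1.
Proof.
move=> YU vY; have [_ i] := UW YU; rewrite pE.
have -> : Ub^T *m J *m v = 0.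
  by apply: mx_w0v => k; apply: i => //; apply: (subvP (U1U YU)); apply/UbE; exists k.
by rewrite mulmx0 add0r memvZ //; apply/UbE; eexists.
Qed.

Lemma pT Y (v : 'cV_N) : Y \in T1 :: T -> v \in Y -> p *m v \in T1.
Proof.
move=> YT vY; have [_ i] := TW YT; rewrite pE.
have -> : Ud^T *m J *m v = 0.
  by apply: mx_w0v => k; apply: i => //; apply: (subvP (T1T YT)).
by rewrite mulmx0 scaler0 addr0.
Qed.

Local Notation capW := (capW J W B).
Local Notation T0 := (T1 :&: W2)%VS.

Lemma U1W2 : (U1 :&: W2)%VS = 0%VS.
Proof.
apply/eqP; rewrite -subv0; apply/subvP => v; rewrite capWE => /andP [/UbE [k ->] /W2P [_ _ h]].
move: h; rewrite mulmxA UdUb -scalemxAl mul1mx => h.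
by rewrite -[k]scale1r -(eps2 F e) -scalerA h scaler0 mulmx0 mem0v.
Qed.

Lemma W2_wf : T0 != 0%VS -> wf e J W2 (capW U) (T0 :: capW T).
Proof.
move=> T0n; case: (Wf) => _ iso [[_ _ cU] [_ _ cT]] tv par.
split.
- exact: (cperp_nondeg JT Wn BW Bu).
- have h Y : Y \in U1 :: U \/ Y \in T1 :: T -> (Y :&: W2 <= W2)%VS /\ isotropic J (Y :&: W2)%VS.
    move=> YY; split; first exact: capvSr.
    have [_ i] : (Y <= W)%VS /\ isotropic J Y by case: YY => [/UW|/TW].
    by move=> a b; rewrite !capWE => /andP [aY _] /andP [bY _]; apply: i.
  move=> Y; rewrite mem_cat => /orP [/mapP [Z ZU ->]|]; first by apply: h; left; rewrite inE ZU orbT.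
  rewrite inE => /predU1P [->|/mapP [Z ZT ->]]; first by apply: h; right; rewrite mem_head.
  by apply: h; right; rewrite inE ZT orbT.
- split.
    rewrite -U1W2; apply: (chain_cap JT BW Bu) cU => [Y y YU|Y YU].
      by apply: pU; rewrite inE YU orbT.
    by have [] := @UW Y; rewrite // inE YU orbT.
  split; [exact: sub0v | by rewrite subv0 | ].
  apply: (chain_cap JT BW Bu) cT => [Y y YT|Y YT].
    by apply: pT; rewrite inE YT orbT.
  by have [] := @TW Y; rewrite // inE YT orbT.
- have h Y Z : Y \in U1 :: U -> Z \in T1 :: T -> transv J (Y :&: W2)%VS (Z :&: W2)%VS.
    move=> YU ZT; apply: (transv_cap JT BW Bu); try by [case: (UW YU)|case: (TW ZT)].
    + by move=> y yY; apply: (subvP (U1U YU)); apply: (pU YU).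
    + by move=> y yY; apply: (subvP (T1T ZT)); apply: (pT ZT).
    + exact: tv.
  move=> Y Z /mapP [Y' YU ->]; rewrite inE => /predU1P [->|/mapP [Z' ZT ->]].
    by apply: h; rewrite ?mem_head // inE YU orbT.
  by apply: h; rewrite inE ?YU ?ZT orbT.
- move=> /par; have := congr1 odd (cperp_dim BW Bu).
  by rewrite oddD (_ : odd (c + c) = false) ?addbF => [->//|]; rewrite addnn odd_double.
Qed.

Lemma W2_dim : (\dim W2 < \dim W)%N.
Proof. by rewrite -(cperp_dim BW Bu); lia. Qed.

(* In the basis Ub of U1 and its dual family Ud in T1, the block a acts on Ud by a
   and on Ub by - a^T. *)
Definition kap (z : 'M[F]_(c + N)) : 'M[F]_N :=
  drsubmx z + (Ud *m ulsubmx z + dlsubmx z) *m (Ub^T *m J)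
   - eps *: (Ub *m ((Ud *m ulsubmx z + dlsubmx z)^T *m J)).

Lemma kapE a y x : kap (block_mx a 0 y x) =
  x + (Ud *m a + y) *m (Ub^T *m J) - eps *: (Ub *m ((Ud *m a + y)^T *m J)).
Proof. by rewrite /kap block_mxKul block_mxKdl block_mxKdr. Qed.

Section OneZ.
Variables (a : 'M[F]_c) (y : 'M[F]_(N, c)) (x : 'M[F]_N).
Hypothesis xR : Reg J W2 (capW U) (T0 :: capW T) x.
Hypothesis yT : forall v, y *m v \in T0.

Lemma x_Ub : x *m Ub = 0.
Proof.
apply: mx_ext => v; rewrite mul0mx -mulmxA; case: xR => _ h _ _; apply: h => w0 /W2P [_ h _].
exact: w_mx0v.
Qed.

Lemma x_Ud : x *m Ud = 0.
Proof.
apply: mx_ext => v; rewrite mul0mx -mulmxA; case: xR => _ h _ _; apply: h => w0 /W2P [_ _ h].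
exact: w_mx0v.
Qed.

Lemma xTJ k (D : 'M_(N, k)) : D^T *m J *m x = - ((x *m D)^T *m J).
Proof. by case: xR => /clsP xc _ _ _; rewrite trmx_mul -(mulmxA D^T x^T) xc mulmxN opprK mulmxA. Qed.

Lemma Ub_x : Ub^T *m J *m x = 0.
Proof. by rewrite xTJ x_Ub trmx0 mul0mx oppr0. Qed.

Lemma yW2 v : y *m v \in W2.
Proof. by have := yT v; rewrite capWE => /andP[]. Qed.

Lemma yT1 v : y *m v \in T1.
Proof. by have := yT v; rewrite capWE => /andP[]. Qed.

Lemma Ub_y : Ub^T *m J *m y = 0.
Proof. by apply: mx_ext => v; rewrite mul0mx -mulmxA; have /W2P [] := yW2 v. Qed.

Local Notation m := (Ud *m a + y).

Lemma mT v : m *m v \in T1.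
Proof. by rewrite mulmxDl memvD ?yT1 // -mulmxA. Qed.

Lemma Ub_m : Ub^T *m J *m m = a.
Proof. by rewrite mulmxDr mulmxA UbUd Ub_y addr0 mul1mx. Qed.

Lemma x_m : x *m m = x *m y.
Proof. by rewrite mulmxDr mulmxA x_Ud mul0mx add0r. Qed.

Lemma m_Ub : m^T *m J *m Ub = eps *: a^T.
Proof.
have := congr1 trmx Ub_m; rewrite !trmx_mul trmxK JT -scalemxAl -scalemxAr !mulmxA => h.
by rewrite -h scalerA eps2 scale1r.
Qed.

Lemma m_T Y (v : 'cV_N) : Y \in T1 :: T -> v \in Y -> m^T *m J *m v = 0.
Proof.
move=> YT vY; apply: mx_w0v => k; have [_ i] := TW YT; apply: i => //.
by apply: (subvP (T1T YT)); exact: mT.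
Qed.

Lemma kap_v (v : 'cV_N) : kap (block_mx a 0 y x) *m v =
  x *m v + m *m (Ub^T *m J *m v) - eps *: (Ub *m (m^T *m J *m v)).
Proof. by rewrite kapE; move: (Ud *m a + y) => m0; rewrite mulmxBl mulmxDl -scalemxAl -!mulmxA. Qed.

Lemma kap_T Y (v : 'cV_N) : Y \in T1 :: T -> v \in Y ->
  kap (block_mx a 0 y x) *m v = x *m v + m *m (Ub^T *m J *m v).
Proof. by move=> YT vY; rewrite kap_v (m_T YT vY) mulmx0 scaler0 subr0. Qed.

Lemma kap_U Y (v : 'cV_N) : Y \in U1 :: U -> v \in Y ->
  kap (block_mx a 0 y x) *m v = x *m v - eps *: (Ub *m (m^T *m J *m v)).
Proof.
move=> YU vY; rewrite kap_v.
have -> : Ub^T *m J *m v = 0.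
  have [_ i] := UW YU; apply: mx_w0v => k; apply: i => //.
  by apply: (subvP (U1U YU)); apply/UbE; exists k.
by rewrite mulmx0 addr0.
Qed.

Lemma x_p (v : 'cV_N) : x *m v = x *m (v - p *m v).
Proof.
by rewrite mulmxBr pE mulmxDr -scalemxAr !(mulmxA x) x_Ub x_Ud !mul0mx scaler0 addr0 subr0.
Qed.

(** On a member of one chain only one of the two correction terms of [kap] survives ([kap_U],
    [kap_T]), and its values lie in the first member of that chain. *)
Lemma kap_Reg : Reg J W (U1 :: U) (T1 :: T) (kap (block_mx a 0 y x)).
Proof.
case: (xR) => xc xk xU xT; split.
- apply: cls_of_w => u v; rewrite !kap_v !(wBl, wBr, wDl, wDr, wZl, wZr) cls_w //.
  have E1 (A1 A2 : 'M[F]_(N, c)) : w (A1 *m (A2^T *m J *m u)) v = eps * w u (A2 *m (A1^T *m J *m v)).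
    rewrite (wC JT); congr (_ * _).
    have -> : w v (A1 *m (A2^T *m J *m u)) = (v^T *m J *m A1 *m A2^T *m J *m u)^T 0 0.
      by rewrite [RHS]mxE /w !mulmxA.
    by rewrite !trmx_mul !trmxK JT -!(scalemxAl, scalemxAr) scalerA eps2 scale1r /w !mulmxA.
  rewrite !E1; have := eps2 F e; set E := sg F e => E2; set b1 := w u _; set b2 := w u _; set b3 := w u _.
  by rewrite mulrA E2; ring.
- move=> v vW; rewrite kap_v.
  have -> : x *m v = 0 by apply: xk => w0 /W2P [w0W _ _]; exact: vW.
  have -> : Ub^T *m J *m v = 0.
    by apply: mx_w0v => k; apply: (wC0 JT); apply: vW; apply: (subvP U1W); apply/UbE; exists k.
  have -> : m^T *m J *m v = 0.
    apply: mx_w0v => k; apply: (wC0 JT); apply: vW; have [s _] := TW (mem_head T1 T).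
    by apply: (subvP s); exact: mT.
  by rewrite !mulmx0 scaler0 addr0 subr0.
- move=> Y YU v vY; rewrite (kap_U YU vY) memvB //; last first.
    by apply: (subvP (U1U YU)); apply: memvZ; apply/UbE; eexists.
  have vW : v \in W by have [s _] := UW YU; apply: (subvP s).
  move: YU; rewrite inE => /predU1P [YE|YU].
    have : v - p *m v \in (U1 :&: W2)%VS.
      by rewrite capWE (compl_cperp JT BW Bu vW) andbT memvB // -?YE // YE (pU (mem_head _ _)) // -YE.
    by rewrite U1W2 memv0 x_p => /eqP ->; rewrite mulmx0 mem0v.
  have YU' : Y \in U1 :: U by rewrite inE YU orbT.
  have /xU sx : (Y :&: W2)%VS \in capW U by apply/mapP; exists Y.
  have /sx : v - p *m v \in (Y :&: W2)%VS.
    rewrite capWE (compl_cperp JT BW Bu vW) andbT memvB //.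
    by apply: (subvP (U1U YU')); apply: (pU YU').
  by rewrite capWE -x_p => /andP[].
- move=> Y YT v vY; rewrite (kap_T YT vY) memvD //; last first.
    by apply: (subvP (T1T YT)); exact: mT.
  have vW : v \in W by have [s _] := TW YT; apply: (subvP s).
  have /xT sx : (Y :&: W2)%VS \in T0 :: capW T.
    move: YT; rewrite !inE => /predU1P [->|YT]; first by rewrite eqxx.
    by apply/orP; right; apply/mapP; exists Y.
  have /sx : v - p *m v \in (Y :&: W2)%VS.
    rewrite capWE (compl_cperp JT BW Bu vW) andbT memvB //.
    by apply: (subvP (T1T YT)); apply: (pT YT).
  by rewrite capWE -x_p => /andP[].
Qed.

Lemma kap_Ud : kap (block_mx a 0 y x) *m Ud = m.
Proof.
apply: mx_ext => v; rewrite -mulmxA (kap_T (mem_head T1 T) (UdT v)) (mulmxA x) x_Ud mul0mx add0r.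
by rewrite (mulmxA (Ub^T *m J)) UbUd mul1mx.
Qed.

Lemma kap_Ub : kap (block_mx a 0 y x) *m Ub = - (Ub *m a^T).
Proof.
apply: mx_ext => v; have vU : Ub *m v \in U1 by apply/UbE; exists v.
rewrite -mulmxA (kap_U (mem_head U1 U) vU) (mulmxA x) x_Ub mul0mx add0r.
rewrite (mulmxA (m^T *m J)) m_Ub -scalemxAl -scalemxAr scalerA eps2 scale1r.
by rewrite mulNmx mulmxA.
Qed.

Lemma Ub_kap : Ub^T *m J *m kap (block_mx a 0 y x) = a *m (Ub^T *m J).
Proof.
rewrite kapE mulmxBr mulmxDr Ub_x add0r -scalemxAr !(mulmxA (Ub^T *m J)) UbUb Ub_m.
by rewrite mul0mx scaler0 subr0.
Qed.

Lemma kap_eq0 : kap (block_mx a 0 y x) = 0 -> block_mx a 0 y x = 0.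
Proof.
move=> k0; have m0 : m = 0 by rewrite -kap_Ud k0 mul0mx.
have a0 : a = 0 by rewrite -Ub_m m0 mulmx0.
have y0 : y = 0 by move: m0; rewrite a0 mulmx0 add0r.
have x0 : x = 0.
  by move: k0; rewrite kapE a0 y0 mulmx0 addr0 mul0mx addr0 trmx0 mul0mx mulmx0 scaler0 subr0.
by rewrite a0 y0 x0 block_mx0.
Qed.

End OneZ.

(** Exchanging the factors exchanges the coefficient of Ub^T J with the one that appears transposed
    after Ub, so the commutator has the shape of [kap] again. *)
Lemma kap_mul a y x a' y' x' :
  Reg J W2 (capW U) (T0 :: capW T) x -> (forall v, y *m v \in T0) ->
  Reg J W2 (capW U) (T0 :: capW T) x' -> (forall v, y' *m v \in T0) ->
  kap (block_mx a 0 y x) *m kap (block_mx a' 0 y' x') =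
  x *m x' + (x *m y' + (Ud *m a + y) *m a') *m (Ub^T *m J)
    + eps *: (Ub *m ((x' *m y + (Ud *m a' + y') *m a)^T *m J)).
Proof.
move=> xR yT xR' yT'; rewrite [in LHS]kapE.
have mm : (Ud *m a + y)^T *m J *m (Ud *m a' + y') = 0.
  by apply: mx_w0 => k l; have [_ i] := TW (mem_head T1 T); apply: i; apply: mT.
rewrite kapE (kap_alg _ _ (x_m a' y' xR) (x_Ub xR) (Ub_x xR') (Ub_m a' yT') UbUb _ mm (m_Ub a yT) (r := (x' *m y)^T *m J)).
  by rewrite [(x' *m y + _)^T]linearD /= [(_ *m a)^T]trmx_mul; congr (_ + _ *: (_ *m _)); rewrite [RHS]mulmxDl mulmxA.
by rewrite (xTJ xR') (x_m a y xR').
Qed.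


Lemma kap_lie a y x a' y' x' :
  Reg J W2 (capW U) (T0 :: capW T) x -> (forall v, y *m v \in T0) ->
  Reg J W2 (capW U) (T0 :: capW T) x' -> (forall v, y' *m v \in T0) ->
  kap (lie (block_mx a 0 y x) (block_mx a' 0 y' x')) =
  lie (kap (block_mx a 0 y x)) (kap (block_mx a' 0 y' x')).
Proof.
move=> xR yT xR' yT'; rewrite lie_block kapE [RHS]/lie !kap_mul // /lie.
have -> : Ud *m (a *m a' - a' *m a) + (y *m a' + x *m y' - (y' *m a + x' *m y)) =
   (x *m y' + (Ud *m a + y) *m a') - (x' *m y + (Ud *m a' + y') *m a).
  rewrite mulmxBr !mulmxDl !mulmxA; set b1 := Ud *m a *m a'; set b2 := Ud *m a' *m a.
  set b3 := y *m a'; set b4 := x *m y'; set b5 := y' *m a; set b6 := x' *m y.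
  by apply/matrixP => i j; rewrite !mxE; ring.
set b1 := _ + _ *m a'; set b2 := _ + _ *m a.
rewrite mulmxBl [(b1 - b2)^T]linearB /= mulmxBl mulmxBr scalerBr.
set b3 := x *m x'; set b4 := x' *m x; set b5 := b1 *m _; set b6 := b2 *m _.
set b7 := eps *: _; set b8 := eps *: _.
by apply/matrixP => i j; rewrite !mxE; ring.
Qed.

Lemma kap_lin k z z' : kap (k *: z + z') = k *: kap z + kap z'.
Proof.
have key (m0 m1 : 'M[F]_(N, c)) (d0 d1 : 'M[F]_N) :
    (k *: d0 + d1) + (k *: m0 + m1) *m (Ub^T *m J) - eps *: (Ub *m ((k *: m0 + m1)^T *m J)) =
    k *: (d0 + m0 *m (Ub^T *m J) - eps *: (Ub *m (m0^T *m J)))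
     + (d1 + m1 *m (Ub^T *m J) - eps *: (Ub *m (m1^T *m J))).
  rewrite linearP !mulmxDl mulmxDr -!scalemxAl -scalemxAr.
  set b1 := m0 *m _; set b2 := m1 *m _; set b3 := Ub *m _; set b4 := Ub *m _.
  by apply/matrixP => i j; rewrite !mxE; ring.
rewrite /kap.
have -> : drsubmx (k *: z + z') = k *: drsubmx z + drsubmx z' by rewrite /drsubmx !linearP.
have -> : Ud *m ulsubmx (k *: z + z') + dlsubmx (k *: z + z') =
   k *: (Ud *m ulsubmx z + dlsubmx z) + (Ud *m ulsubmx z' + dlsubmx z').
  by rewrite /ulsubmx /dlsubmx !linearP scalerDr addrACA.
exact: key.
Qed.

(** a is read off from X Ud by pairing with Ub, y is the rest of X Ud, and x is the compression of X
    to W2. *)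
Lemma kap_surj X : Reg J W (U1 :: U) (T1 :: T) X ->
  exists z, [/\ Gc J W2 (capW U) T0 (capW T) z & X = kap z].
Proof.
move=> XR; have XW := Reg_im JT Ju Wn XR; case: XR => Xc Xk XU XT.
have XUb : exists a', X *m Ub = Ub *m a'.
  have [L [LB BE]] : exists L : 'M[F]_(c, N), L *m Ub = 1%:M /\ True.
    exists (eps *: (Ud^T *m J)); split=> //.
    by rewrite -scalemxAl UdUb scalerA eps2 scale1r.
  exists (L *m X *m Ub); apply: mx_ext => v.
  have /XU h : U1 \in U1 :: U by exact: mem_head.
  have /h /UbE [k kE] : Ub *m v \in U1 by apply/UbE; exists v.
  by rewrite -!mulmxA kE (mulmxA L) LB mul1mx.
have [a' Xa'] := XUb.
pose a := Ub^T *m J *m X *m Ud; pose y := X *m Ud - Ud *m a; pose x := cpr J B X.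
have XUd k : X *m Ud *m k \in T1.
  by rewrite -mulmxA; apply: (XT T1 (mem_head _ _)); exact: UdT.
have UbX : Ub^T *m J *m X = - (a'^T *m (Ub^T *m J)).
  have /clsP h := Xc.
  have : (X *m Ub)^T *m J = - (Ub^T *m J *m X) by rewrite trmx_mul -(mulmxA Ub^T X^T) h mulmxN mulmxA.
  by move=> h'; rewrite -[LHS]opprK -h' Xa' trmx_mul mulmxA.
have aE : a = - a'^T by rewrite /a UbX mulNmx -mulmxA UbUd mulmx1.
have yT0 v : y *m v \in T0.
  rewrite capWE; apply/andP; split.
    by rewrite /y mulmxBl memvB // -mulmxA.
  have yT1 : y *m v \in T1 by rewrite /y mulmxBl memvB // -mulmxA.
  have [s i] := TW (mem_head T1 T).
  apply/W2P; split; first exact: (subvP s).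
    by rewrite mulmxA /y mulmxBr !mulmxA UbUd mul1mx /a subrr mul0mx.
  by apply: mx_w0v => k; apply: i.
have xR : Reg J W2 (capW U) (T0 :: capW T) x.
  split.
  - exact: (cpr_cls JT Bu).
  - by move=> v vW; apply: (cpr_kill JT BW Bu Xk vW).
  - move=> _ /mapP [Y YU ->]; have YU' : Y \in U1 :: U by rewrite inE YU orbT.
    have [s _] := UW YU'; apply: (cpr_stable JT BW Bu s); first exact: XU.
    by move=> v vY; apply: (subvP (U1U YU')); apply: (pU YU').
  - have h Y : Y \in T1 :: T -> stable x (Y :&: W2)%VS.
      move=> YT; have [s _] := TW YT; apply: (cpr_stable JT BW Bu s); first exact: XT.
      by move=> v vY; apply: (subvP (T1T YT)); apply: (pT YT).
    move=> Y; rewrite inE => /predU1P [->|/mapP [Z ZT ->]]; apply: h; first exact: mem_head.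
    by rewrite inE ZT orbT.
exists (block_mx a 0 y x); split; first by exists a, y, x.
rewrite kapE; have -> : Ud *m a + y = X *m Ud by rewrite /y addrC subrK.
rewrite /x /cpr; have -> : gproj J B = Ud *m (Ub^T *m J) + eps *: (Ub *m (Ud^T *m J)).
  by apply: mx_ext => v; rewrite pE mulmxDl -scalemxAl -!mulmxA.
apply: (kap_surj_alg (a' := a') (q := Ud^T *m J)) => //.
- by have /clsP h := Xc; rewrite trmx_mul -(mulmxA Ud^T X^T) h mulmxN opprK mulmxA.
- by rewrite mulmxA.
- apply: mx_w0 => k l; have [_ i] := TW (mem_head T1 T); apply: i; first exact: UdT.
  exact: XUd.
- exact: UbUb.
- exact: UdUb.
Qed.


(** With V = 0, [reduction] says that an isomorphism transports a Frobenius functional, its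
    principal element and the spectrum. On the quotients, U1 carries - a^T, T1 / T0 carries a, and
    the others are those of W2. *)
Lemma kappa_claim :
  (forall W' U' T', (\dim W' < \dim W)%N -> wf e J W' U' T' -> claim_state e J W' U' T') ->
  claim_state e J W (U1 :: U) (T1 :: T).
Proof.
move=> IH g A h gE fr hp.
have [g' g'E] : exists g' : {vspace 'M[F]_(c + N)}, forall z, z \in g' <-> Gc J W2 (capW U) T0 (capW T) z.
  apply: subspace_exists.
    exists 0, 0, 0; split; rewrite ?block_mx0 //; first exact: Reg0.
    by move=> v; rewrite mul0mx mem0v.
  move=> k z z' [a1 [y1 [x1 [-> xR1 yT1]]]] [a2 [y2 [x2 [-> xR2 yT2]]]].
  rewrite scale_block_mx add_block_mx scaler0 addr0; do 3 eexists; split; first by reflexivity.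
    exact: Reg_sub.
  by move=> v; rewrite mulmxDl -scalemxAl memvD ?memvZ.
have gl : lie_closed g by move=> x y /gE xR /gE yR; apply/gE; exact: Reg_lie.
have gl' : lie_closed g' by exact: Gc_lie g'E.
have [A' [z [v0 [fr' hp' v00 hE eigE]]]] : exists A' h' v0,
   [/\ frob g' A', prin g' A' h', v0 \in (0%VS : {vspace 'M[F]_N}), h = 0 + kap h' + v0 &
    forall l, ad_eigenvalue g h l <->
      [\/ ad_eigenvalue 0%VS h l, ad_eigenvalue 0%VS h (1 - l) | ad_eigenvalue g' h' l]].
  apply: (reduction (iota := kap) _ gl gl') => //.
  - exact: kap_lin.
  - by move=> _ /g'E [a [y [x [-> xR yT]]]]; apply/gE; exact: kap_Reg.
  - by move=> _ /g'E [a [y [x [-> xR yT]]]]; rewrite memv0 => /eqP; exact: kap_eq0.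
  - move=> _ _ /g'E [a [y [x [-> xR yT]]]] /g'E [a' [y' [x' [-> xR' yT']]]].
    exact: kap_lie.
  - exact: sub0v.
  - by move=> x v _; rewrite !memv0 => /eqP ->; rewrite lie0r.
  - by move=> v v'; rewrite !memv0 => /eqP -> /eqP ->; rewrite lie0r mulmx0 raddf0.
  - by move=> x v _; rewrite memv0 => /eqP ->; rewrite lie0r mulmx0 raddf0.
  - move=> x /gE /kap_surj [z [zG ->]] _; exists z, 0; split; rewrite ?mem0v ?addr0 //.
    exact/g'E.
  - exact: mem0v.
  - by move=> v; rewrite memv0 => /eqP ->; rewrite lie0r mulmx0 raddf0.
  - by move=> x _; rewrite lie0l mulmx0 raddf0.
  - by move=> x _; rewrite lie0l mem0v.
  - exact: fr.
  - exact: hp.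
move: v00 hE; rewrite memv0 => /eqP ->; rewrite add0r addr0 => hE.
have no0 l : ~ ad_eigenvalue (0%VS : {vspace 'M[F]_N}) h l.
  by case=> x []; rewrite memv0 => ->.
(* If T1 cap W2 were zero, then y = 0 throughout and the identity of gl_c would be a nonzero central
   element. *)
have T0n : T0 != 0%VS.
  apply/eqP => T00; have y0 (y : 'M[F]_(N, c)) : (forall v, y *m v \in T0) -> y = 0.
    by move=> yT; apply: mx_ext => v; have := yT v; rewrite T00 memv0 mul0mx => /eqP.
  have : block_mx 1%:M 0 0 0 = 0 :> 'M[F]_(c + N).
    apply: fr'.
      apply/g'E; exists 1%:M, 0, 0; split=> //; first exact: Reg0.
      by move=> v; rewrite mul0mx mem0v.
    move=> _ /g'E [a [y [x [-> xR /y0 ->]]]]; rewrite lie_block lie0l !mulmx0 !mul0mx !addr0 subrr.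
    by rewrite /lie mul1mx mulmx1 subrr block_mx0 mulmx0 raddf0.
  rewrite -(block_mx0 F c N c N) => /eq_block_mx [/matrixP /(_ (Ordinal c0) (Ordinal c0)) /eqP].
  by rewrite !mxE eqxx oner_eq0.
have wf2 := W2_wf T0n.
have cG : claim_G e J c W2 (capW U) T0 (capW T).
  apply: claim_G_all => //.
  by move=> T' wf'; apply: IH => //; exact: W2_dim.
have [a [y [x [zE xR yT]]]] := (g'E z).1 hp'.1.
rewrite zE in hp' hE eigE.
have [gU [gT0 gT] g3 g4 [m um]] := cG _ _ _ _ _ g'E fr' hp'.
have hR := (gE h).1 hp.1; have [_ _ hU hT] := hR.
have W2n := cperp_nondeg JT Wn BW Bu.
have xW2 v : v \in W2 -> x *m v \in W2 by move=> _; exact: (Reg_im JT Ju W2n xR).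
have [_ _ [[_ _ cU] [_ _ cT]] _ _] := Wf.
have evU1 l : ev h 0%VS U1 l <-> evm a (- l).
  rewrite -evm_opp_tr; apply: (ev0_evm (Tb := Ub)).
  - exact: UbE.
  - move=> k k0; have : Ud^T *m J *m (Ub *m k) = 0 by rewrite k0 mulmx0.
    rewrite mulmxA UdUb -scalemxAl mul1mx => h0.
    by rewrite -[k]scale1r -(eps2 F e) -scalerA h0 scaler0.
  - by rewrite hE kap_Ub // mulmxN.
have evT01 l : ev h T0 T1 l <-> evm a l.
  rewrite evm_col; split.
    case=> v [vT vn]; rewrite capWE => /andP [_ /W2P [_ h0 _]]; exists (Ub^T *m J *m v).
      apply: contraNneq vn => h1; rewrite capWE vT /=.
      have [s i] := TW (mem_head T1 T).
      apply/W2P; split=> //; first exact: (subvP s).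
      by apply: mx_w0v => k; apply: i.
    move: h0; rewrite mulmxBr (mulmxA _ h v) hE Ub_kap // -scalemxAr -(mulmxA a) => /eqP.
    by rewrite subr_eq0 => /eqP.
  case=> v vn ve; exists (Ud *m v); split=> //.
    rewrite capWE; apply/negP => /andP [_ /W2P [_ h0 _]].
    by move: vn; rewrite -[v]mul1mx -UbUd -mulmxA h0 eqxx.
  rewrite mulmxA hE kap_Ud // mulmxDl -mulmxA ve scalemxAr addrAC subrr add0r.
  exact: yT.
have hxT v : v \in T0 -> h *m v = x *m v.
  rewrite capWE => /andP [vT /W2P [_ h0 _]].
  by rewrite hE (kap_T a x yT (mem_head T1 T) vT) h0 mulmx0 addr0.
have evT0 l : ev h 0%VS T0 l <-> ev x 0%VS T0 l.
  by split=> -[v [vT vn ve]]; exists v; split=> //; move: ve; rewrite hxT.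
have sT0 : stable h T0.
  by move=> v vT; rewrite hxT //; case: xR => _ _ _; apply; rewrite ?mem_head.
split.
- split.
    (* spec U1 = - spec a is the reflection of spec a + 1. *)
    by apply: good_ext (good_refl g3) => l; rewrite evU1 addrAC subrr add0r.
  apply: (allgood_cap (x := x) JT BW Bu cU).
  + by apply: hU; exact: mem_head.
  + by move=> Y YU; apply: hU; rewrite inE YU orbT.
  + by move=> Y YU; have [] := @UW Y; rewrite // inE YU orbT.
  + by move=> Y v YU; apply: pU; rewrite inE YU orbT.
  + move=> Y v YU vY vW2; have YU' : Y \in U1 :: U by rewrite inE YU orbT.
    rewrite hE (kap_U _ _ _ YU' vY) addrAC subrr add0r memvN memvZ //.
    by apply/UbE; eexists.
  + exact: xW2.
  + by rewrite U1W2.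
- split.
    apply: good_ext g4 => l; rewrite (@ev_split _ _ h 0%VS T0 T1) ?sub0v ?capvSl //.
    + by rewrite evT0 evT01; tauto.
    + by move=> v; rewrite !memv0 => /eqP ->; rewrite mulmx0.
  apply: (allgood_cap (x := x) JT BW Bu cT).
  + by apply: hT; exact: mem_head.
  + by move=> Y YT; apply: hT; rewrite inE YT orbT.
  + by move=> Y YT; have [] := @TW Y; rewrite // inE YT orbT.
  + by move=> Y v YT; apply: pT; rewrite inE YT orbT.
  + move=> Y v YT vY /W2P [_ h0 _]; have YT' : Y \in T1 :: T by rewrite inE YT orbT.
    by rewrite hE (kap_T _ _ yT YT' vY) h0 mulmx0 addr0 subrr mem0v.
  + exact: xW2.
  + exact: gT.
exists m => l; rewrite -um eigE; split=> [[/no0|/no0|]|] //.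
by move=> h0; constructor 3.
Qed.

End Kappa.
(** Since no nonzero vector of U1 is orthogonal to T1, the Gram matrix of bases has a right inverse,
    which provides a family in T1 dual to the basis of U1. *)
Lemma claim_iso W U1 U T1 T :
  wf e J W (U1 :: U) (T1 :: T) ->
  (forall u, u \in U1 -> (forall z, z \in T1 -> w u z = 0) -> u = 0) ->
  (forall W' U' T', (\dim W' < \dim W)%N -> wf e J W' U' T' -> claim_state e J W' U' T') ->
  claim_state e J W (U1 :: U) (T1 :: T).
Proof.
move=> Wf inj IH.
have [Ub [L [LU UbE]]] := col_basis U1.
have [Tb [L' [LT TbE]]] := col_basis T1.
have [l lU|R RE] := @row_free_inj _ _ (Ub^T *m J *m Tb).
  have : Ub *m l^T = 0.
    apply: inj; first by apply/UbE; exists l^T.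
    by move=> z /TbE [k ->]; rewrite wE trmxK lU mul0mx mxE.
  move/(congr1 (mulmx L)); rewrite mulmxA LU mul1mx mulmx0 => /(congr1 trmx).
  by rewrite trmxK trmx0.
have c0 : (0 < \dim U1)%N.
  case: Wf => _ _ [[_ U1n _] _] _ _; by rewrite lt0n dimv_eq0 -subv0.
apply: (kappa_claim Wf c0 UbE (Ud := Tb *m R)) => //.
  by move=> k; apply/TbE; exists (R *m k); rewrite mulmxA.
by rewrite mulmxA.
Qed.

End Iso.

(** * Elements of the kernel of the Kirillov form *)

Section Wedge.
Variables (F : numClosedFieldType) (e : bool) (N : nat) (J : 'M[F]_N).
Local Notation eps := (sg F e).
Hypothesis JT : J^T = eps *: J.
Hypothesis Ju : J \in unitmx.
Local Notation w := (w J).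
Local Notation vs := ({vspace 'cV[F]_N}).

(** The element of the algebra given by the exterior product of u and t in the orthogonal case, and
    by their symmetric product in the symplectic case. *)
Definition wedge (u t : 'cV[F]_N) : 'M[F]_N := t *m (u^T *m J) - eps *: (u *m (t^T *m J)).

Lemma w_mx (u v : 'cV[F]_N) : u^T *m J *m v = (w u v)%:M.
Proof. by rewrite [LHS]mx11_scalar. Qed.

Lemma wedgeE u t v : wedge u t *m v = w u v *: t - (eps * w t v) *: u.
Proof.
rewrite /wedge mulmxBl -scalemxAl -!mulmxA !(mulmxA _ J) !w_mx !mul_mx_scalar scalerA //.
Qed.

Lemma wedge_cls u t : wedge u t \in cls J.
Proof.
apply: cls_of_w => a b; rewrite !wedgeE wBl wBr !wZl !wZr.
rewrite [w a t](wC JT) [w a u](wC JT).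
have := eps2 F e; set E := sg F e => E2.
set b1 := w u a; set b2 := w t b; set b3 := w t a; set b4 := w u b.
have -> : E * b3 * b4 = b4 * (E * b3) by ring.
have -> : E * b2 * (E * b1) = (E * E) * (b1 * b2) by ring.
by rewrite E2; ring.
Qed.

(** The two rank one terms contribute equally because A is skew for [w]. *)
Lemma tr_wedge A u t : A \in cls J -> \tr (A *m wedge u t) = 2 * w u (A *m t).
Proof.
move=> Ac; rewrite /wedge mulmxBr raddfB /= -scalemxAr mxtraceZ !mulmxA.
rewrite [\tr (A *m t *m _ *m _)]mxtrace_mulC mulmxA.
have trw (x : 'cV[F]_N) (z : 'rV[F]_N) : \tr (x *m z) = (z *m x) 0 0.
  by rewrite mxtrace_mulC /mxtrace big_ord1.
rewrite -!mulmxA [\tr (J *m _)]mxtrace_mulC -!mulmxA !mulmxA -(mulmxA (A *m t)) -(mulmxA (A *m u)) !trw.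
rewrite -/(w u (A *m t)) -/(w t (A *m u)) -[w t _]opprK -cls_w // (wC JT (A *m t)) mulrN mulrA eps2 mul1r opprK.
by rewrite -mulr2n mulr_natl.
Qed.

Lemma lie_wedge y u t : y \in cls J -> lie y (wedge u t) = wedge (y *m u) t + wedge u (y *m t).
Proof.
move=> yc; apply: mx_ext => v.
have -> : lie y (wedge u t) *m v = y *m (wedge u t *m v) - wedge u t *m (y *m v).
  by rewrite /lie mulmxBl !mulmxA.
have -> : (wedge (y *m u) t + wedge u (y *m t)) *m v = wedge (y *m u) t *m v + wedge u (y *m t) *m v.
  exact: mulmxDl.
rewrite !wedgeE mulmxBr -!scalemxAr !cls_w //.
set b1 := y *m t; set b2 := y *m u; set c1 := w u _; set c2 := w t _; set c3 := w u _; set c4 := w t _.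
by apply/matrixP => i j; rewrite !mxE; ring.
Qed.

Lemma trlie_wedge A y u t : A \in cls J -> y \in cls J ->
  \tr (A *m lie y (wedge u t)) = 2 * (w (y *m u) (A *m t) + w u (A *m (y *m t))).
Proof. by move=> Ac yc; rewrite lie_wedge // mulmxDr raddfD /= !tr_wedge // mulrDr. Qed.

Lemma wedge_eq0 u t : wedge u t = 0 -> u != 0 -> exists a, t = a *: u.
Proof.
move=> h u0.
have [v wv] : exists v, w u v != 0.
  apply: NNPP => no; case/negP: u0; apply/eqP; apply: (w_nondeg Ju) => v.
  by apply/eqP/negPn/negP => wv; apply: no; exists v.
have := wedgeE u t v; rewrite h mul0mx => /eqP; rewrite eq_sym subr_eq0 => /eqP h'.
exists ((w u v)^-1 * (eps * w t v)).
by rewrite -scalerA -h' scalerA mulVf // scale1r.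
Qed.

Lemma wedge_kill (W : vs) u t v : u \in W -> t \in W -> (forall w0, w0 \in W -> w v w0 = 0) ->
  wedge u t *m v = 0.
Proof.
move=> uW tW h; rewrite wedgeE (wC0 JT (h _ uW)) (wC0 JT (h _ tW)) mulr0 !scale0r subr0 //.
Qed.

Definition clsW (W : vs) (x : 'M[F]_N) : Prop :=
  x \in cls J /\ forall v, (forall w0, w0 \in W -> w v w0 = 0) -> x *m v = 0.

Lemma Reg_clsW (W : vs) U T x : Reg J W U T x -> clsW W x.
Proof. by case. Qed.

Lemma wedge_clsW (W : vs) u t : u \in W -> t \in W -> clsW W (wedge u t).
Proof. by move=> uW tW; split; [exact: wedge_cls | move=> v; exact: wedge_kill]. Qed.

Lemma clsW_im (W : vs) x v : nondeg J W -> clsW W x -> x *m v \in W.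
Proof.
move=> Wn [xc xk]; apply: (@Reg_im _ _ _ _ JT Ju W [::] [::]) => //.
Qed.

(** S is the skew part of A for the adjunction defined by [w], and q compresses it to W. Neither
    operation changes traces against the algebra of W, since self-adjoint matrices have trace zero
    against skew ones. *)
Lemma cls_rep (W : vs) A : nondeg J W -> exists A', clsW W A' /\
  forall x, clsW W x -> \tr (A' *m x) = \tr (A *m x).
Proof.
move=> Wn; have [q [q1 q2 q3]] := nondeg_proj JT Wn.
have two : (2 : F) != 0 by rewrite pnatr_eq0.
pose S := 2^-1 *: (A - invmx J *m A^T *m J).
have wq a b : w (q *m a) b = w a (q *m b) by rewrite /w trmx_mul -(mulmxA a^T) q3 !mulmxA.
have Sc : S \in cls J.
  apply/clsP; rewrite /S !linearZ /= -scalemxAl. congr (_ *: _).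
  rewrite linearB /= mulmxBl mulmxBr opprB !trmx_mul trmxK !mulmxA mulmxV // mul1mx; congr (_ - _).
  have JiT : (invmx J)^T = eps *: invmx J.
    rewrite trmx_inv JT; apply: (can_inj (mulKmx Ju)).
    have Ju' : eps *: J \in unitmx.
      rewrite unitmxZ // unitfE; apply/eqP => e0; have := eps2 F e.
      by rewrite e0 mul0r => /eqP; rewrite eq_sym oner_eq0.
    rewrite -[J in J *m invmx _]scale1r -(eps2 F e) -scalerA -scalemxAl mulmxV //.
    by rewrite -scalemxAr mulmxV.
  by rewrite JiT JT -!scalemxAl -!scalemxAr -!scalemxAl scalerA eps2 scale1r mulmxKV.
exists (q *m S *m q); split.
  split; first by apply: cls_of_w => a b; rewrite -!mulmxA wq cls_w // wq.
  move=> v vW; rewrite -mulmxA; have -> : q *m v = 0.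
    by apply: Wn => // w0 w0W; rewrite wq vW.
  by rewrite mulmx0.
move=> x xW; have [xc xk] := xW.
have qx : q *m x = x by apply: mx_ext => v; rewrite -mulmxA q2 // clsW_im.
have xq : x *m q = x.
  apply: mx_ext => v; apply/eqP; rewrite -subr_eq0 -mulmxA -mulmxBr xk // => w0 w0W.
  by rewrite wBl wq q2 // subrr.
rewrite -!mulmxA mxtrace_mulC -!mulmxA xq qx /S -scalemxAl mxtraceZ mulmxBl raddfB /=.
have -> : \tr (invmx J *m A^T *m J *m x) = - \tr (A *m x).
  have /clsP h := xc; have h' : J *m x = - (x^T *m J) by rewrite h opprK.
  rewrite -(mulmxA _ J) h' mulmxN raddfN /= mxtrace_mulC -(mulmxA x^T) mulKVmx //.
  by rewrite -trmx_mul mxtrace_tr.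
by rewrite opprK; set b := \tr _; field.
Qed.

Lemma frob_ext n (g : {vspace 'M[F]_n}) A A' : lie_closed g ->
  (forall x, x \in g -> \tr (A' *m x) = \tr (A *m x)) -> frob g A -> frob g A'.
Proof.
move=> gl h fr x xg hx; apply: fr => // y yg; rewrite -h ?hx //; exact: gl.
Qed.

Lemma prin_ext n (g : {vspace 'M[F]_n}) A A' h : lie_closed g ->
  (forall x, x \in g -> \tr (A' *m x) = \tr (A *m x)) -> prin g A h -> prin g A' h.
Proof.
move=> gl hA [hg hp]; split=> // x xg; rewrite !hA ?hp //; exact: gl.
Qed.

(** * Kernel elements attached to an isotropic subspace K *)

Section Kernel.
Variables (W : vs) (k : {vspace 'M[F]_N}) (A : 'M[F]_N) (K : vs).
Hypothesis Wn : nondeg J W.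
Hypothesis AW : clsW W A.
Hypothesis kW : forall x, x \in k -> clsW W x.
Hypothesis KW : (K <= W)%VS.
Hypothesis Ki : isotropic J K.
Hypothesis Kst : forall y, y \in k -> stable y K.
Hypothesis kH : forall x, clsW W x ->
  (forall v, v \in W -> (forall a, a \in K -> w a v = 0) -> x *m v \in K) -> x \in k.
Hypothesis fr : frob k A.

Let Ac : A \in cls J. Proof. by case: AW. Qed.

Lemma trmx_J m n (M : 'M[F]_(N, m)) (D : 'M[F]_(N, n)) :
  (M^T *m J *m D)^T = eps *: (D^T *m J *m M).
Proof. by rewrite !trmx_mul trmxK JT -!(scalemxAl, scalemxAr) mulmxA. Qed.

Lemma cls_TJ x n (D : 'M[F]_(N, n)) : x \in cls J -> (x *m D)^T *m J = - (D^T *m J *m x).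
Proof. by move/clsP => h; rewrite trmx_mul -(mulmxA D^T x^T) h mulmxN mulmxA. Qed.

(* x = Qb R Qb^T J - (A Dj + Dj A) with Dj = Qb P Qb^T J lies in k and is in the
   kernel of the Kirillov form of A as soon as S X^-1 Y = Y X^-1 S; it maps Qb to
   Qb X^-1 S. *)
Lemma kernel_core n (Qb : 'M[F]_(N, n)) (r : 'cV[F]_N) (S : 'M[F]_n) :
  (forall v : 'cV_N, v \in K <-> exists c a, v = Qb *m c + a *: r) ->
  (forall c : 'cV_n, Qb *m c = 0 -> c = 0) ->
  r^T *m J *m A *m Qb = 0 -> r^T *m J *m A *m A *m Qb = 0 ->
  forall (X Y : 'M[F]_n), X = - (Qb^T *m J *m A *m Qb) -> Y = - (Qb^T *m J *m A *m A *m Qb) ->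
  X \in unitmx ->
  S^T = eps *: S -> S *m invmx X *m Y = Y *m invmx X *m S -> S = 0.
Proof.
move=> KE Qi r1 r2 X Y XE YE Xu ST SXY.
have QK c : Qb *m c \in K by apply/KE; exists c, 0; rewrite scale0r addr0.
have AT : A^T *m J = - (J *m A) by apply/clsP.
have XT : X^T = - (eps *: X).
  rewrite XE linearN /= -(mulmxA _ A Qb) trmx_J cls_TJ //.
  by rewrite mulNmx mulmxA.
have YE' : Y = (A *m Qb)^T *m J *m (A *m Qb) by rewrite YE cls_TJ // mulNmx mulmxA.
have YT : Y^T = eps *: Y by rewrite YE' trmx_J.
have [Xi XiE] : exists Xi, Xi = invmx X by eexists.
have XXi : X *m Xi = 1%:M by rewrite XiE mulmxV.
have XiX : Xi *m X = 1%:M by rewrite XiE mulVmx.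
have XiT : Xi^T = - (eps *: Xi).
  have h : Xi^T *m X^T = 1%:M by rewrite -trmx_mul XXi trmx1.
  rewrite -[Xi^T]mulmx1 -XXi mulmxA -[Xi^T *m X]scale1r -(eps2 F e) -scalerA.
  have -> : eps *: (Xi^T *m X) = - (Xi^T *m X^T) by rewrite XT mulmxN opprK scalemxAr.
  by rewrite h scalerN mulNmx -scalemxAl mul1mx.
rewrite -XiE in SXY.
have [P PE] : exists P, P = Xi *m S *m Xi by eexists.
have [R RE0] : exists R, R = P *m Y *m Xi by eexists.
have PT : P^T = eps *: P.
  rewrite PE !trmx_mul XiT ST !(mulNmx, mulmxN) opprK -!(scalemxAl, scalemxAr) !scalerA.
  by rewrite -?mulrA eps2 ?mul1r ?mulr1 mulmxA.
have RT : R^T = - (eps *: R).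
  have RE : R = Xi *m Y *m Xi *m S *m Xi.
    have -> : R = Xi *m (S *m Xi *m Y) *m Xi by rewrite RE0 PE !mulmxA.
    by rewrite SXY !mulmxA.
  rewrite {1}RE0 !trmx_mul XiT YT PT !(mulNmx, mulmxN) -!(scalemxAl, scalemxAr) !scalerA.
  by rewrite -?mulrA eps2 ?mul1r ?mulr1 RE PE !mulmxA.
have QJQ : Qb^T *m J *m Qb = 0 by apply: mx_w0 => c d; exact: Ki.
have [Dj DjE] : exists Dj, Dj = Qb *m P *m Qb^T *m J by eexists.
have [Z ZE] : exists Z, Z = Qb *m R *m Qb^T *m J by eexists.
have [x xE] : exists x, x = Z - (A *m Dj + Dj *m A) by eexists.
have DjT : Dj^T *m J = J *m Dj.
  rewrite DjE !trmx_mul !trmxK PT JT -!(scalemxAl, scalemxAr) scalerA eps2 scale1r.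
  by rewrite !mulmxA.
have ZT : Z^T *m J = - (J *m Z).
  rewrite ZE !trmx_mul !trmxK RT JT ?(mulNmx, mulmxN) -!(scalemxAl, scalemxAr) ?(mulNmx, mulmxN) -?(scalemxAl, scalemxAr).
  by rewrite ?scalerN scalerA eps2 scale1r !mulmxA.
have xc : x \in cls J.
  apply/clsP; rewrite xE linearB linearD /= mulmxBl mulmxDl !trmx_mul ZT.
  rewrite -(mulmxA Dj^T) AT mulmxN (mulmxA Dj^T) DjT -(mulmxA A^T) DjT (mulmxA A^T) AT mulNmx.
  rewrite mulmxBr mulmxDr opprB opprD !opprK !mulmxA.
  set b1 := J *m Z; set b2 := _ *m A; set b3 := _ *m Dj.
  by apply/matrixP => i j; rewrite !mxE; ring.
have Dj0 v : (forall c, w (Qb *m c) v = 0) -> Dj *m v = 0 /\ Z *m v = 0.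
  by move/mx_w0v => h; rewrite DjE ZE -!(mulmxA _ J) -!(mulmxA _ Qb^T) (mulmxA Qb^T) h !mulmx0.
have DjK v : Dj *m v \in K by rewrite DjE -!mulmxA; exact: QK.
have ZK v : Z *m v \in K by rewrite ZE -!mulmxA; exact: QK.
have xk : x \in k.
  apply: kH.
    split=> // v vW; have [_ Ak] := AW; have Av := Ak v vW.
    have [|d0 z0] := Dj0 v.
      by move=> c; apply: (wC0 JT); apply: vW; apply: (subvP KW).
    by rewrite xE mulmxBl mulmxDl z0 -!mulmxA d0 Av !mulmx0 addr0 subrr.
  move=> v vW vK; have [|d0 z0] := Dj0 v; first by move=> c; apply: vK.
  by rewrite xE mulmxBl mulmxDl z0 -!mulmxA d0 mulmx0 !add0r memvN.
have r1' : Qb^T *m J *m A *m r = 0.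
  have := congr1 trmx r1; rewrite -(mulmxA _ A) trmx_J trmx0 cls_TJ // mulNmx scalerN => /eqP.
  rewrite oppr_eq0 => /eqP h.
  by rewrite -[LHS]scale1r -(eps2 F e) -scalerA h scaler0.
have r2' : Qb^T *m J *m A *m A *m r = 0.
  have := congr1 trmx r2; rewrite -!(mulmxA _ A) trmx_J trmx0.
  rewrite !cls_TJ // !mulNmx opprK !mulmxA => h.
  by rewrite -[LHS]scale1r -(eps2 F e) -scalerA h scaler0.
have x0 : x = 0.
  apply: fr => // y yk; have [yc _] := kW yk.
  have [et [rho yQ]] : exists (et : 'M_n) (rho : 'rV_n), y *m Qb = Qb *m et + r *m rho.
    have hc j : exists cr : 'cV[F]_n * F, col j (y *m Qb) = Qb *m cr.1 + cr.2 *: r.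
      have : y *m (Qb *m delta_mx j 0) \in K by apply: Kst.
      by move=> /KE [c [a ca]]; exists (c, a); rewrite colE -mulmxA ca.
    have [f fE] := fin_all_exists hc.
    exists (\matrix_(i, j) (f j).1 i 0), (\row_j (f j).2); apply/matrixP => i j.
    have /colP/(_ i) := fE j; rewrite mxE => ->; rewrite !mxE big_ord1 !mxE mulrC; congr (_ + _).
    by apply: eq_bigr => l _; rewrite !mxE.
  have Qy : Qb^T *m J *m y = - ((et^T *m Qb^T + rho^T *m r^T) *m J).
    have /clsP yJ := yc; have := congr1 (fun M => M^T *m J) yQ.
    rewrite /= linearD /= !trmx_mul -(mulmxA _ y^T) yJ mulmxN => h.
    by rewrite -h opprK mulmxA.
  (* The component of y Qb along r drops out of these traces because r is orthogonal to A Qb and to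
     A A Qb; y then enters only through et. *)
  have tl (M : 'M_N) (C : 'M_n) : r^T *m J *m M *m Qb = 0 ->
      \tr (M *m (Qb *m C *m Qb^T *m J) *m y) = - \tr (C *m et^T *m (Qb^T *m J *m M *m Qb)).
    move=> rM; have -> : M *m (Qb *m C *m Qb^T *m J) *m y = (M *m Qb *m C) *m (Qb^T *m J *m y).
      by rewrite !mulmxA.
    rewrite Qy mulmxN raddfN /= mxtrace_mulC mulmxDl mulmxDl raddfD /=.
    have -> : rho^T *m r^T *m J *m (M *m Qb *m C) = rho^T *m (r^T *m J *m M *m Qb) *m C.
      by rewrite !mulmxA.
    rewrite rM mulmx0 mul0mx raddf0 addr0; congr (- _).
    by rewrite [in RHS]mxtrace_mulC !mulmxA [in RHS]mxtrace_mulC !mulmxA.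
  have tr_ (M : 'M_N) (C : 'M_n) : Qb^T *m J *m M *m r = 0 ->
      \tr ((Qb *m C *m Qb^T *m J) *m M *m y) = \tr (C *m (Qb^T *m J *m M *m Qb) *m et).
    move=> rM; have -> : (Qb *m C *m Qb^T *m J) *m M *m y = Qb *m (C *m (Qb^T *m J *m M *m y)).
      by rewrite !mulmxA.
    rewrite mxtrace_mulC -!mulmxA yQ !mulmxDr !mulmxA.
    have -> : C *m Qb^T *m J *m M *m r *m rho = C *m (Qb^T *m J *m M *m r) *m rho by rewrite !mulmxA.
    by rewrite rM mulmx0 mul0mx addr0.
  have -> : \tr (A *m lie x y) = \tr (A *m Z *m y) - \tr (Z *m A *m y)
      - \tr (A *m A *m Dj *m y) + \tr (Dj *m (A *m A) *m y).
    have -> : \tr (A *m lie x y) = \tr (A *m x *m y - x *m A *m y).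
      by rewrite /lie mulmxBr !raddfB /= !mulmxA; congr (_ - _); rewrite mxtrace_mulC mulmxA.
    rewrite -raddfB -raddfB -raddfD /=; congr (\tr _); rewrite xE.
    rewrite !(mulmxDl, mulmxDr, mulmxBl, mulmxBr, mulNmx, mulmxN) !mulmxA.
    set b1 := A *m Z *m y; set b2 := Z *m A *m y; set b3 := A *m A *m Dj *m y.
    set b4 := A *m Dj *m A *m y; set b5 := Dj *m A *m A *m y.
    by apply/matrixP => i j; rewrite !mxE; ring.
  have r2A : r^T *m J *m (A *m A) *m Qb = 0 by rewrite !mulmxA.
  have r2A' : Qb^T *m J *m (A *m A) *m r = 0 by rewrite !mulmxA.
  rewrite ZE DjE (tl _ _ r1) (tr_ _ _ r1') (tl _ _ r2A) (tr_ _ _ r2A').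
  have XA : Qb^T *m J *m A *m Qb = - X by rewrite XE opprK.
  have YA : Qb^T *m J *m (A *m A) *m Qb = - Y by rewrite YE opprK !mulmxA.
  have trN (M : 'M[F]_n) : \tr (- M) = - \tr M by rewrite raddfN.
  rewrite XA YA ![_ *m - _]mulmxN ![- _ *m _]mulNmx !trN !opprK.
  (* R is chosen to satisfy R X = P Y. The commutation hypothesis on S gives X R = Y P as well, and
     then the four traces cancel. *)
  have RX : R *m X = P *m Y by rewrite RE0 -mulmxA XiX mulmx1.
  have XR : X *m R = Y *m P.
    by rewrite RE0 PE !mulmxA XXi mul1mx -[Y *m Xi *m S]SXY.
  rewrite RX [\tr (R *m _ *m _)]mxtrace_mulC mulmxA XR.
  rewrite [\tr (P *m et^T *m _)]mxtrace_mulC mulmxA.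
  by set b1 := \tr _; set b2 := \tr _; ring.
have [DQ ZQ] : Dj *m Qb = 0 /\ Z *m Qb = 0.
  by rewrite DjE ZE -!(mulmxA _ J) -!(mulmxA _ Qb^T) (mulmxA Qb^T) QJQ !mulmx0.
have : x *m Qb = Qb *m (Xi *m S).
  rewrite xE mulmxBl mulmxDl ZQ -(mulmxA A) DQ mulmx0 !add0r DjE.
  have -> : Qb *m P *m Qb^T *m J *m A *m Qb = Qb *m P *m (Qb^T *m J *m A *m Qb) by rewrite !mulmxA.
  rewrite -[Qb^T *m J *m A *m Qb]opprK -XE mulmxN opprK PE -!mulmxA XiX mulmx1 //.
rewrite x0 mul0mx => /esym h.
have XS : Xi *m S = 0.
  apply/matrixP => i j; have := Qi (Xi *m S *m delta_mx j 0).
  rewrite !mulmxA -(mulmxA Qb) h mul0mx -colE => /(_ erefl) /colP/(_ i).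
  by rewrite !mxE.
by rewrite -[S]mul1mx -XXi -mulmxA XS mulmx0.
Qed.


Lemma wedge_k r z : r \in K -> z \in W -> wedge r z \in k.
Proof.
move=> rK zW; apply: kH; first by apply: wedge_clsW => //; apply: (subvP KW).
by move=> v vW vK; rewrite wedgeE vK // scale0r sub0r memvN memvZ.
Qed.

Lemma wedge_ker r z : r \in K -> z \in W ->
  (forall y, y \in k -> w (y *m r) (A *m z) + w r (A *m (y *m z)) = 0) -> wedge r z = 0.
Proof.
move=> rK zW h; apply: fr; first exact: wedge_k.
move=> y yk; have [yc _] := kW yk.
by rewrite trlieC trlie_wedge // h // mulr0 oppr0.
Qed.

Lemma col_inj n m (B : 'M[F]_(N, n)) (L : 'M[F]_(n, N)) (c : 'M_(n, m)) :
  L *m B = 1%:M -> B *m c = 0 -> c = 0.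
Proof. by move=> LB h; rewrite -[c]mul1mx -LB -mulmxA h mulmx0. Qed.

Lemma K_core_unit n (Qb : 'M[F]_(N, n)) :
  (forall c : 'cV_n, (forall d : 'cV_n, w (Qb *m d) (A *m (Qb *m c)) = 0) -> Qb *m c = 0) ->
  (forall c : 'cV_n, Qb *m c = 0 -> c = 0) ->
  - (Qb^T *m J *m A *m Qb) \in unitmx.
Proof.
move=> h Qi; rewrite -unitmx_tr -row_free_unit; apply: inj_row_free => v hv.
have {}hv : Qb^T *m J *m A *m Qb *m v^T = 0.
  apply/eqP; rewrite -oppr_eq0 -mulNmx; apply/eqP.
  by apply: trmx_inj; rewrite trmx_mul trmxK hv trmx0.
have : v^T = 0.
  apply: Qi; apply: h => d; apply: w_mx0v; by rewrite !mulmxA.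
by move/(congr1 trmx); rewrite trmxK trmx0.
Qed.

(** A vector r in the radical of w (A v) v' on K gives a kernel element wedge r r, which is nonzero
    in the symplectic case if r is; so the matrix X of [kernel_core] is invertible. The choice S = Y
    satisfies the commutation condition trivially and yields Y = 0. Then every antisymmetric S
    satisfies it, hence vanishes, and dim K <= 1. *)
Lemma K_symp : e = true -> K = 0%VS \/ exists r, [/\ K = <[r]>%VS, r != 0 & w (A *m r) r != 0].
Proof.
move=> e1.
have rad0 r : r \in K -> (forall v, v \in K -> w (A *m r) v = 0) -> r = 0.
  move=> rK h; have rW := subvP KW _ rK.
  have wr0 : wedge r r = 0.
    apply: wedge_ker => // y yk; have yr := Kst yk rK.
    rewrite (wC0 JT (h _ yr)) add0r.
    by have := h _ yr; rewrite cls_w // => /eqP; rewrite oppr_eq0 => /eqP.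
  apply: (w_nondeg Ju) => v; apply/eqP/negPn/negP => wv.
  have := wedgeE r r v; rewrite wr0 mul0mx e1 mulN1r scaleNr opprK -mulr2n => /esym/eqP.
  rewrite -scaler_nat scaler_eq0 pnatr_eq0 /= scaler_eq0 (negPf wv) /= => /eqP r0.
  by rewrite r0 w0l eqxx in wv.
have [Qb [L [LQ QE]]] := col_basis K.
move En : (\dim K) Qb L LQ QE => n Qb L LQ QE.
have Qi (c : 'cV_n) : Qb *m c = 0 -> c = 0 by apply: col_inj LQ.
have KE v : v \in K <-> exists c a, v = Qb *m c + a *: (0 : 'cV[F]_N).
  split=> [/QE [c ->]|[c [a ->]]]; first by exists c, 0; rewrite scaler0 addr0.
  by rewrite scaler0 addr0; apply/QE; exists c.
have Xu : - (Qb^T *m J *m A *m Qb) \in unitmx.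
  apply: K_core_unit => // c h; apply: rad0; first by apply/QE; exists c.
  by move=> v /QE [d ->]; rewrite (wC JT) h mulr0.
have core (S : 'M[F]_n) := @kernel_core n Qb 0 S KE Qi _ _ _ _ erefl erefl Xu.
have z1 : (0 : 'cV[F]_N)^T *m J *m A *m Qb = 0 by rewrite trmx0 !mul0mx.
have z2 : (0 : 'cV[F]_N)^T *m J *m A *m A *m Qb = 0 by rewrite trmx0 !mul0mx.
have Y0 : - (Qb^T *m J *m A *m A *m Qb) = 0.
  apply: core => //; have YE : Qb^T *m J *m A *m A *m Qb = - ((A *m Qb)^T *m J *m (A *m Qb)).
    by rewrite cls_TJ // mulNmx opprK mulmxA.
  by rewrite YE opprK trmx_J.
have S0 (S : 'M[F]_n) : S^T = eps *: S -> S = 0.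
  by move=> ST; apply: core => //; rewrite Y0 mulmx0 !mul0mx.
case: n En Qb L LQ QE Qi KE Xu {core} z1 z2 Y0 S0 => [|[|n]] En Qb L LQ QE Qi KE Xu z1 z2 Y0 S0.
- by left; apply/eqP; rewrite -dimv_eq0 En.
- right; exists (Qb *m (1%:M : 'cV_1)).
  have r0 : Qb *m (1%:M : 'cV_1) != 0.
    by apply/eqP => /Qi /eqP; rewrite oner_eq0.
  have KQ : K = <[Qb *m (1%:M : 'cV_1)]>%VS.
    apply/eqP; rewrite eq_sym eqEdim En dim_vline r0 andbT -memvE.
    by apply/QE; eexists.
  split=> //; apply/eqP => h; case/eqP: r0; apply: rad0; first by rewrite KQ memv_line.
  by move=> v; rewrite KQ => /vlineP [a ->]; rewrite wZr h mulr0.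
- exfalso; pose S : 'M[F]_n.+2 := delta_mx ord0 (lift ord0 ord0) - delta_mx (lift ord0 ord0) ord0.
  have ST : S^T = eps *: S by rewrite e1 scaleN1r linearB /= !trmx_delta opprB.
  have /matrixP/(_ ord0 (lift ord0 ord0)) := S0 S ST.
  rewrite !mxE !eqxx /= subr0 => /eqP; by rewrite oner_eq0.
Qed.


(** As in [K_symp], the choice S = Y gives Y = 0; then every symmetric S would vanish, which leaves
    only n = 0. *)
Lemma core_orth n (Qb : 'M[F]_(N, n)) (r : 'cV[F]_N) : e = false ->
  (forall v : 'cV_N, v \in K <-> exists c a, v = Qb *m c + a *: r) ->
  (forall c : 'cV_n, Qb *m c = 0 -> c = 0) ->
  r^T *m J *m A *m Qb = 0 -> r^T *m J *m A *m A *m Qb = 0 ->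
  - (Qb^T *m J *m A *m Qb) \in unitmx -> n = 0%N.
Proof.
move=> e0 KE Qi z1 z2 Xu.
have core (S : 'M[F]_n) := @kernel_core n Qb r S KE Qi z1 z2 _ _ erefl erefl Xu.
have Y0 : - (Qb^T *m J *m A *m A *m Qb) = 0.
  apply: core => //; have YE : Qb^T *m J *m A *m A *m Qb = - ((A *m Qb)^T *m J *m (A *m Qb)).
    by rewrite cls_TJ // mulNmx opprK mulmxA.
  by rewrite YE opprK trmx_J.
have S0 (S : 'M[F]_n) : S^T = eps *: S -> S = 0.
  by move=> ST; apply: core => //; rewrite Y0 mulmx0 !mul0mx.
case: n Qb KE Qi z1 z2 Xu {core} Y0 S0 => [//|n] Qb KE Qi z1 z2 Xu Y0 S0.
have ST : (delta_mx ord0 ord0 : 'M[F]_n.+1)^T = eps *: delta_mx ord0 ord0 by rewrite e0 scale1r trmx_delta.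
have /matrixP/(_ ord0 ord0) := S0 _ ST.
rewrite !mxE !eqxx /= => /eqP; by rewrite oner_eq0.
Qed.

(** Fredholm alternative for the form w (A v) s on K: a functional that vanishes on the radical is
    represented by an element of K. *)
Lemma rep_mod_rad r z : (forall v, v \in K -> (forall u, u \in K -> w (A *m v) u = 0) -> exists a, v = a *: r) ->
  w (A *m r) z = 0 -> exists2 s, s \in K & forall v, v \in K -> w (A *m v) s = w (A *m v) z.
Proof.
move=> rad rz; have [Kb [L [LK KE]]] := col_basis K.
have [M ME] : exists M : 'M[F]_(\dim K), M = (A *m Kb)^T *m J *m Kb by eexists.
have [f fE] : exists f : 'cV[F]_(\dim K), f = (A *m Kb)^T *m J *m z by eexists.
have /submxP [D fD] : (f^T <= M^T)%MS.
  rewrite submxE; apply/eqP/matrixP => i j; rewrite [RHS]mxE.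
  have [v vE] : exists v : 'cV[F]_(\dim K), v = col j (cokermx M^T) by eexists.
  have Mv : M^T *m v = 0 by rewrite vE colE mulmxA mulmx_coker mul0mx.
  have [a av] : exists a, Kb *m v = a *: r.
    apply: rad; first by apply/KE; eexists.
    move=> u /KE [c ->]; rewrite /w trmx_mul trmx_mul.
    have -> : v^T *m Kb^T *m A^T = v^T *m (A *m Kb)^T by rewrite trmx_mul mulmxA.
    have -> : v^T *m (A *m Kb)^T *m J *m (Kb *m c) = (M^T *m v)^T *m c.
      by rewrite (trmx_mul M^T) trmxK ME !mulmxA.
    by rewrite Mv trmx0 mul0mx mxE.
  have -> : (f^T *m cokermx M^T) i j = (f^T *m v) i 0.
    have <- : col j (f^T *m cokermx M^T) = f^T *m v by rewrite vE !colE; exact: (esym (mulmxA f^T _ _)).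
    by move: (f^T *m _) => M'; rewrite mxE.
  have -> : f^T *m v = ((A *m (Kb *m v))^T *m J *m z)^T.
    by rewrite fE !trmx_mul !trmxK !mulmxA.
  rewrite av -scalemxAr mxE !ord1.
  by have := wZl J a (A *m r) z; rewrite rz mulr0 /w.
exists (Kb *m D^T); first by apply/KE; eexists.
move=> v /KE [c ->].
have fM : f = M *m D^T by apply: trmx_inj; rewrite trmx_mul trmxK.
have e1 x : w (A *m (Kb *m c)) x = (c^T *m ((A *m Kb)^T *m J *m x)) 0 0.
  by rewrite /w !trmx_mul !mulmxA.
by rewrite !e1 -fE fM ME !mulmxA.
Qed.

(** Two radical vectors r, s of w (A v) v' on K give a kernel element wedge r s, so the radical is
    at most a line. If it is zero, [core_orth] gives K = 0; if it is <r>, a complement of r in K is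
    shown to vanish. *)
Lemma K_orth w0 : e = false -> w0 \in W -> (forall v, v \in K -> w v w0 = 0) -> w0 \notin K ->
  K = 0%VS \/ exists r, [/\ K = <[r]>%VS, r != 0 & w (A *m r) (A *m r) != 0].
Proof.
move=> e0 w0W w0K w0nK.
have AWm v : A *m v \in W by apply: clsW_im Wn AW.
have wC1 a b : w a b = w b a by rewrite (wC JT) e0 mul1r.
have rad2 r s : r \in K -> s \in K -> (forall v, v \in K -> w (A *m r) v = 0) ->
    (forall v, v \in K -> w (A *m s) v = 0) -> wedge r s = 0.
  move=> rK sK hr hs; apply: wedge_ker => //; first exact: (subvP KW).
  move=> y yk; rewrite (wC0 JT (hs _ (Kst yk rK))) add0r.
  by have := hr _ (Kst yk sK); rewrite cls_w // => /eqP; rewrite oppr_eq0 => /eqP.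
case: (classic (exists r, [/\ r \in K, r != 0 & forall v, v \in K -> w (A *m r) v = 0])); last first.
  move=> no; left.
  have rad0 r : r \in K -> (forall v, v \in K -> w (A *m r) v = 0) -> r = 0.
    by move=> rK h; apply/eqP/negPn/negP => r0; apply: no; exists r.
  have [Qb [L [LQ QE]]] := col_basis K.
  have Qi (c : 'cV_(\dim K)) : Qb *m c = 0 -> c = 0 by apply: col_inj LQ.
  have KE v : v \in K <-> exists c a, v = Qb *m c + a *: (0 : 'cV[F]_N).
    split=> [/QE [c ->]|[c [a ->]]]; first by exists c, 0; rewrite scaler0 addr0.
    by rewrite scaler0 addr0; apply/QE; exists c.
  apply/eqP; rewrite -dimv_eq0; apply/eqP; apply: (core_orth e0 KE Qi).
  - by rewrite trmx0 !mul0mx.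
  - by rewrite trmx0 !mul0mx.
  apply: K_core_unit => // c h; apply: rad0; first by apply/QE; exists c.
  by move=> v /QE [d ->]; rewrite (wC JT) h mulr0.
case=> r [rK r0 rr]; right; exists r.
have rad1 v : v \in K -> (forall u, u \in K -> w (A *m v) u = 0) -> exists a, v = a *: r.
  by move=> vK hv; apply: wedge_eq0 r0; apply: rad2.
(* If this were zero, there would be a z in K^perp outside K with w (A r) z = 0: A r itself, or w0
   when A r lies in K. Corrected by some s in K, it makes wedge r (z - s) a kernel element, which
   forces z into K. *)
have wr : w (A *m r) (A *m r) != 0.
  apply/eqP => wr.
  have [z [zW zK znK zz]] : exists z, [/\ z \in W, forall v, v \in K -> w v z = 0, z \notin K &
      z = A *m r \/ A *m r \in K].
    have [AK|AK] := boolP (A *m r \in K); first by exists w0; split=> //; right.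
    by exists (A *m r); split=> //; [move=> v vK; rewrite wC1 rr | left].
  have rz : w (A *m r) z = 0.
    by case: zz => [->//|AK]; exact: zK.
  have [s sK sE] := rep_mod_rad rad1 rz.
  have zsW : z - s \in W by rewrite memvB //; apply: (subvP KW).
  have [a az] : exists a, z - s = a *: r.
    apply: wedge_eq0 r0; apply: wedge_ker => // y yk; have [yc _] := kW yk.
    have -> : w (y *m r) (A *m (z - s)) = 0.
      have := cls_w (y *m r) (z - s) Ac; rewrite wBr sE ?subrr; last exact: Kst.
      by move/eqP; rewrite eq_sym oppr_eq0 => /eqP.
    have -> : w r (A *m (y *m (z - s))) = - w (A *m r) (y *m (z - s)) by rewrite cls_w // opprK.
    rewrite add0r; apply/eqP; rewrite oppr_eq0; apply/eqP.
    case: zz => [zz|AK].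
      rewrite mulmxBr wBr (rr _ (Kst yk sK)) subr0.
      have := cls_w z z yc; rewrite [w (y *m z) z]wC1 -zz => /eqP.
      by rewrite -addr_eq0 -mulr2n mulrn_eq0 /= => /eqP.
    have := cls_w (A *m r) (z - s) yc; have yA := Kst yk AK.
    rewrite wBr zK // Ki // subrr => /eqP.
    by rewrite eq_sym oppr_eq0 => /eqP.
  case/negP: znK; have -> : z = a *: r + s by rewrite -az subrK.
  by rewrite memvD // memvZ.
split=> //.
(* Q is a complement of <r> in K, chosen so that r is orthogonal to A A Q; orthogonality to A Q
   holds because r is in the radical. *)
have [Q QE] : exists Q : vs, forall v, v \in Q <-> v \in K /\ w (A *m r) (A *m v) = 0.
  apply: subspace_exists; first by rewrite mem0v mulmx0 w0r.
  move=> a u v [uK hu] [vK hv]; split; first by rewrite memvD // memvZ.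
  by rewrite mulmxDr -scalemxAr wDr wZr hu hv mulr0 addr0.
have [Qb [L [LQ QbE]]] := col_basis Q.
have Qi (c : 'cV_(\dim Q)) : Qb *m c = 0 -> c = 0 by apply: col_inj LQ.
have QK c : Qb *m c \in K /\ w (A *m r) (A *m (Qb *m c)) = 0 by apply/QE/QbE; exists c.
have KE v : v \in K <-> exists c a, v = Qb *m c + a *: r.
  split=> [vK|[c [a ->]]]; last by rewrite memvD ?memvZ //; case: (QK c).
  pose a := w (A *m r) (A *m v) / w (A *m r) (A *m r).
  have : v - a *: r \in Q.
    apply/QE; split; first by rewrite memvB // memvZ.
    by rewrite mulmxBr wBr -scalemxAr wZr divfK // subrr.
  by move=> /QbE [c cE]; exists c, a; rewrite -cE subrK.
have n0 : \dim Q = 0%N.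
  apply: (core_orth e0 KE Qi).
  - apply: mx_ext => c; rewrite mul0mx -!mulmxA; apply/matrixP => i j; rewrite !ord1 [RHS]mxE.
    have := rr _ (QK c).1; rewrite cls_w // /w -!mulmxA => /eqP; rewrite oppr_eq0 => /eqP //.
  - apply: mx_ext => c; rewrite mul0mx -!mulmxA; apply/matrixP => i j; rewrite !ord1 [RHS]mxE.
    have := (QK c).2; rewrite cls_w // /w -!mulmxA => /eqP; rewrite oppr_eq0 => /eqP //.
  apply: K_core_unit => // c h; have [cK cA] := QK c.
  have [a aE] : exists a, Qb *m c = a *: r.
    apply: rad1 => // v /KE [d [b ->]]; rewrite wDr wZr (wC1 _ r) (wC1 _ (Qb *m d)) h add0r.
    have := rr _ cK; rewrite cls_w // => /eqP; rewrite oppr_eq0 => /eqP ->.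
    by rewrite mulr0.
  move/eqP: cA; rewrite aE -scalemxAr wZr mulf_eq0 (negPf wr) orbF => /eqP ->.
  by rewrite scale0r.
apply/eqP; rewrite eq_sym eqEsubv -memvE rK; apply/subvP => v /KE [c [a ->]].
have -> : Qb *m c = 0.
  apply/eqP; rewrite -memv0; have /eqP : \dim Q = 0%N by [].
  by rewrite dimv_eq0 => /eqP <-; apply/QbE; exists c.
by rewrite add0r memvZ // memv_line.
Qed.

End Kernel.
End Wedge.

(** * One empty chain *)

Section Base.
Variables (F : numClosedFieldType) (e : bool) (N : nat) (J : 'M[F]_N).
Local Notation eps := (sg F e).
Hypothesis JT : J^T = eps *: J.
Hypothesis Ju : J \in unitmx.
Local Notation w := (w J).
Local Notation wedge := (wedge e J).
Local Notation vs := ({vspace 'cV[F]_N}).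

(** The set {-1, 0, 1} in the orthogonal case and {-1/2, 1/2} in the symplectic case. Differences of
    two such values lie in the range of [unbroken_small]. *)
Definition small (l : F) : Prop := exists i : int, -1 <= i <= bd e /\ l = off F e + i%:~R.

Lemma small_opp l : small l -> small (- l).
Proof.
case=> i [hi ->]; exists (- i - 1 + bd e); split.
  by case: e hi => /=; lia.
have := off2 F e; set o := off F e => o2.
have -> : (- i - 1 + bd e)%:~R = - i%:~R - (o + o) :> F.
  by rewrite o2 -intrN -intrB; congr (_%:~R); lia.
by ring.
Qed.

Lemma small_sub l l' : small l -> small l' -> exists i : int, -2 <= i <= 2 /\ l - l' = i%:~R.
Proof.
case=> i [hi ->] [j [hj ->]]; exists (i - j); split; first by case: e hi hj => /=; lia.
by rewrite intrB; ring.
Qed.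

Definition base_state (W : vs) (T : seq vs) : Prop :=
  forall (g : {vspace 'M[F]_N}) A h,
    (forall x, x \in g <-> Reg J W [::] T x) -> frob g A -> prin g A h ->
    allgood e h 0%VS T /\ forall l, ev h 0%VS W l -> small l.

Lemma Reg_lie_closed (g : {vspace 'M[F]_N}) W U T :
  (forall x, x \in g <-> Reg J W U T x) -> lie_closed g.
Proof. by move=> gE x y /gE xg /gE yg; apply/gE; exact: Reg_lie. Qed.

(** g embeds in End(W), so by [evm_tensor] every eigenvalue of ad h is a difference of two
    eigenvalues of h on W. *)
Lemma base_claim (W : vs) T : nondeg J W -> base_state W T -> claim_state e J W [::] T.
Proof.
move=> Wn B g A h gE fr hp; have [gT gW] := B g A h gE fr hp.
have gl := Reg_lie_closed gE.
split=> //.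
case: (classic (exists x, x \in g /\ x != 0)) => [[x [xg x0]]|no]; last first.
  exists 0%N => l; split; first by case=> x [xg x0 _]; case: no; exists x.
  by case=> i [hi _]; lia.
apply: unbroken_small.
- exact: frob_eig0 gl fr hp xg x0.
- by move=> l; apply: eig_sym fr hp.
move=> l [z [zg z0 zl]].
have [Wb [L [LW WE]]] := col_basis W.
have st y : y \in g -> y *m Wb = Wb *m (L *m y *m Wb).
  move=> /gE yR; apply: mx_ext => c; rewrite -!mulmxA.
  have /WE [d dE] : y *m (Wb *m c) \in W by apply: (Reg_im JT Ju Wn yR).
  by rewrite dE (mulmxA L) LW mul1mx.
have hs := st _ hp.1; have zs := st _ zg.
have [al [be [ha hb ->]]] : exists al be, [/\ evm (L *m h *m Wb) al, evm (L *m h *m Wb) be & l = al - be].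
  apply/evm_tensor; exists (L *m z *m Wb).
    apply: contra z0 => /eqP h0; rewrite h0 mulmx0 in zs.
    have /gE [zc zk _ _] := zg.
    have [q [q1 q2 q3]] := nondeg_proj JT Wn.
    apply/eqP/mx_ext => v; rewrite mul0mx -(subrK (q *m v) v) mulmxDr.
    have /WE [c cE] := q1 v.
    have -> : z *m (q *m v) = 0 by rewrite cE mulmxA zs mul0mx.
    rewrite addr0; apply: zk => w0 w0W.
    have -> : w (v - q *m v) w0 = w v w0 - w (q *m v) w0 by exact: wBl.
    have -> : w (q *m v) w0 = w v (q *m w0) by rewrite /w trmx_mul -(mulmxA v^T) q3 !mulmxA.
    by rewrite q2 // subrr.
  have e1 a b : b \in g -> L *m (a *m b) *m Wb = L *m a *m Wb *m (L *m b *m Wb).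
    by move=> bg; rewrite -!mulmxA [in LHS](st _ bg) !mulmxA.
  by rewrite -!e1 ?hp.1 // -mulmxBl -mulmxBr -/(lie h z) zl -scalemxAr -scalemxAl.
have sm a : evm (L *m h *m Wb) a -> small a.
  have Wi (c : 'cV_(\dim W)) : Wb *m c = 0 -> c = 0 by exact: col_inj LW.
  by move=> ha'; apply/gW/(ev0_evm a WE Wi hs).
exact: small_sub (sm _ ha) (sm _ hb).
Qed.

Lemma perp_ex (W Y : vs) : nondeg J W -> (Y <= W)%VS -> exists P : vs,
  (forall v, v \in P <-> v \in W /\ forall y, y \in Y -> w y v = 0) /\ (\dim P + \dim Y)%N = \dim W.
Proof.
move=> Wn YW; have [B [L [LB BE]]] := col_basis Y.
have [f fE] : exists f : 'Hom('cV[F]_N, 'cV[F]_(\dim Y)), forall v, f v = B^T *m J *m v.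
  by apply: linear_fun_exists => a x y; rewrite mulmxDr -scalemxAr.
exists (W :&: lker f)%VS; split.
  move=> v; rewrite memv_cap memv_ker fE; split=> [/andP [vW /eqP h]|[vW h]].
    by split=> // y /BE [c ->]; exact: w_mx0v.
  by rewrite vW; apply/eqP/mx_w0v => c; apply: h; apply/BE; exists c.
have dY : \dim (f @: W)%VS = \dim Y.
  suff -> : (f @: W)%VS = fullv by rewrite dimvf /dim /= muln1.
  apply/eqP; rewrite eqEsubv subvf; apply/subvP => c _; apply: full_of_annihilator => l hl.
  have BY : B *m l^T \in Y by apply/BE; exists l^T.
  have : B *m l^T = 0.
    apply: Wn; first exact: (subvP YW).
    move=> w0 w0W; have := hl _ (memv_img f w0W); rewrite fE => h.
    have -> : w (B *m l^T) w0 = (l *m (B^T *m J *m w0)) 0 0 by rewrite /w trmx_mul trmxK !mulmxA.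
    by rewrite h mxE.
  move/(col_inj LB) => /(congr1 trmx); by rewrite trmxK trmx0.
by have := limg_ker_dim f W; rewrite dY.
Qed.

Lemma small0 : e = false -> small 0.
Proof. by move=> e0; exists 0; rewrite /off /bd e0 /= addr0. Qed.

Lemma wedge_diag u : e = true -> wedge u u = 0 -> u = 0.
Proof.
move=> e1 h; apply: (w_nondeg Ju) => v; apply/eqP/negPn/negP => wv.
have := wedgeE e J u u v; rewrite h mul0mx e1 mulN1r scaleNr opprK -mulr2n => /esym/eqP.
rewrite -scaler_nat scaler_eq0 pnatr_eq0 /= scaler_eq0 (negPf wv) /= => /eqP r0.
by rewrite r0 w0l eqxx in wv.
Qed.

Lemma stable0 (h : 'M[F]_N) : stable h 0%VS.
Proof. by move=> v; rewrite !memv0 => /eqP ->; rewrite mulmx0. Qed.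

(** W / K^perp is dual to K, and h acts on it by minus the transpose. *)
Lemma ev_three (W K P : vs) h l : clsW J W h -> nondeg J W -> (K <= W)%VS -> isotropic J K -> stable h K ->
  (forall v, v \in P <-> v \in W /\ forall y, y \in K -> w y v = 0) ->
  ev h 0%VS W l -> [\/ ev h 0%VS K l, ev h K P l | ev h 0%VS K (- l)].
Proof.
move=> hW Wn KW Ki hK PE evl; have [hc _] := hW.
have KP : (K <= P)%VS by apply/subvP => v vK; apply/PE; split; [exact: (subvP KW) | move=> y yK; exact: Ki].
have PW : (P <= W)%VS by apply/subvP => v /PE [].
have hP : stable h P.
  move=> v /PE [vW vK]; apply/PE; split; first exact: (clsW_im JT Ju _ Wn hW).
  by move=> y yK; rewrite -[w _ _]opprK -cls_w // vK ?oppr0 // hK.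
have /(ev_split _ (sub0v P) PW (@stable0 h) hP) [evl'|evl'] := evl.
  have /(ev_split _ (sub0v K) KP (@stable0 h) hK) [evl''|evl''] := evl'; first exact: Or31.
  exact: Or32.
apply: Or33; have [Kb [L [LK KE]]] := col_basis K.
have hKb : h *m Kb = Kb *m (L *m h *m Kb).
  apply: mx_ext => c; rewrite -!mulmxA.
  have /KE [d dE] : h *m (Kb *m c) \in K by apply: hK; apply/KE; exists c.
  by rewrite dE (mulmxA L) LK mul1mx.
have Ki' (c : 'cV_(\dim K)) : Kb *m c = 0 -> c = 0 by exact: col_inj LK.
apply/(ev0_evm (- l) KE Ki' hKb).
apply/evm_opp_tr; apply/evm_col.
case: evl' => y [yW yP hy]; exists (Kb^T *m J *m y).
  apply: contra yP => /eqP h0; apply/PE; split=> // v /KE [c ->]; exact: w_mx0v.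
have /PE [_ yK] := hy.
have : Kb^T *m J *m (h *m y - l *: y) = 0 by apply: mx_w0v => c; apply: yK; apply/KE; exists c.
rewrite mulmxBr -scalemxAr => /eqP; rewrite subr_eq0 => /eqP <-.
have := cls_TJ Kb hc; rewrite {1}hKb => h1.
have h2 : Kb^T *m J *m h = - ((Kb *m (L *m h *m Kb))^T *m J) by rewrite h1 opprK.
by rewrite (mulmxA _ h y) h2 (trmx_mul Kb) !mulNmx !mulmxA.
Qed.

(** The functional is represented by an element A' of the algebra itself, and A' is in the kernel
    because the trace of A' [A', y] is zero. *)
Lemma frob_full W (g : {vspace 'M[F]_N}) A : nondeg J W ->
  (forall x, x \in g <-> clsW J W x) -> frob g A -> forall x, x \in g -> x = 0.
Proof.
move=> Wn gE fr.
have gl : lie_closed g.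
  apply: (@Reg_lie_closed g W [::] [::]) => x; rewrite gE.
  by split=> [[h1 h2]|[h1 h2 _ _]]; split.
have [A' [AW AE]] := cls_rep JT Ju A Wn.
have AE' x : x \in g -> \tr (A' *m x) = \tr (A *m x) by move=> /gE; exact: AE.
have {fr}fr := frob_ext gl AE' fr.
have Ag : A' \in g by apply/gE.
have A0 : A' = 0.
  apply: fr => // y yg; rewrite /lie mulmxBr raddfB /=.
  have -> : \tr (A' *m (y *m A')) = \tr (A' *m (A' *m y)) by rewrite mxtrace_mulC -mulmxA mxtrace_mulC -mulmxA.
  by rewrite subrr.
by move=> x xg; apply: fr => // y _; rewrite A0 mul0mx raddf0.
Qed.

(** Without chains g is zero by [frob_full], so h = 0 and the only possible eigenvalue is 0; in the
    symplectic case wedge y y shows that W has no nonzero vector y. *)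
Lemma base_nil (W : vs) : wf e J W [::] [::] -> base_state W [::].
Proof.
case=> Wn _ _ _ _ g A h gE fr hp; split=> // l evl.
have gE' x : x \in g <-> clsW J W x by rewrite gE; split=> [[]|[]].
have g0 := frob_full Wn gE' fr.
have h0 := g0 _ hp.1; case: evl => y [yW]; rewrite memv0 => y0.
rewrite h0 mul0mx sub0r memv0 oppr_eq0 scaler_eq0 (negPf y0) orbF => /eqP ->.
case: (boolP e) => [e1|/negPf]; last exact: small0.
have : wedge y y = 0 by apply: g0; apply/gE; case: (wedge_clsW JT yW yW).
by move/(wedge_diag e1) => y00; rewrite y00 eqxx in y0.
Qed.

(* The algebra of the smaller space W2 = (K + A K)^perp is Frobenius for the same A
   because [A, z] kills K when z vanishes on K and A K. *)
Lemma step_O W (T0 : seq vs) K (T : seq vs) (g : {vspace 'M[F]_N}) A h :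
  wf e J W [::] (T0 ++ K :: T) -> (forall Y, Y \in T0 -> (Y <= K)%VS) -> chain K T -> K != 0%VS ->
  clsW J W A ->
  (forall x, x \in g <-> Reg J W [::] (T0 ++ K :: T) x) -> frob g A -> prin g A h ->
  (forall v, v \in K -> (forall u, u \in K -> w (A *m v) u = 0) -> v = 0) ->
  (forall W' T', (\dim W' < \dim W)%N -> wf e J W' [::] T' -> base_state W' T') ->
  (forall l, ev h 0%VS K l -> small l) ->
  allgood e h K T /\ forall l, ev h 0%VS W l -> small l.
Proof.
move=> [Wn iso _ _ par] T0K cT Kn0 AW gE fr hp nd IH smK.
have [Ac _] := AW; have gl := Reg_lie_closed gE.
have KT : K \in T0 ++ K :: T by rewrite mem_cat mem_head orbT.
have [KW Ki] := iso _ KT.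
have TT Y : Y \in T -> Y \in T0 ++ K :: T by move=> h0; rewrite mem_cat inE h0 !orbT.
have TW Y : Y \in T -> (Y <= W)%VS by move/TT/iso => [].
have Ti Y : Y \in T -> isotropic J Y by move/TT/iso => [].
have KsT Y : Y \in T -> (K <= Y)%VS by move=> YT; apply: chain_mem cT YT.
have [Kb [L [LK KE]]] := col_basis K.
have Kbi (c : 'cV_(\dim K)) : Kb *m c = 0 -> c = 0 by exact: col_inj LK.
have KbK c : Kb *m c \in K by apply/KE; exists c.
have [E EE] : exists E : 'M[F]_(N, \dim K + \dim K), E = row_mx Kb (A *m Kb) by eexists.
have Ec (c1 c2 : 'cV_(\dim K)) : E *m col_mx c1 c2 = Kb *m c1 + A *m (Kb *m c2).
  by rewrite EE mul_row_col -mulmxA.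
have EW c : E *m c \in W.
  rewrite -(vsubmxK c) Ec memvD //; first exact: (subvP KW).
  exact: (clsW_im JT Ju).
(* K is isotropic and, by [nd], in perfect duality with A K, so the Gram matrix is block
   antitriangular with invertible corners. *)
have Eu : E^T *m J *m E \in unitmx.
  apply: gram_unit => c; rewrite -(vsubmxK c); set c1 := usubmx c; set c2 := dsubmx c => h0.
  have c2z : Kb *m c2 = 0.
    apply: nd => // u /KE [d ->]; have := h0 (col_mx d 0).
    by rewrite !Ec !mulmx0 addr0 wDl (Ki (Kb *m c1)) // add0r.
  have c1z : Kb *m c1 = 0.
    apply: nd => // u /KE [d ->]; have := h0 (col_mx 0 d).
    by rewrite !Ec c2z !mulmx0 add0r addr0 => h1; rewrite cls_w // h1 oppr0.
  by rewrite (Kbi _ c1z) (Kbi _ c2z) col_mx0.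
have [p pE] : exists p, p = gproj J E by eexists.
have [pE1 _ pJ] : [/\ p *m E = E, (E^T *m J) *m p = E^T *m J & p^T *m J = J *m p].
  by rewrite pE; exact: (nondeg_gram JT Eu).
have wp a b : w (p *m a) b = w a (p *m b) by rewrite pE (w_gproj JT).
have pid v : v \in K -> p *m v = v.
  move=> /KE [c ->]; have -> : Kb *m c = E *m col_mx c 0 by rewrite Ec !mulmx0 addr0.
  by rewrite mulmxA pE1.
have pK v : (forall u, u \in K -> w u v = 0) -> p *m v \in K.
  move=> vK; have [d dE] : exists d, p *m v = E *m d by rewrite pE gprojE; eexists.
  rewrite dE -(vsubmxK d) Ec; set d1 := usubmx d; set d2 := dsubmx d.
  suff -> : Kb *m d2 = 0 by rewrite mulmx0 addr0.
  apply: nd => // u uK; have := wp v u; rewrite (pid u uK) (wC0 JT (vK _ uK)) dE -(vsubmxK d) Ec.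
  by rewrite wDl (Ki (Kb *m _)) // add0r.
have pTK Y v : Y \in T -> v \in Y -> p *m v \in K.
  by move=> YT vY; apply: pK => u uK; apply: (Ti _ YT) => //; apply: (subvP (KsT _ YT)).
have [W2 W2E] : exists W2 : vs, W2 = cperp J W E by eexists.
have W2s : (W2 <= W)%VS by rewrite W2E cperp_sub.
have W2K u v : v \in W2 -> u \in K -> w u v = 0.
  rewrite W2E => vW2 /KE [c ->]; have -> : Kb *m c = E *m col_mx c 0 by rewrite Ec !mulmx0 addr0.
  exact: w_cperpB vW2.
have W2AK u v : v \in W2 -> u \in K -> w (A *m u) v = 0.
  rewrite W2E => vW2 /KE [c ->]; have -> : A *m (Kb *m c) = E *m col_mx 0 c by rewrite Ec !mulmx0 add0r.
  exact: w_cperpB vW2.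
have KW2 : (K :&: W2)%VS = 0%VS.
  apply/eqP; rewrite -subv0; apply/subvP => v; rewrite memv_cap memv0 => /andP [vK vW2].
  by rewrite -(pid _ vK) pE (gproj_cperp (W := W)) // -W2E.
have comp v : v \in W -> v - p *m v \in W2 by rewrite pE W2E; exact: (compl_cperp JT EW Eu).
have killW2 x v : clsW J W2 x -> (v \in K \/ exists2 u, u \in K & v = A *m u) -> x *m v = 0.
  move=> [_ xk] hv; apply: xk => w0 w0W; case: hv => [vK|[u uK ->]]; first exact: W2K.
  exact: W2AK.
have subReg z : Reg J W2 [::] (capW J W E T) z -> Reg J W [::] (T0 ++ K :: T) z.
  move=> [zc zk _ zT].
  have zK v : v \in K -> z *m v = 0 by move=> vK; apply: (@killW2 z); [split | left].
  split=> //.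
    by move=> v vW; apply: zk => w0 w0W; apply: vW; apply: (subvP W2s).
  move=> Y; rewrite mem_cat inE => /or3P [YT0|/eqP ->|YT] v vY.
  - by rewrite zK ?mem0v //; apply: (subvP (T0K _ YT0)).
  - by rewrite zK ?mem0v.
  have pv := pTK _ _ YT vY; have pvY := subvP (KsT _ YT) _ pv.
  rewrite -(subrK (p *m v) v) mulmxDr (zK _ pv) addr0.
  have : z *m (v - p *m v) \in (Y :&: cperp J W E)%VS.
    apply: zT; first exact: map_f.
    by rewrite capWE -W2E memvB //= comp //; apply: (subvP (TW _ YT)).
  by rewrite capWE => /andP [].
have st x : stable x K -> exists xi, x *m Kb = Kb *m xi.
  move=> xK; exists (L *m x *m Kb); apply: mx_ext => c; rewrite -!mulmxA.
  by have /KE [d ->] := xK _ (KbK c); rewrite (mulmxA L) LK mul1mx.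
(* The image of p c lies in K, which y preserves and c kills, so p c y has square zero. *)
have trpc c y : c \in cls J -> (forall v, v \in K -> c *m v = 0) -> stable y K -> \tr (p *m c *m y) = 0.
  move=> cc cK /st [xi xiE].
  have pc : p *m c = Kb *m (L *m (p *m c)).
    apply: mx_ext => v; rewrite -!mulmxA.
    have /KE [d ->] : p *m (c *m v) \in K.
      by apply: pK => u uK; rewrite -[w _ _]opprK -cls_w // cK // w0l oppr0.
    by rewrite (mulmxA L) LK mul1mx.
  have cKb : c *m Kb = 0 by apply: mx_ext => v; rewrite -mulmxA mul0mx cK.
  have h1 : L *m (p *m c) *m y *m Kb = L *m (p *m (c *m Kb)) *m xi by rewrite -!mulmxA xiE !mulmxA.
  by rewrite pc -(mulmxA Kb) mxtrace_mulC h1 cKb !mulmx0 mul0mx raddf0.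
have trcpr c x : c \in cls J -> (forall v, v \in K -> c *m v = 0) -> x \in cls J -> stable x K ->
    \tr (c *m cpr J E x) = \tr (c *m x).
  move=> cc cK xc xK.
  have t1 : \tr (c *m x *m p) = 0 by rewrite mxtrace_mulC mulmxA trpc.
  have t2 : \tr (c *m p *m x *m p) = 0.
    have -> : c *m p *m x *m p = (c *m (p *m x)) *m p by rewrite !mulmxA.
    rewrite mxtrace_mulC (mulmxA p c) trpc // => v vK.
    by rewrite -mulmxA pid // xK.
  have t3 : \tr (c *m p *m x) = 0.
    rewrite -mxtrace_tr !trmx_mul; have /clsP cJ := cc; have /clsP xJ := xc.
    have -> : x^T *m (p^T *m c^T) = J *m (x *m (p *m c)) *m invmx J.
      apply: (can_inj (mulmxK Ju)); rewrite mulmxKV //.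
      by rewrite -!mulmxA cJ !mulmxN (mulmxA p^T) pJ !mulmxA xJ !mulNmx opprK.
    by rewrite mxtrace_mulC mulKmx // mxtrace_mulC trpc.
  rewrite /cpr -pE; have -> : (1%:M - p) *m x *m (1%:M - p) = x - x *m p - p *m x + p *m x *m p.
    rewrite mulmxBl mul1mx mulmxBr mulmx1 mulmxBl.
    set b1 := p *m x; set b2 := x *m p; set b3 := b1 *m p.
    by apply/matrixP => i j; rewrite !mxE; ring.
  by rewrite mulmxDr !mulmxBr raddfD !raddfB /= !mulmxA t1 t2 t3 !subr0 addr0.
have c0cls z : z \in cls J -> lie A z \in cls J by move=> zc; exact: lie_cls.
have c0K z : clsW J W2 z -> forall v, v \in K -> lie A z *m v = 0.
  move=> zW v vK; rewrite /lie mulmxBl -!mulmxA (killW2 z v zW) ?(killW2 z (A *m v) zW) ?mulmx0 ?subrr //.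
  - by right; exists v.
  - by left.
have trc0 z x : \tr (A *m lie z x) = \tr (lie A z *m x).
  rewrite /lie mulmxBr mulmxBl !raddfB /= !mulmxA; congr (_ - _).
  by rewrite mxtrace_mulC mulmxA.
have cprReg x : Reg J W [::] (T0 ++ K :: T) x -> Reg J W2 [::] (capW J W E T) (cpr J E x).
  move=> [xc xk _ xT]; split=> //; first exact: (cpr_cls JT Eu xc).
    by move=> v vW2; apply: (cpr_kill JT EW Eu xk) => w0; rewrite -W2E; exact: vW2.
  move=> _ /mapP [Y YT ->]; apply: (cpr_stable JT EW Eu) => //; first exact: TW.
    by apply: xT; exact: TT.
  by move=> y yY; rewrite -pE; apply: (subvP (KsT _ YT)); exact: pTK yY.
have [g2 g2E] := Reg_exists J W2 [::] (capW J W E T).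
(* z pairs with x through [A, z], which kills K, so only the compression of x to W2 is seen. Hence A
   is again a Frobenius functional for W2, with the compression of h as principal element. *)
have transfer z x : z \in g2 -> x \in g -> \tr (A *m lie z x) = \tr (A *m lie z (cpr J E x)).
  move=> /g2E [zc zk _ _] /gE [xc xk _ xT]; rewrite !trc0 trcpr //.
  - exact: c0cls.
  - by apply: c0K; split.
  - exact: xT.
have g2g z : z \in g2 -> z \in g by move=> /g2E /subReg /gE.
have hR := (gE _).1 hp.1.
have fr2 : frob g2 A.
  move=> z zg2 hz; apply: fr; first exact: g2g.
  by move=> x xg; rewrite transfer // hz //; apply/g2E/cprReg/gE.
have hp2 : prin g2 A (cpr J E h).
  split; first by apply/g2E/cprReg.
  move=> x xg2; rewrite -(hp.2 _ (g2g _ xg2)) trlieC [RHS]trlieC; congr (- _).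
  by rewrite (transfer x h) // hp.1.
have wf2 : wf e J W2 [::] (capW J W E T).
  split=> //.
  - by rewrite W2E; exact: (cperp_nondeg JT Wn EW Eu).
  - move=> _ /mapP [Y YT ->]; split; first by rewrite -W2E capvSr.
    move=> a b; rewrite !capWE => /andP [aY _] /andP [bY _]; exact: (Ti _ YT).
  - split=> //; rewrite -KW2 W2E; apply: (chain_cap JT EW Eu) => // Y y YT yY.
    by rewrite -pE; exact: pTK yY.
  - move/par; rewrite -(cperp_dim EW Eu) -W2E addnn oddD odd_double addbF //.
have lt : (\dim W2 < \dim W)%N.
  have k0 : (0 < \dim K)%N by rewrite lt0n dimv_eq0.
  by rewrite -(cperp_dim EW Eu) -W2E; lia.
have [ag2 sm2] := IH _ _ lt wf2 g2 A _ g2E fr2 hp2.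
have [hc hk _ hT] := hR.
have hK : stable h K by exact: hT.
have [_ xkW] : clsW J W2 (cpr J E h) by apply: Reg_clsW (cprReg _ hR).
have xW2 v : v \in W2 -> cpr J E h *m v \in W2.
  move=> _; apply: (clsW_im JT Ju); last exact: Reg_clsW (cprReg _ hR).
  by case: wf2.
have hx v : (forall u, u \in K -> w u v = 0) -> v \in W2 -> h *m v - cpr J E h *m v \in K.
  move=> vK vW2; have h0 : cpr J E h *m v = h *m v - gproj J E *m (h *m v).
    by apply: (cpr_cperp (W := W)); rewrite -W2E.
  rewrite h0 opprB addrC subrK -pE; apply: pK => u uK.
  by rewrite -[w _ _]opprK -cls_w // vK ?oppr0 // hK.
split.
  apply: (allgood_cap JT EW Eu (x := cpr J E h) cT hK) => //.
  - by move=> Y YT; apply: hT; exact: TT.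
  - by move=> Y y YT yY; rewrite -pE; exact: pTK yY.
  - move=> Y v YT vY; rewrite -W2E; apply: hx => u uK; apply: (Ti _ YT) => //.
    exact: (subvP (KsT _ YT)).
  - by move=> v; rewrite -W2E; exact: xW2.
  - by rewrite -W2E KW2.
have [P [PE _]] := perp_ex Wn KW.
have hW : clsW J W h by split.
move=> l /(ev_three hW Wn KW Ki hK PE) [evK|evP|evK]; first exact: smK.
  apply: sm2.
  have KP : (K <= P)%VS by apply/subvP => v vK; apply/PE; split; [exact: (subvP KW) | move=> y yK; exact: Ki].
  have PW : (P <= W)%VS by apply/subvP => v /PE [].
  have [] : ev (cpr J E h) (K :&: cperp J W E)%VS (P :&: cperp J W E)%VS l.
    apply/(ev_cap JT EW Eu (h := h) (x := cpr J E h) l KP PW hK) => //.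
    - by move=> y /PE [_ yK]; rewrite -pE; apply: pK.
    - by move=> v /PE [_ vK]; rewrite -W2E; exact: hx.
    - by move=> v; rewrite -W2E; exact: xW2.
  rewrite -W2E KW2 => y [yP y0 yl].
  exists y; split=> //; by move: yP; rewrite memv_cap => /andP [].
by rewrite -[l]opprK; apply: small_opp; exact: smK.
Qed.

Lemma base_wlog W T :
  nondeg J W ->
  (forall (g : {vspace 'M[F]_N}) A h, clsW J W A -> (forall x, x \in g <-> Reg J W [::] T x) ->
    frob g A -> prin g A h -> allgood e h 0%VS T /\ forall l, ev h 0%VS W l -> small l) ->
  base_state W T.
Proof.
move=> Wn H g A h gE fr hp; have gl := Reg_lie_closed gE.
have [A' [AW AE]] := cls_rep JT Ju A Wn.
have AE' x : x \in g -> \tr (A' *m x) = \tr (A *m x).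
  by move=> /gE [h1 h2 _ _]; apply: AE.
exact: (H g A') (frob_ext gl AE' fr) (prin_ext gl AE' hp).
Qed.

(** Every member Y satisfies T1 <= Y <= T1^perp. This provides the hypothesis [kH] of the kernel
    lemmas for K = T1. *)
Lemma Reg_first W T1 T x :
  wf e J W [::] (T1 :: T) -> clsW J W x ->
  (forall v, v \in W -> (forall a, a \in T1 -> w a v = 0) -> x *m v \in T1) -> Reg J W [::] (T1 :: T) x.
Proof.
move=> [Wn iso [_ /= [_ _ cT]] _ _] [xc xk] h; split=> // Y YT v vY.
have T1Y : (T1 <= Y)%VS.
  by move: YT; rewrite inE => /predU1P [->|YT]; [exact: subvv | exact: chain_mem cT YT].
have [YW Yi] := iso _ YT.
apply: (subvP T1Y); apply: h; first exact: (subvP YW).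
by move=> a aT; apply: Yi => //; apply: (subvP T1Y).
Qed.

Lemma ev_line (h : 'M[F]_N) (t : 'cV[F]_N) a l : h *m t = a *: t -> ev h 0%VS <[t]>%VS l -> l = a.
Proof.
move=> ht [y [/vlineP [b ->]]]; rewrite !memv0 -scalemxAr ht scalerA mulrC -scalerA -scalerBl => bt.
by rewrite scaler_eq0 (negPf bt) orbF subr_eq0 => /eqP ->.
Qed.

(** By [K_symp], T1 is a line <t>. Testing h on wedge t t, where the functional does not vanish,
    gives h t = t / 2; then [step_O] is applied with K = T1. *)
Lemma base_symp W T1 T : e = true -> wf e J W [::] (T1 :: T) ->
  (forall W' T', (\dim W' < \dim W)%N -> wf e J W' [::] T' -> base_state W' T') ->
  base_state W (T1 :: T).
Proof.
move=> e1 Wf IH; have [Wn iso [_ /= [_ T1n cT]] _ _] := Wf.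
apply: base_wlog => // g A h AW gE fr hp; have gl := Reg_lie_closed gE; have [Ac _] := AW.
have [T1W T1i] := iso _ (mem_head _ _).
have kW x : x \in g -> clsW J W x by move=> /gE [].
have Kst x : x \in g -> stable x T1 by move=> /gE [_ _ _]; apply; exact: mem_head.
have kH x : clsW J W x -> (forall v, v \in W -> (forall a, a \in T1 -> w a v = 0) -> x *m v \in T1) -> x \in g.
  by move=> xW hx; apply/gE; exact: Reg_first.
have [T10|[t [T1t t0 wt]]] := K_symp JT Ju AW kW T1W T1i Kst kH fr e1.
  by rewrite T10 subvv in T1n.
have tT : t \in T1 by rewrite T1t memv_line.
have /vlineP [a ha] : h *m t \in <[t]>%VS by rewrite -T1t; apply: Kst => //; exact: hp.1.
have [hc _] := kW _ hp.1.
have tAt : w t (A *m t) != 0.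
  by rewrite -[w _ _]opprK oppr_eq0 -cls_w.
have a2 : a = 2^-1.
  have := hp.2 _ (wedge_k JT T1W kH tT (subvP T1W _ tT)).
  rewrite trlie_wedge // tr_wedge // ha -!scalemxAr wZl wZr -mulrDl => /(mulfI _); rewrite pnatr_eq0 => /(_ isT).
  rewrite -{2}[w t (A *m t)]mul1r => /(mulIf tAt) h2.
  by apply: (@mulfI _ 2); rewrite ?pnatr_eq0 // mulfV ?pnatr_eq0 // mulr_natl mulr2n h2.
have smT1 l : ev h 0%VS T1 l -> l = off F e + (0 : int)%:~R.
  by rewrite T1t => /(ev_line ha) ->; rewrite a2 e1 /off addr0.
have [||||agT smW] := @step_O W [::] T1 T g A h Wf _ cT _ AW gE fr hp _ IH.
- by [].
- by apply: contra T1n => /eqP ->; rewrite subvv.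
- move=> v; rewrite T1t => /vlineP [b ->] /(_ _ (memv_line t)).
  by rewrite -scalemxAr wZl => /eqP; rewrite mulf_eq0 (negPf wt) orbF => /eqP ->; rewrite scale0r.
- by move=> l /smT1 ->; exists 0; split=> //; case: e.
split=> //; split=> //; apply: (good_single (i := 0)) => //; last by case: e.
apply: ev_exists => //; first exact: stable0.
by apply: Kst; exact: hp.1.
Qed.

(** * One empty chain in the orthogonal case *)

Section Orth.
Hypothesis e0 : e = false.

Lemma wS a b : w a b = w b a.
Proof. by rewrite (wC JT) e0 mul1r. Qed.

Lemma w_cls y a b : y \in cls J -> w a (y *m b) = - w (y *m a) b.
Proof. by move=> yc; rewrite cls_w // opprK. Qed.

Lemma w_self y a : y \in cls J -> w a (y *m a) = 0.
Proof.
move=> yc; have := w_cls a a yc; rewrite [w (y *m a) a]wS => /eqP.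
by rewrite -addr_eq0 -mulr2n mulrn_eq0 /= => /eqP.
Qed.

Lemma wedgeE0 u t v : wedge u t *m v = w u v *: t - w t v *: u.
Proof. by rewrite wedgeE e0 mul1r. Qed.

Section OrthStep.
Variables (W : vs) (T1 : vs) (T : seq vs) (g : {vspace 'M[F]_N}) (A h : 'M[F]_N).
Hypothesis Wf : wf e J W [::] (T1 :: T).
Hypothesis AW : clsW J W A.
Hypothesis gE : forall x, x \in g <-> Reg J W [::] (T1 :: T) x.
Hypothesis fr : frob g A.
Hypothesis hp : prin g A h.

Let Wn : nondeg J W. Proof. by case: Wf. Qed.
Let Ac : A \in cls J. Proof. by case: AW. Qed.
Let gl : lie_closed g. Proof. exact: Reg_lie_closed gE. Qed.

Lemma orth_iso Y : Y \in T1 :: T -> (Y <= W)%VS /\ isotropic J Y.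
Proof. by case: Wf => _ iso _ _ _ YT; exact: iso. Qed.

Let T1W : (T1 <= W)%VS. Proof. by case: (orth_iso (mem_head _ _)). Qed.
Let T1i : isotropic J T1. Proof. by case: (orth_iso (mem_head _ _)). Qed.

Lemma T1_sub Y : Y \in T1 :: T -> (T1 <= Y)%VS.
Proof.
case: Wf => _ _ [_ /= [_ _ cT]] _ _.
by rewrite inE => /predU1P [->|YT]; [exact: subvv | exact: chain_mem cT YT].
Qed.

Lemma g_clsW x : x \in g -> clsW J W x.
Proof. by move=> /gE []. Qed.

Lemma g_st x Y : x \in g -> Y \in T1 :: T -> stable x Y.
Proof. by move=> /gE [_ _ _ h0] YT; exact: h0. Qed.

Lemma g_kH x : clsW J W x -> (forall v, v \in W -> (forall a, a \in T1 -> w a v = 0) -> x *m v \in T1) -> x \in g.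
Proof. by move=> xW hx; apply/gE; exact: Reg_first. Qed.

Lemma AWm v : A *m v \in W.
Proof. exact: (clsW_im JT Ju _ Wn AW). Qed.

(** As dim W is odd, T1^perp is larger than T1, which supplies the vector required by [K_orth].
    Testing h on wedge t (A t) gives the eigenvalue 1. *)
Lemma orth_line : exists t, [/\ T1 = <[t]>%VS, t != 0, w (A *m t) (A *m t) != 0 & h *m t = t].
Proof.
have [P [PE dP]] := perp_ex Wn T1W.
have T1P : (T1 <= P)%VS.
  by apply/subvP => v vT; apply/PE; split; [exact: (subvP T1W) | move=> y yT; exact: T1i].
have [w0 w0P w0T] : exists2 w0, w0 \in P & w0 \notin T1.
  apply/subvPn/negP => PT; have par : odd (\dim W) by case: Wf => _ _ _ _; apply.
  by move: par; rewrite -dP; have -> : P = T1 by [apply/eqP; rewrite eqEsubv PT]; rewrite addnn odd_double.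
have /PE [w0W w0K] := w0P.
have Kst x : x \in g -> stable x T1 by move=> xg; apply: (g_st xg); exact: mem_head.
have [T10|[t [T1t t0 wt]]] := K_orth JT Ju Wn AW g_clsW T1W T1i Kst g_kH fr e0 w0W w0K w0T.
  by case: Wf => _ _ [_ /= [_ /negP[]]]; rewrite T10 subvv.
exists t; split=> //.
have tT : t \in T1 by rewrite T1t memv_line.
have /vlineP [a ha] : h *m t \in <[t]>%VS by rewrite -T1t; apply: Kst => //; exact: hp.1.
have [hc _] := g_clsW hp.1.
have := hp.2 _ (wedge_k JT T1W g_kH tT (AWm t)).
rewrite trlie_wedge // tr_wedge // => /mulfI; rewrite pnatr_eq0 => /(_ isT).
rewrite ha wZl !(w_cls t (A *m t)) // (w_cls t (h *m _)) // (w_self (A *m t)) // oppr0 addr0.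
move/eqP; rewrite mulrN eqr_opp -subr_eq0 -[X in _ - X]mul1r -mulrBl mulf_eq0 (negPf wt) orbF subr_eq0 => /eqP ->.
by rewrite scale1r.
Qed.

Lemma orth_partner t : t \in T1 -> t != 0 -> w (A *m t) (A *m t) != 0 ->
  exists u, [/\ u \in W, w t u = 1, w u u = 0 & w u (A *m t) = 0].
Proof.
move=> tT t0 q0; have tW := subvP T1W _ tT.
have tt : w t t = 0 by exact: T1i.
have tAt : w t (A *m t) = 0 by exact: w_self.
have [u0 [u0W tu0]] : exists u0, u0 \in W /\ w t u0 != 0.
  apply: NNPP => no; case/negP: t0; apply/eqP; apply: Wn => // v vW.
  by apply/eqP/negPn/negP => tv; apply: no; exists v.
have [u1 [u1W tu1]] : exists u1, u1 \in W /\ w t u1 = 1.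
  by exists ((w t u0)^-1 *: u0); rewrite memvZ // wZr mulVf.
have [u2 [u2W tu2 u2A]] : exists u2, [/\ u2 \in W, w t u2 = 1 & w u2 (A *m t) = 0].
  exists (u1 - (w u1 (A *m t) / w (A *m t) (A *m t)) *: (A *m t)); split.
  - by rewrite memvB // memvZ // AWm.
  - by rewrite wBr wZr tAt mulr0 subr0.
  - by rewrite wBl wZl divfK // subrr.
exists (u2 - (w u2 u2 / 2) *: t); split.
- by rewrite memvB // memvZ.
- by rewrite wBr wZr tt mulr0 subr0.
- by rewrite !wBl !wBr !wZl !wZr tt [w u2 t]wS tu2; field.
- by rewrite wBl wZl u2A tAt mulr0 subr0.
Qed.

Section WithT.
Variables (t u : 'cV[F]_N).
Hypothesis T1t : T1 = <[t]>%VS.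
Hypothesis t0 : t != 0.
Hypothesis q0 : w (A *m t) (A *m t) != 0.
Hypothesis ht : h *m t = t.
Hypothesis uW : u \in W.
Hypothesis tu : w t u = 1.
Hypothesis uu : w u u = 0.
Hypothesis uA : w u (A *m t) = 0.

Let tT : t \in T1. Proof. by rewrite T1t memv_line. Qed.
Let tW : t \in W. Proof. exact: subvP T1W _ tT. Qed.
Let tt : w t t = 0. Proof. exact: T1i. Qed.
Let tA : w t (A *m t) = 0. Proof. exact: w_self. Qed.

Lemma g_line x : x \in g -> exists a, x *m t = a *: t.
Proof. by move=> xg; apply/vlineP; rewrite -T1t; apply: (g_st xg (mem_head _ _)). Qed.

Lemma wedge_g v : v \in W -> wedge t v \in g.
Proof. by move=> vW; exact: (wedge_k JT T1W g_kH tT vW). Qed.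

Let mxlin a (x y : 'M[F]_N) (z : 'cV[F]_N) : (a *: x + y) *m z = a *: (x *m z) + y *m z.
Proof. by rewrite mulmxDl scalemxAl. Qed.

(* Reduction by V = { wedge t v : v in t^perp }: g1 kills t, its hyperbolic partner
   u, and A t, so that g1 acts on an even-dimensional space. *)
Lemma orth_g1 : exists (g1 : {vspace 'M[F]_N}) A1 h1 v,
  [/\ forall x, x \in g1 <-> [/\ x \in g, x *m t = 0, x *m u = 0 & x *m (A *m t) = 0],
      frob g1 A1, prin g1 A1 h1, v \in W & w t v = 0] /\
  lie_closed g1 /\ h = wedge t (- u) + h1 + wedge t v.
Proof.
have [g1 g1E] : exists g1 : {vspace 'M[F]_N}, forall x, x \in g1 <->
    [/\ x \in g, x *m t = 0, x *m u = 0 & x *m (A *m t) = 0].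
  apply: subspace_exists; first by rewrite !mul0mx mem0v.
  move=> a x y [xg x1 x2 x3] [yg y1 y2 y3]; split.
  - by rewrite memvD // memvZ.
  - by rewrite (mxlin a x y t) x1 y1 scaler0 addr0.
  - by rewrite (mxlin a x y u) x2 y2 scaler0 addr0.
  - by rewrite (mxlin a x y (A *m t)) x3 y3 scaler0 addr0.
have wedgeD a v v' : wedge t (a *: v + v') = a *: wedge t v + wedge t v'.
  apply: mx_ext => z; rewrite (mxlin a (wedge t v) (wedge t v') z) !wedgeE0 wDl wZl.
  set b1 := w t z; set b2 := w v z; set b3 := w v' z.
  by apply/matrixP => i j; rewrite !mxE; ring.
have wedge0 : wedge t 0 = 0.
  by apply: mx_ext => z; rewrite wedgeE0 w0l mul0mx scaler0 scale0r subrr.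
have wedge0l v : wedge 0 v = 0.
  by apply: mx_ext => z; rewrite wedgeE0 w0l mul0mx scaler0 scale0r subrr.
have [V VE] : exists V : {vspace 'M[F]_N}, forall x, x \in V <->
    exists v, [/\ v \in W, w t v = 0 & x = wedge t v].
  apply: subspace_exists; first by exists 0; rewrite mem0v w0r wedge0.
  move=> a x y [v [vW tv ->]] [v' [v'W tv' ->]]; exists (a *: v + v'); split.
  - by rewrite memvD // memvZ.
  - by rewrite wDr wZr tv tv' mulr0 addr0.
  - by rewrite wedgeD.
pose h0 := wedge t (- u).
have h0t : h0 *m t = t by rewrite wedgeE0 tt wNl [w u t]wS tu scale0r sub0r scaleN1r opprK.
have trg x v : x \in g -> \tr (A *m lie x (wedge t v)) = 2 * (w (x *m t) (A *m v) + w t (A *m (x *m v))).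
  by move=> xg; rewrite trlie_wedge //; case: (g_clsW xg).
have g1l : lie_closed g1.
  move=> x y /g1E [xg x1 x2 x3] /g1E [yg y1 y2 y3]; apply/g1E; split.
  - exact: gl.
  - by rewrite /lie mulmxBl -!mulmxA x1 y1 !mulmx0 subrr.
  - by rewrite /lie mulmxBl -!mulmxA x2 y2 !mulmx0 subrr.
  - by rewrite /lie mulmxBl -!(mulmxA _ _ (A *m t)) x3 y3 !mulmx0 subrr.
have h0g : h0 \in g by apply: wedge_g; rewrite memvN.
have lie_h0 x : x \in g1 -> lie h0 x = 0.
  move=> /g1E [xg x1 x2 x3]; have [xc _] := g_clsW xg.
  by rewrite lieC lie_wedge // x1 mulmxN x2 oppr0 wedge0 wedge0l addr0 oppr0.
have [A1 [h1 [v0 [fr1 hp1 v0V hE _]]]] : exists A1 h1 v0,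
   [/\ frob g1 A1, prin g1 A1 h1, v0 \in V, h = h0 + id h1 + v0 &
    forall l, ad_eigenvalue g h l <->
      [\/ ad_eigenvalue V h l, ad_eigenvalue V h (1 - l) | ad_eigenvalue g1 h1 l]].
  apply: (reduction (iota := id) (V := V) (A := A) (h := h) (h0 := h0) _ gl g1l) => //.
  - by move=> x /g1E [].
  - move=> x /g1E [xg x1 x2 x3] /VE [v [vW tv xE]].
    have : x *m u = v - w v u *: t by rewrite xE wedgeE0 tu scale1r.
    rewrite x2 => /esym/eqP; rewrite subr_eq0 => /eqP vt.
    rewrite xE vt; apply: mx_ext => z; rewrite wedgeE0 wZl mul0mx scalerA mulrC.
    by rewrite subrr.
  - by apply/subvP => x /VE [v [vW _ ->]]; exact: wedge_g.
  - move=> x _ xg /VE [v [vW tv ->]]; have [xc _] := g_clsW xg; have [a xt] := g_line xg.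
    rewrite lie_wedge // xt; apply/VE; exists (a *: v + x *m v); split.
    + by rewrite memvD ?memvZ // (clsW_im JT Ju _ Wn (g_clsW xg)).
    + by rewrite wDr wZr tv w_cls // xt wZl tv !mulr0 oppr0 addr0.
    rewrite wedgeD; congr (_ + _); apply: mx_ext => z; rewrite -(scalemxAl a (wedge t v)) !wedgeE0 wZl.
    set b1 := w t z; set b2 := w v z.
    by apply/matrixP => i j; rewrite !mxE; ring.
  - move=> _ _ /VE [v [vW tv ->]] /VE [v' [v'W tv' ->]].
    rewrite trg; last exact: wedge_g.
    rewrite !wedgeE0 tt [w v t]wS tv tv' !scale0r !subrr w0l add0r sub0r mulmxN -scalemxAr wNr wZr tA.
    by rewrite mulr0 oppr0 mulr0.
  - move=> x _ /g1E [xg x1 x2 x3] /VE [v [vW tv ->]]; have [xc _] := g_clsW xg.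
    by rewrite trg //= x1 w0l add0r w_cls // w_cls // x3 w0l !oppr0 mulr0.
  - move=> x xg hx; have [xc _] := g_clsW xg; have [a xt] := g_line xg.
    have xw v : v \in W -> w t v = 0 -> w (x *m (A *m t) - a *: (A *m t)) v = 0.
      move=> vW tv; have : \tr (A *m lie x (wedge t v)) = 0 by apply: hx; apply/VE; exists v.
      rewrite trg // => /eqP; rewrite mulf_eq0 pnatr_eq0 /= => /eqP.
      by rewrite xt wZl (w_cls t v) // (w_cls t (x *m v)) // (w_cls (A *m t) v) // opprK wBl wZl mulrN addrC.
    (* Modulo <t>, x acts on A t by the scalar a. Since x is skew and A t is not isotropic, a =
       0. *)
    have a0 : a = 0.
      have := xw _ (AWm t) tA; rewrite wBl wZl wS w_self // sub0r => /eqP.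
      by rewrite oppr_eq0 mulf_eq0 (negPf q0) orbF => /eqP.
    rewrite a0 scale0r in xt.
    have /vlineP [b xA] : x *m (A *m t) \in <[t]>%VS.
      rewrite -T1t; apply: (perp_perp JT Wn T1W).
        exact: (clsW_im JT Ju _ Wn (g_clsW xg)).
      move=> v vW vT; rewrite wS; have := xw v vW; rewrite a0 scale0r subr0; apply.
      by rewrite wS; exact: vT.
    have xuW : x *m u \in W by exact: (clsW_im JT Ju _ Wn (g_clsW xg)).
    have txu : w t (x *m u) = 0 by rewrite w_cls // xt w0l oppr0.
    exists (x - wedge t (x *m u)), (wedge t (x *m u)); split; last by rewrite subrK.
      apply/g1E; split.
      + by rewrite memvB // wedge_g.
      + by rewrite mulmxBl xt wedgeE0 tt [w _ t]wS txu !scale0r !subrr.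
      + by rewrite mulmxBl wedgeE0 tu [w _ u]wS w_self // scale1r scale0r subr0 subrr.
      + rewrite mulmxBl wedgeE0 tA scale0r sub0r opprK.
        have -> : w (x *m u) (A *m t) = - b by rewrite cls_w // xA wZr [w u t]wS tu mulr1.
        by rewrite xA scaleNr subrr.
    by apply/VE; exists (x *m u).
  - move=> _ /VE [v [vW tv ->]]; rewrite trg // tr_wedge // h0t.
    rewrite [h0 *m v]wedgeE0 tv scale0r sub0r mulmxN -scalemxAr wNr wZr tA mulr0 oppr0 addr0 //.
  - by move=> x xg1; rewrite lie_h0 // mulmx0 raddf0.
  - by move=> x xg1; rewrite lie_h0 // mem0v.
have /VE [v [vW tv v0E]] := v0V.
exists g1, A1, h1, v; split; first by split.
by split=> //; rewrite {1}hE v0E.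
Qed.

(** t and u span a hyperbolic plane orthogonal to the anisotropic vector A t, so these three vectors
    split off; W0 is the complement on which g1 acts. *)
Lemma orth_W0 : exists W0 : vs,
  [/\ forall v, v \in W0 <-> [/\ v \in W, w t v = 0, w u v = 0 & w (A *m t) v = 0],
      nondeg J W0, (\dim W0 + 3)%N = \dim W &
      forall v, v \in W -> exists v0 a b d, v0 \in W0 /\ v = v0 + (a *: t + b *: u + d *: (A *m t))].
Proof.
have [E EE] : exists E : 'M[F]_(N, 1 + 1 + 1), E = row_mx (row_mx t u) (A *m t) by eexists.
have Ec (c : 'cV_(1 + 1 + 1)) : exists a b d, [/\ E *m c = a *: t + b *: u + d *: (A *m t) &
    a = 0 -> b = 0 -> d = 0 -> c = 0].
  exists (usubmx (usubmx c) 0 0), (dsubmx (usubmx c) 0 0), (dsubmx c 0 0).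
  have r1 (M : 'cV[F]_N) (x : 'cV[F]_1) : M *m x = x 0 0 *: M by rewrite [x in LHS]mx11_scalar mul_mx_scalar.
  split; first by rewrite -{1}(vsubmxK c) -{1}(vsubmxK (usubmx c)) EE !mul_row_col !r1.
  move=> a0 b0 d0; rewrite -(vsubmxK c) -(vsubmxK (usubmx c)).
  by rewrite [usubmx (usubmx c)]mx11_scalar [dsubmx (usubmx c)]mx11_scalar [dsubmx c]mx11_scalar a0 b0 d0 !raddf0 !col_mx0.
have Ed a b d : exists c, E *m c = a *: t + b *: u + d *: (A *m t).
  exists (col_mx (col_mx a%:M b%:M) d%:M).
  by rewrite EE !mul_row_col !mul_mx_scalar.
have Eu : E^T *m J *m E \in unitmx.
  apply: gram_unit => c; have [a [b [d [-> c0]]]] := Ec c => h0.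
  have hx a' b' d' : w (a *: t + b *: u + d *: (A *m t)) (a' *: t + b' *: u + d' *: (A *m t)) = 0.
    by have [c' <-] := Ed a' b' d'.
  have := hx 0 1 0; rewrite !scale0r add0r addr0 scale1r !wDl !wZl tu uu [w _ u]wS uA !mulr0 !addr0 mulr1 => a0.
  have := hx 1 0 0; rewrite !scale0r !addr0 scale1r !wDl !wZl tt [w u t]wS tu [w (A *m t) t]wS tA !mulr0 mulr1 add0r addr0 => b0.
  have := hx 0 0 1; rewrite !scale0r !add0r scale1r !wDl !wZl tA uA !mulr0 !add0r => /eqP.
  by rewrite mulf_eq0 (negPf q0) orbF => /eqP d0; apply: c0.
have EW c : E *m c \in W.
  by have [a [b [d [-> _]]]] := Ec c; rewrite !memvD // memvZ // AWm.
have [W0 W0E] : exists W0 : vs, W0 = cperp J W E by eexists.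
exists W0; rewrite W0E; split.
- move=> v; split=> [vW0|[vW v1 v2 v3]].
    have wE0 a b d : w (a *: t + b *: u + d *: (A *m t)) v = 0.
      by have [c <-] := Ed a b d; exact: w_cperpB vW0.
    split; first exact: (subvP (cperp_sub J W E)).
    + by have := wE0 1 0 0; rewrite !scale0r !addr0 scale1r.
    + by have := wE0 0 1 0; rewrite !scale0r addr0 add0r scale1r.
    + by have := wE0 0 0 1; rewrite !scale0r !add0r scale1r.
  apply/cperpP; split=> //; apply: mx_w0v => c; have [a [b [d [-> _]]]] := Ec c.
  by rewrite !wDl !wZl v1 v2 v3 !mulr0 !addr0.
- exact: (cperp_nondeg JT Wn EW Eu).
- exact: (cperp_dim EW Eu).
move=> v vW; have cv := compl_cperp JT EW Eu vW.
have [c cE] : exists c, gproj J E *m v = E *m c by rewrite gprojE; eexists.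
have [a [b [d [Ecc _]]]] := Ec c.
by exists (v - gproj J E *m v), a, b, d; split=> //; rewrite -Ecc -cE subrK.
Qed.

Lemma W0_clsW (W0 : vs) (x : 'M[F]_N) :
  (forall v, v \in W0 <-> [/\ v \in W, w t v = 0, w u v = 0 & w (A *m t) v = 0]) ->
  clsW J W0 x <-> [/\ clsW J W x, x *m t = 0, x *m u = 0 & x *m (A *m t) = 0].
Proof.
move=> W0E; split=> [[xc xk]|[[xc xk] x1 x2 x3]].
  split; first split=> //.
  - by move=> v vW; apply: xk => w0 /W0E [w0W _ _ _]; exact: vW.
  - by apply: xk => v /W0E [].
  - by apply: xk => v /W0E [].
  - by apply: xk => v /W0E [].
split=> // v vW0; apply: (w_nondeg Ju) => z.
rewrite cls_w // vW0 ?oppr0 //; apply/W0E; split.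
- by apply: (clsW_im JT Ju _ Wn); split.
- by rewrite w_cls // x1 w0l oppr0.
- by rewrite w_cls // x2 w0l oppr0.
- by rewrite w_cls // x3 w0l oppr0.
Qed.

(** Here g1 is the full orthogonal algebra of W0, hence zero by [frob_full]. So h maps T1^perp into
    T1, and only 0 occurs on T1^perp / T1. *)
Lemma orth_one : T = [::] -> forall l, ev h 0%VS W l -> small l.
Proof.
move=> T_nil; have [g1 [A1 [h1 [v [[g1E fr1 hp1 vW tv] [_ hE]]]]]] := orth_g1.
have [W0 [W0E W0n _ _]] := orth_W0.
have h10 : h1 = 0.
  apply: (frob_full W0n _ fr1) => [x|]; last exact: hp1.1.
  rewrite g1E (W0_clsW _ W0E); split=> [[xg x1 x2 x3]|[xW x1 x2 x3]]; split=> //; first exact: g_clsW.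
  apply/gE; case: xW => xc xk; split=> // Y; rewrite T_nil inE => /eqP ->.
  by move=> z; rewrite T1t => /vlineP [b ->]; rewrite -scalemxAr x1 scaler0 mem0v.
have hW := g_clsW hp.1; have [P [PE _]] := perp_ex Wn T1W.
have hT1 : stable h T1 by exact: (g_st hp.1 (mem_head _ _)).
have e1 l : ev h 0%VS T1 l -> l = 1.
  by rewrite T1t; apply: ev_line; rewrite ht scale1r.
have sm1 : small 1 by exists 1; rewrite /bd /off e0 /= add0r.
move=> l /(ev_three hW Wn T1W T1i hT1 PE) [/e1 ->//|[y [yP yT hy]]|/e1 l1]; last first.
  by rewrite -[l]opprK l1; apply: small_opp.
have /PE [yW yt] := yP; have ty := yt _ tT.
have hyT : h *m y \in T1.
  rewrite hE h10 addr0 mulmxDl !wedgeE0 ty !scale0r !sub0r T1t -!scaleNr memvD //.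
  - by rewrite memvZ // memv_line.
  - by rewrite memvZ // memv_line.
case: (eqVneq l 0) => [->|l0]; first exact: small0.
case/negP: yT; have : l *: y \in T1.
  by rewrite -[l *: y]opprK memvN -(addKr (h *m y) (- _)) memvD ?memvN.
by move/(memvZ l^-1); rewrite scalerA mulVf // scale1r.
Qed.

(** The conclusion amounts to T2 = <t, s>. If T2 were orthogonal to A t, wedge t k with k in T2
    outside T1 would be in the kernel; this gives s. For the rest, [K_orth] is applied to g1 on W0
    with K = T2 cap W0 and the W0-component s0 of s. *)
Lemma orth_T2 T2 : T2 \in T1 :: T -> ~~ (T2 <= T1)%VS ->
  (forall Y, Y \in T1 :: T -> Y = T1 \/ (T2 <= Y)%VS) ->
  exists2 s, s \in T2 & w (A *m t) s != 0 /\ forall v, v \in T2 -> w u v = 0 -> w (A *m t) v = 0 -> v = 0.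
Proof.
move=> T2T T2n T2min; have [T2W T2i] := orth_iso T2T; have T12 := T1_sub T2T.
have tT2 := subvP T12 _ tT.
have [s [sT2 ws]] : exists s, s \in T2 /\ w (A *m t) s != 0.
  apply: NNPP => no; have T2A v : v \in T2 -> w (A *m t) v = 0.
    by move=> vT; apply/eqP/negPn/negP => h0; apply: no; exists v.
  have /subvPn [k kT2 kT1] := T2n.
  have : wedge t k = 0.
    apply: (wedge_ker JT AW g_clsW T1W g_kH fr tT (subvP T2W _ kT2)) => y yg.
    have [yc _] := g_clsW yg; have [b yt] := g_line yg.
    rewrite yt wZl !(w_cls t) // T2A // T2A ?oppr0 ?mulr0 ?addr0 //.
    exact: (g_st yg T2T).
  move=> /(wedge_eq0 Ju) /(_ t0) [b kb].
  by case/negP: kT1; rewrite kb memvZ.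
exists s => //; split=> //.
have [g1 [A1 [h1 [v1 [[g1E fr1 hp1 _ _] [g1l _]]]]]] := orth_g1.
have [W0 [W0E W0n W0d W0s]] := orth_W0.
have [A' [AW' AE']] := cls_rep JT Ju A1 W0n.
have g1W0 x : x \in g1 -> clsW J W0 x.
  by move=> /g1E [xg x1 x2 x3]; apply/(W0_clsW _ W0E); split=> //; exact: g_clsW.
have fr1' : frob g1 A' by apply: (frob_ext g1l) fr1 => x /g1W0; exact: AE'.
have [A'c _] := AW'.
have [K KE] : exists K : vs, forall v, v \in K <-> [/\ v \in T2, w u v = 0 & w (A *m t) v = 0].
  apply: subspace_exists; first by rewrite mem0v !w0r.
  move=> a x y [xT x1 x2] [yT y1 y2]; split; first by rewrite memvD // memvZ.
  - by rewrite wDr wZr x1 y1 mulr0 addr0.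
  - by rewrite wDr wZr x2 y2 mulr0 addr0.
have KT2 v : v \in K -> v \in T2 by move=> /KE [].
have KW0 : (K <= W0)%VS.
  by apply/subvP => v /KE [vT va vb]; apply/W0E; split=> //; [exact: (subvP T2W) | exact: T2i].
have Ki : isotropic J K by move=> a b /KT2 aT /KT2 bT; exact: T2i.
have Kst y : y \in g1 -> stable y K.
  move=> /g1E [yg y1 y2 y3] v /KE [vT va vb]; have [yc _] := g_clsW yg; apply/KE; split.
  - exact: (g_st yg T2T).
  - by rewrite w_cls // y2 w0l oppr0.
  - by rewrite w_cls // y3 w0l oppr0.
have kH x : clsW J W0 x -> (forall v, v \in W0 -> (forall a, a \in K -> w a v = 0) -> x *m v \in K) -> x \in g1.
  move=> /(W0_clsW _ W0E) [xW x1 x2 x3] hx; apply/g1E; split=> //; apply/gE.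
  have [xc xk] := xW; split=> // Y YT v vY; have [YW Yi] := orth_iso YT.
  case: (T2min _ YT) => [YT1|T2Y].
    by move: vY; rewrite YT1 T1t => /vlineP [b ->]; rewrite -scalemxAr x1 scaler0 mem0v.
  apply: (subvP T2Y); apply: KT2.
  have [v0 [a [b [d [v0W vE]]]]] := W0s _ (subvP YW _ vY).
  have -> : x *m v = x *m v0.
    by rewrite vE !mulmxDr -!scalemxAr x1 x2 x3 !scaler0 !addr0.
  apply: hx => // k kK; have /KE [kT2 ka kb] := kK.
  have v0E : v0 = v - (a *: t + b *: u + d *: (A *m t)) by rewrite vE addrK.
  rewrite v0E wBr (Yi _ _ (subvP T2Y _ kT2) vY) !wDr !wZr (T2i _ _ kT2 tT2) [w k u]wS [w k (A *m t)]wS ka kb.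
  by rewrite !mulr0 !addr0 subrr.
have [s0 [a [b [d [s0W sE]]]]] := W0s _ (subvP T2W _ sT2).
have /W0E [_ ts0 us0 As0] := s0W.
have b0 : b = 0.
  have := T2i _ _ tT2 sT2; rewrite sE !wDr !wZr ts0 tt tu tA !mulr0 mulr1 !add0r addr0 //.
have d0 : d != 0.
  apply: contra ws => /eqP dz; rewrite sE b0 dz !scale0r !addr0 wDr wZr As0 [w (A *m t) t]wS tA mulr0 addr0 //.
have s0E : s0 = s - a *: t - d *: (A *m t).
  by rewrite sE b0 scale0r addr0 -addrA -opprD addrK.
have s0K v : v \in K -> w v s0 = 0.
  move=> /KE [vT va vb]; rewrite s0E !wBr !wZr (T2i _ _ vT sT2) (T2i _ _ vT tT2) [w v (A *m t)]wS vb.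
  by rewrite !mulr0 !subr0.
have s0s0 : w s0 s0 != 0.
  have h1' : w s0 s0 = w s0 s.
    by rewrite sE b0 scale0r addr0 !wDr !wZr [w s0 t]wS ts0 [w s0 (A *m t)]wS As0 !mulr0 !addr0.
  rewrite h1' s0E !wBl !wZl (T2i _ _ sT2 sT2) (T2i _ _ tT2 sT2) mulr0 !sub0r ?oppr0 ?add0r.
  by rewrite oppr_eq0 mulf_neq0.
have s0nK : s0 \notin K by apply: contra s0s0 => h0; rewrite s0K.
have [K0|[k [Kk k0 q1]]] := K_orth JT Ju W0n AW' g1W0 KW0 Ki Kst kH fr1' e0 s0W s0K s0nK.
  by move=> v vT va vb; apply/eqP; rewrite -memv0 -K0; apply/KE.
(* The alternative K = <k>: modulo K, s0 is a nonzero multiple of A' k, and K turns out to be the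
   orthogonal of K + <s0> in W0. Then dim W0 = 1 + 2 and dim W = 6, against the parity. *)
exfalso.
have kK : k \in K by rewrite Kk memv_line.
have kW0 := subvP KW0 _ kK.
have ys0 y : y \in g1 -> y *m s0 \in K.
  move=> yg1; have /g1E [yg y1 y2 y3] := yg1; have [yc _] := g_clsW yg.
  have -> : y *m s0 = y *m s.
    by rewrite sE b0 scale0r addr0 !mulmxDr -!scalemxAr y1 y3 !scaler0 !addr0.
  apply/KE; split; first exact: (g_st yg T2T).
  - by rewrite w_cls // y2 w0l oppr0.
  - by rewrite w_cls // y3 w0l oppr0.
have [x0 x0E] : exists x0, x0 = A' *m k by eexists.
have q1' : w x0 x0 != 0 by rewrite x0E.
have kx0 : w k x0 = 0 by rewrite x0E w_self.
have x0K v : v \in K -> w x0 v = 0 by rewrite Kk => /vlineP [c ->]; rewrite wZr wS kx0 mulr0.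
have x0W0 : x0 \in W0 by rewrite x0E; exact: (clsW_im JT Ju _ W0n AW').
have ker z : z \in W0 -> w x0 z = 0 -> (forall y, y \in g1 -> w x0 (y *m z) = 0) -> z \in K.
  move=> zW xz hz; have : wedge k z = 0.
    apply: (wedge_ker JT AW' g1W0 KW0 kH fr1' kK zW) => y yg.
    have : y *m k \in K by exact: Kst.
    rewrite Kk => /vlineP [c ->].
    by rewrite wZl !(w_cls k) // -x0E xz hz // oppr0 mulr0 addr0.
  move=> /(wedge_eq0 Ju) /(_ k0) [c ->]; exact: memvZ.
have [c cE] : exists c, c = w x0 s0 / w x0 x0 by eexists.
have z1K : s0 - c *: x0 \in K.
  apply: ker; first by rewrite memvB // memvZ.
    by rewrite wBr wZr cE divfK // subrr.
  move=> y yg; have [yc _] := g1W0 _ yg.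
  by rewrite mulmxBr -scalemxAr wBr wZr (x0K _ (ys0 _ yg)) w_self // mulr0 subr0.
have c0 : c != 0.
  by apply: contra s0nK => /eqP cz; move: z1K; rewrite cz scale0r subr0.
have Y0 : (K + <[s0]> <= W0)%VS by rewrite subv_add KW0 -memvE.
have [P [PE Pd]] := perp_ex W0n Y0.
have PK z : z \in P -> z \in K.
  move=> /PE [zW zK]; have ks : w k z = 0 by apply: zK; apply: (subvP (addvSl _ _)).
  have ss : w s0 z = 0 by apply: zK; apply: (subvP (addvSr _ _)); exact: memv_line.
  have xK v : v \in K -> w v z = 0 by move=> vK; apply: zK; apply: (subvP (addvSl _ _)).
  have x0E' : x0 = c^-1 *: (s0 - (s0 - c *: x0)) by rewrite opprB addrC subrK scalerA mulVf // scale1r.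
  apply: ker => //; first by rewrite x0E' wZl wBl ss (xK _ z1K) subrr mulr0.
  move=> y yg; have [yc _] := g1W0 _ yg.
  rewrite w_cls // xK ?oppr0 // x0E' -scalemxAr mulmxBr memvZ // memvB ?ys0 //.
  exact: (Kst _ yg).
have KP : (K <= P)%VS.
  apply/subvP => v vK; apply/PE; split; first exact: (subvP KW0).
  move=> _ /memv_addP [v' v'K [_ /vlineP [m ->] ->]].
  by rewrite wDl wZl Ki // [w s0 v]wS s0K // mulr0 addr0.
have PKe : P = K by apply/eqP; rewrite eqEsubv KP andbT; apply/subvP => z; exact: PK.
have dK : \dim K = 1%N by rewrite Kk dim_vline k0.
have dKs : \dim (K + <[s0]>)%VS = 2%N.
  have := dim_add_line s0nK; rewrite dK => lt.
  have le : (\dim (K + <[s0]>)%VS <= 2)%N.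
    apply: leq_trans (dimv_add_leqif K <[s0]>%VS).1 _; rewrite dK dim_vline; by case: (s0 != 0).
  by apply/eqP; rewrite eqn_leq le lt.
have par : odd (\dim W) by case: Wf => _ _ _ _; apply.
by move: par; rewrite -W0d -Pd PKe dK dKs.
Qed.

End WithT.
End OrthStep.
End Orth.
(** h has eigenvalue 1 on T1 = <t>. When there is a second member <t, s>, testing h on wedge t s
    puts h s in T1, so T2 / T1 has eigenvalue 0. The form w (A v) v' vanishes on T1 but is
    nondegenerate on T2, so [step_O] is applied with K = T2. *)
Lemma base_orth W T1 T : e = false -> wf e J W [::] (T1 :: T) ->
  (forall W' T', (\dim W' < \dim W)%N -> wf e J W' [::] T' -> base_state W' T') ->
  base_state W (T1 :: T).
Proof.
move=> e0 Wf IH; have [Wn iso [_ /= [_ T1n cT]] _ _] := Wf.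
apply: base_wlog => // g A h AW gE fr hp; have [Ac _] := AW.
have [t [T1t t0 q0 ht]] := orth_line e0 Wf AW gE fr hp.
have tT : t \in T1 by rewrite T1t memv_line.
have [u [uW tu uu uA]] := orth_partner e0 Wf AW tT t0 q0.
have hW : clsW J W h by exact: (g_clsW gE hp.1).
have [hc _] := hW.
have hst Y : Y \in T1 :: T -> stable h Y by exact: (g_st gE hp.1).
have e1 l : ev h 0%VS T1 l -> l = off F e + (1 : int)%:~R.
  by rewrite T1t => evl; rewrite /off e0 add0r; apply: ev_line evl; rewrite ht scale1r.
have good1 : good e (ev h 0%VS T1).
  apply: (good_single (i := 1)) => //; last by rewrite /bd e0.
  by apply: ev_exists => //; [exact: stable0 | exact: hst (mem_head _ _)].
case: T Wf IH iso cT gE hst => [|T2 T] Wf IH iso cT gE hst.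
  by split=> //; apply: (orth_one e0 Wf AW gE fr hp T1t q0 ht uW tu uu uA).
have [T12 T2n cT2] := cT.
have T2T : T2 \in [:: T1, T2 & T] by rewrite !inE eqxx orbT.
have T2min Y : Y \in [:: T1, T2 & T] -> Y = T1 \/ (T2 <= Y)%VS.
  rewrite !inE => /or3P [/eqP ->|/eqP ->|YT]; [by left | by right; exact: subvv |].
  by right; exact: chain_mem cT2 YT.
have [s sT2 [ws T2z]] := orth_T2 e0 Wf AW gE fr hp T1t t0 q0 uW tu uu uA T2T T2n T2min.
have tT2 := subvP T12 _ tT.
have [T2W T2i] := iso _ T2T; have [T1W T1i] := iso _ (mem_head _ _).
have tA : w (A *m t) t = 0 by rewrite (wS e0) (w_self e0).
have T2d v : v \in T2 -> exists c m, v = c *: s + m *: t.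
  move=> vT; pose c := w (A *m t) v / w (A *m t) s.
  exists c, (w u (v - c *: s)); apply/eqP; rewrite -subr_eq0 opprD addrA; apply/eqP; apply: T2z.
  - by rewrite !memvB // memvZ.
  - by rewrite wBr wZr (wS e0 u t) tu mulr1 subrr.
  - by rewrite !wBr !wZr tA mulr0 subr0 divfK // subrr.
have hsT : h *m s \in T1.
  have [c [m hs]] := T2d _ (hst _ T2T _ sT2).
  have := hp.2 _ (wedge_g Wf gE T1t (subvP T2W _ sT2)).
  rewrite trlie_wedge // tr_wedge // ht mulrDr => /eqP; rewrite -subr_eq0 addrAC subrr add0r mulf_eq0 pnatr_eq0 /=.
  rewrite w_cls // oppr_eq0 hs wDr !wZr tA mulr0 addr0 mulf_eq0 (negPf ws) orbF => /eqP ->.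
  by rewrite scale0r add0r memvZ.
have e2 l : ev h T1 T2 l -> l = off F e + (0 : int)%:~R.
  move=> [y [yT2 yT1 hy]]; rewrite /off e0 addr0 /=; apply/eqP/negPn/negP => l0.
  have [c [m yE]] := T2d _ yT2.
  have hyT : h *m y \in T1 by rewrite yE mulmxDr -!scalemxAr ht memvD // memvZ.
  case/negP: yT1; have : l *: y \in T1.
    by rewrite -[l *: y]opprK memvN -(addKr (h *m y) (- _)) memvD ?memvN.
  by move/(memvZ l^-1); rewrite scalerA mulVf // scale1r.
have good2 : good e (ev h T1 T2).
  apply: (good_single (i := 0)) => //; last by rewrite /bd e0.
  by apply: ev_exists => //; apply: hst => //; exact: mem_head.
have [||||agT smW] := @step_O W [:: T1] T2 T g A h Wf _ cT2 _ AW gE fr hp _ IH.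
- by move=> Y; rewrite inE => /eqP ->.
- by apply: contra T2n => /eqP ->; rewrite sub0v.
- move=> v vT2 hv; have [c [m vE]] := T2d _ vT2.
  have := hv _ tT2; rewrite cls_w // (wS e0) vE wDr !wZr tA mulr0 addr0 => /eqP.
  rewrite oppr_eq0 mulf_eq0 (negPf ws) orbF => /eqP c0.
  have := hv _ sT2; rewrite vE c0 scale0r add0r -scalemxAr wZl => /eqP.
  by rewrite mulf_eq0 (negPf ws) orbF => /eqP ->; rewrite scale0r.
- move=> l /(ev_split _ (sub0v T1) T12 (@stable0 h) (hst _ (mem_head _ _))) [/e1|/e2] ->.
    by exists 1; split=> //; rewrite /bd e0.
  by exists 0; split=> //; rewrite /bd e0.
by split.
Qed.

Lemma base_all n W T : (\dim W <= n)%N -> wf e J W [::] T -> base_state W T.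
Proof.
elim: n W T => [|n IH] W T dW Wf.
  case: T Wf => [|T1 T] Wf; first exact: base_nil.
  have [Wn iso [_ /= [_ T1n _]] _ _] := Wf; have [T1W _] := iso _ (mem_head _ _).
  have : W = 0%VS by apply/eqP; rewrite -dimv_eq0 -leqn0.
  by move=> W0; case/negP: T1n; move: T1W; rewrite W0.
have IH' W' T' : (\dim W' < \dim W)%N -> wf e J W' [::] T' -> base_state W' T'.
  by move=> lt; apply: IH; rewrite -ltnS (leq_trans lt).
case: T Wf => [|T1 T] Wf; first exact: base_nil.
case: (boolP e) => [e1|/negPf e0]; first exact: base_symp.
exact: base_orth.
Qed.

Lemma wf_swap W U T : wf e J W U T -> wf e J W T U.
Proof.
move=> [Wn iso [cU cT] tr par]; split=> //.
- by move=> Y; rewrite mem_cat orbC -mem_cat; exact: iso.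
- move=> Y Z YT ZU; have [h0|h0] := tr _ _ ZU YT; [right|left] => z zZ hz; apply: h0 => // v vV.
    by apply: (wC0 JT); exact: hz.
  by apply: (wC0 JT); exact: hz.
Qed.

Lemma claim_swap W U T : claim_state e J W T U -> claim_state e J W U T.
Proof.
move=> C g A h gE fr hp; have [] := C g A h _ fr hp; last by split.
by move=> x; rewrite gE; exact: Reg_swap.
Qed.

Lemma claim_all n W U T : (\dim W <= n)%N -> wf e J W U T -> claim_state e J W U T.
Proof.
elim: n W U T => [|n IH] W U T dW Wf.
  have Wn : nondeg J W by case: Wf.
  have W0 : W = 0%VS by apply/eqP; rewrite -dimv_eq0 -leqn0.
  case: U Wf => [|U1 U] Wf; first by apply: base_claim => //; exact: base_all Wf.
  have [_ iso [/= [_ U1n _] _] _ _] := Wf; have [U1W _] := iso _ (mem_head _ _).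
  by case/negP: U1n; move: U1W; rewrite W0.
have Wn : nondeg J W by case: Wf.
have IH' W' U' T' : (\dim W' < \dim W)%N -> wf e J W' U' T' -> claim_state e J W' U' T'.
  by move=> lt; apply: IH; rewrite -ltnS (leq_trans lt).
case: U Wf => [|U1 U] Wf; first by apply: base_claim => //; exact: base_all Wf.
case: T Wf => [|T1 T] Wf.
  by apply: claim_swap; apply: base_claim => //; apply: base_all (wf_swap Wf).
have [_ _ _ tr _] := Wf.
have [h0|h0] := tr _ _ (mem_head _ _) (mem_head _ _).
  exact: (claim_iso JT Ju Wf h0 IH').
apply: claim_swap; apply: (claim_iso JT Ju (wf_swap Wf) _ IH').
by move=> z zT hz; apply: h0 => // v vU; apply: (wC0 JT); exact: hz.
Qed.

End Base.

(** * Standard seaweeds as stabilisers of flags *)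

Section Std.
Variables (F : numClosedFieldType) (e : bool) (N n : nat) (J : 'M[F]_N) (ss : 'I_N -> F).
Local Notation eps := (sg F e).
Hypothesis JE : forall i j, J i j = if j == rev_ord i then ss i else 0.
Hypothesis ss2 : forall i, ss i * ss i = 1.
Hypothesis ssr : forall i, ss (rev_ord i) = eps * ss i.
Hypothesis Nn : (n.*2 <= N <= n.*2.+1)%N.
Hypothesis Nodd : e = false -> N = n.*2.+1.

Lemma std_JT : J^T = eps *: J.
Proof.
apply/matrixP => i j; rewrite !mxE !JE.
have -> : (i == rev_ord j) = (j == rev_ord i) by apply/eqP/eqP => ->; rewrite rev_ordK.
by case: eqP => [->|]; rewrite ?mulr0 // ssr.
Qed.

Lemma mulJE k (x : 'M[F]_(N, k)) i j : (J *m x) i j = ss i * x (rev_ord i) j.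
Proof.
rewrite mxE (bigD1 (rev_ord i)) //= JE eqxx big1 ?addr0 // => l li.
by rewrite JE (negPf li) mul0r.
Qed.

Lemma mulxJE k (x : 'M[F]_(k, N)) i j : (x *m J) i j = x i (rev_ord j) * ss (rev_ord j).
Proof.
rewrite mxE (bigD1 (rev_ord j)) //= JE rev_ordK eqxx big1 ?addr0 // => l li.
by rewrite JE; case: eqP => [jl|]; rewrite ?mulr0 //; rewrite jl rev_ordK eqxx in li.
Qed.

Lemma std_JJ : J *m J = eps%:M.
Proof.
apply/matrixP => i j; rewrite mulJE JE rev_ordK mxE ssr eq_sym; case: eqP => _; last by rewrite mulr0.
by rewrite mulrCA ss2 mulr1.
Qed.

Lemma std_Ju : J \in unitmx.
Proof.
have h : J *m (eps *: J) = 1%:M by rewrite -scalemxAr std_JJ scale_scalar_mx eps2.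
by have [] := mulmx1_unit h.
Qed.

Lemma clsE (x : 'M[F]_N) : x \in cls J <->
  forall i j, x i j = - (ss i * ss j * x (rev_ord j) (rev_ord i)).
Proof.
have key i j : (x^T *m J) i j = - (J *m x) i j <->
    x (rev_ord i) j = - (ss (rev_ord i) * ss j * x (rev_ord j) i).
  rewrite mulxJE mulJE mxE !ssr.
  have z1 := ss2 i; have z2 := ss2 j; have z3 := eps2 F e.
  set a := ss i in z1 *; set b := ss j in z2 *; set E := sg F e in z3 *.
  set y := x (rev_ord j) i; set z := x (rev_ord i) j; split=> [h|h].
    have -> : z = a * a * z by rewrite z1 mul1r.
    rewrite -[a * a * z]opprK -mulrA -mulrN -mulrN -[- (a * z)]h; ring.
  rewrite h; have -> : - (a * - (E * a * b * y)) = (a * a) * (E * b * y) by ring.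
  by rewrite z1; ring.
split=> [/clsP h i j|h].
  by rewrite -{1}(rev_ordK i) (proj1 (key (rev_ord i) j)) ?rev_ordK // h mxE.
by apply/clsP/matrixP => i j; rewrite [RHS]mxE; apply/key; rewrite h rev_ordK.
Qed.

Lemma cartan_diag H : cartan J H -> exists2 d : 'rV[F]_N, H = diag_mx d & forall i, d 0 (rev_ord i) = - d 0 i.
Proof.
move=> [Hc /is_diag_mxP Hd]; exists (\row_i H i i).
  apply/matrixP => i j; rewrite !mxE; case: eqP => [->|/eqP ij]; first by rewrite mulr1n.
  by rewrite mulr0n Hd.
move=> i; have /clsE h := Hc; rewrite !mxE (h (rev_ord i)) rev_ordK !ssr.
have -> : eps * ss i * (eps * ss i) = (eps * eps) * (ss i * ss i) by ring.
by rewrite eps2 ss2 !mul1r.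
Qed.

Lemma diag_cartan (d : 'rV[F]_N) : (forall i, d 0 (rev_ord i) = - d 0 i) -> cartan J (diag_mx d).
Proof.
move=> h; split; last exact: diag_mx_is_diag.
apply/clsE => i j; rewrite !mxE (inj_eq rev_ord_inj) eq_sym; case: eqP => [->|_]; last by rewrite !mulr0n mulr0 oppr0.
by rewrite !mulr1n h ss2 mul1r opprK.
Qed.

Lemma lie_diag (d : 'rV[F]_N) X i j : lie (diag_mx d) X i j = (d 0 i - d 0 j) * X i j.
Proof. by rewrite /lie mul_diag_mx mul_mx_diag !mxE mulrBl [X i j * _]mulrC. Qed.

Lemma lie_cartan H X i j : cartan J H -> lie H X i j = (H i i - H j j) * X i j.
Proof. by case/cartan_diag => d -> _; rewrite lie_diag !mxE !eqxx !mulr1n. Qed.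

Lemma rootspE beta X i j H : rootsp J beta X -> cartan J H -> X i j != 0 -> beta H = H i i - H j j.
Proof.
move=> [_ h] Hc X0; have := congr1 (fun M : 'M_N => M i j) (h H Hc); rewrite lie_cartan // mxE.
by move/(mulIf X0) ->.
Qed.

(** A regular element: its diagonal decreases in steps of 2, so the value at [rho] of the weight
    H_ii - H_jj reads off j - i. *)
Definition rho : 'M[F]_N := diag_mx (\row_i (N%:R - 1 - (i : nat)%:R * 2)).

Lemma rho_cartan : cartan J rho.
Proof.
apply: diag_cartan => i; rewrite !mxE /= natrB; last by case: i.
by rewrite -natr1; ring.
Qed.

Lemma rhoE i j : rho i i - rho j j = ((j : nat)%:R - (i : nat)%:R) * 2.
Proof. rewrite !mxE !eqxx !mulr1n; ring. Qed.

(* The coweight that vanishes on all simple roots but the m-th one. *)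
Definition Hm (m : nat) : 'M[F]_N :=
  diag_mx (\row_i (if (i < m)%N then 1 else if (N - m <= i)%N then -1 else 0)).

Lemma HmE m i : Hm m i i = if (i < m)%N then 1 else if (N - m <= i)%N then -1 else 0.
Proof. by rewrite !mxE eqxx mulr1n. Qed.

Lemma Hm_cartan m : (m <= n)%N -> cartan J (Hm m).
Proof.
move=> mn; apply: diag_cartan => i; rewrite !mxE /=; have := ltn_ord i; case/andP: Nn => n1 n2 iN.
have -> : (N - i.+1 < m)%N = (N - m <= i)%N by apply/idP/idP; lia.
have -> : (N - m <= N - i.+1)%N = (i < m)%N by apply/idP/idP; lia.
case: ltnP => h1; case: leqP => h2 //; rewrite ?opprK ?oppr0 //; lia.
Qed.

(* Root vector of weight H_ii - H_jj (zero if j = rev_ord i in the orthogonal case). *)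
Definition elt (i j : 'I_N) (a : F) : 'M[F]_N :=
  a *: delta_mx i j - (ss i * ss j * a) *: delta_mx (rev_ord j) (rev_ord i).

Lemma elt_cls i j a : elt i j a \in cls J.
Proof.
have rE (x y : 'I_N) : (rev_ord x == y) = (x == rev_ord y).
  by apply/eqP/eqP => [<-|->]; rewrite rev_ordK.
apply/clsE => k l; rewrite !mxE !rE !rev_ordK.
have f1 : ss k * ss l * (ss i * ss j) * ((k == i) && (l == j))%:R = ((k == i) && (l == j))%:R.
  case: eqP => [->|_] /=; last by rewrite mulr0.
  case: eqP => [->|_] /=; last by rewrite mulr0.
  have -> : ss i * ss j * (ss i * ss j) = (ss i * ss i) * (ss j * ss j) by ring.
  by rewrite !ss2 !mulr1.
have f2 : ss k * ss l * ((k == rev_ord j) && (l == rev_ord i))%:R =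
    ss i * ss j * ((k == rev_ord j) && (l == rev_ord i))%:R.
  case: eqP => [->|_] /=; last by rewrite !mulr0.
  case: eqP => [->|_] /=; last by rewrite !mulr0.
  rewrite !ssr; have -> : eps * ss j * (eps * ss i) = (eps * eps) * (ss i * ss j) by ring.
  by rewrite eps2 mul1r.
rewrite [(l == j) && _]andbC [(l == rev_ord i) && _]andbC.
set b1 := (_ && _) in f1 *; set b2 := (_ && _) in f2 *.
rewrite -{1}f1; have -> : ss i * ss j * a * b2%:R = a * (ss i * ss j * b2%:R) by ring.
by rewrite -f2; ring.
Qed.


Lemma cartan_rev H i : cartan J H -> H (rev_ord i) (rev_ord i) = - H i i.
Proof. by case/cartan_diag => d -> h; rewrite !mxE !eqxx !mulr1n. Qed.

Lemma elt_root beta i j a : (forall H, cartan J H -> beta H = H i i - H j j) -> rootsp J beta (elt i j a).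
Proof.
move=> bE; split; first exact: elt_cls.
move=> H Hc; apply/matrixP => k l; rewrite lie_cartan // bE // !mxE.
case: (boolP ((k == i) && (l == j))) => [/andP [/eqP -> /eqP ->] //|_]. 
case: (boolP ((k == rev_ord j) && (l == rev_ord i))) => [/andP [/eqP -> /eqP ->]|_]. 
  by rewrite !cartan_rev // opprK [- H j j + _]addrC.
by rewrite !mulr0 subrr !mulr0.
Qed.

(** Evaluated at [rho], a nonzero entry (k, l) of any vector of this weight satisfies l - k = j - i
    > 0. The antidiagonal is excluded in the orthogonal case, where [elt i j] vanishes there. *)
Lemma pos_root_wt (beta : weight F N) (i j : 'I_N) :
  (i < j)%N -> e = true \/ j <> rev_ord i ->
  (forall H, cartan J H -> beta H = H i i - H j j) -> pos_root J beta.
Proof.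
move=> ij ej bE; split.
  split.
    exists rho; split; first exact: rho_cartan.
    by rewrite bE ?rhoE; [rewrite mulf_neq0 ?pnatr_eq0 // subr_eq0 eqr_nat; lia | exact: rho_cartan].
  exists (elt i j 1); split; last exact: elt_root.
  apply/eqP => /matrixP /(_ i j); rewrite !mxE !eqxx /= mulr1 => /eqP; apply/negP.
  case: (eqVneq j (rev_ord i)) => [jE|jn].
    case: ej => // e1; rewrite jE rev_ordK !eqxx ssr e1 /= !mulr1.
    have -> : ss i * (-1 * ss i) = - (ss i * ss i) by ring.
    by rewrite ss2 opprK -[1 + 1]/(2%:R) pnatr_eq0.
  by rewrite andbF mulr0 subr0 mulr1 oner_eq0.
move=> X Xr k l lk; apply/eqP/negPn/negP => X0.
have := rootspE Xr rho_cartan X0; rewrite bE ?rhoE; last exact: rho_cartan.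
have two : (2 : F) != 0 by rewrite pnatr_eq0.
move=> /(mulIf two) /eqP; rewrite subr_eq addrAC eq_sym subr_eq -!natrD eqr_nat; lia.
Qed.

Lemma cls_antidiag X i : e = false -> X \in cls J -> X i (rev_ord i) = 0.
Proof.
move=> e0 /clsE /(_ i (rev_ord i)); rewrite rev_ordK ssr e0 mul1r ss2 mul1r => /eqP.
by rewrite -addr_eq0 -mulr2n mulrn_eq0 /= => /eqP.
Qed.

(** For q > p + 1 the weight H_pp - H_qq splits at an intermediate index r. In the orthogonal case
    neither half may be antidiagonal: r = p + 1 works unless q is the mirror of p + 1, and then r =
    q - 1 works, because for odd N consecutive indices are never mirrors. *)
Lemma simple_eps a : simple_root J a ->
  exists p q : 'I_N, q = p.+1 :> nat /\ forall H, cartan J H -> a H = H p p - H q q.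
Proof.
move=> [[[_ [Z [Z0 Zr]]] up] nosplit].
have [p [q Zpq]] : exists p q, Z p q != 0.
  apply: NNPP => no; case/negP: Z0; apply/eqP/matrixP => p q; rewrite mxE.
  by apply/eqP/negPn/negP => h; apply: no; exists p, q.
have aE H : cartan J H -> a H = H p p - H q q by move=> Hc; apply: rootspE Zr Hc Zpq.
have pq : (p < q)%N by rewrite ltnNge; apply/negP => qp; rewrite (up _ Zr) ?eqxx // in Zpq.
have rt : e = true \/ q <> rev_ord p.
  case: (boolP e) => [|/negPf e0]; [by left | right => qE].
  by move: Zpq; rewrite qE (cls_antidiag _ e0) ?eqxx //; case: Zr.
exists p, q; split=> //; apply/eqP/negPn/negP => qp1; apply: nosplit.
have qN := ltn_ord q.
have split_at (r : 'I_N) : (p < r)%N -> (r < q)%N -> (e = true \/ r <> rev_ord p) -> (e = true \/ q <> rev_ord r) ->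
    exists beta gamma, pos_root J beta /\ pos_root J gamma /\ forall H, cartan J H -> a H = beta H + gamma H.
  move=> pr rq h1 h2; exists (fun H => H p p - H r r), (fun H => H r r - H q q); split.
    exact: (@pos_root_wt _ p r).
  split; first exact: (@pos_root_wt _ r q).
  by move=> H /aE ->; rewrite addrA subrK.
have p1N : (p.+1 < N)%N by lia.
case: (boolP e) => [|/negPf e0].
  move=> e1; apply: (split_at (Ordinal p1N)) => /=; [lia | lia | by left | by left].
have NE := Nodd e0.
have odd_neq (x y : 'I_N) : y = x.+1 :> nat -> y <> rev_ord x.
  by move=> yx /(congr1 val) /=; have := ltn_ord x; lia.
case: (eqVneq q (rev_ord (Ordinal p1N))) => [qE|qn].
  have q1N : (q.-1 < N)%N by lia.
  apply: (split_at (Ordinal q1N)) => /=; [lia | lia | right | right].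
    by move=> /(congr1 val) /=; have := congr1 val qE => /=; lia.
  by apply: odd_neq => /=; lia.
apply: (split_at (Ordinal p1N)) => /=; [lia | lia | right | right].
  exact: odd_neq.
by move=> qE; rewrite qE eqxx in qn.
Qed.

(** The diagonal of [Hm m] jumps only at m and at N - m. These two jumps are mirror images and give
    the same weight on the Cartan subalgebra. *)
Lemma eps_in (pi : weight F N -> Prop) m (k k1 : 'I_N) : simple_subset J pi -> k1 = k.+1 :> nat ->
  (m <= n)%N -> (m = k.+1 \/ m = (N - k.+1)%N) ->
  (exists a, pi a /\ a (Hm m) <> 0) -> exists a, pi a /\ forall H, cartan J H -> a H = H k k - H k1 k1.
Proof.
move=> sp k1E mn mk [a [pia a0]]; exists a; split=> // H Hc.
have [p [q [qp aE]]] := simple_eps (sp _ pia).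
have := aE _ (Hm_cartan mn); rewrite !HmE => am.
have kN := ltn_ord k1; have qN := ltn_ord q; case/andP: Nn => n1 n2.
have pm : p.+1 = m \/ p.+1 = (N - m)%N.
  apply: NNPP => no; apply: a0; rewrite am.
  have -> : (q < m)%N = (p < m)%N by apply/idP/idP; lia.
  have -> : (N - m <= q)%N = (N - m <= p)%N by apply/idP/idP; lia.
  by rewrite subrr.
have [pk|pk] : (p = k :> nat) \/ (p = rev_ord k1 :> nat) by rewrite /=; lia.
  have -> : k = p by apply: val_inj.
  have -> : k1 = q by apply: val_inj => /=; lia.
  exact: aE.
rewrite aE //; have -> : p = rev_ord k1 by apply: val_inj.
have -> : q = rev_ord k by apply: val_inj => /=; move: pk => /=; lia.
by rewrite !cartan_rev // opprK addrC.
Qed.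

(** X preserves the span of the last m basis vectors for each m whose simple root is missing from
    pi; absence from pi is expressed through the coweight [Hm m]. *)
Definition flagU (pi : weight F N -> Prop) (X : 'M[F]_N) : Prop :=
  forall m, (0 < m <= n)%N -> (forall a, pi a -> a (Hm m) = 0) ->
  forall i j : 'I_N, (i < N - m)%N -> (N - m <= j)%N -> X i j = 0.

Lemma flagU_perp pi X m : X \in cls J -> flagU pi X -> (0 < m <= n)%N -> (forall a, pi a -> a (Hm m) = 0) ->
  forall i j : 'I_N, (i < m)%N -> (m <= j)%N -> X i j = 0.
Proof.
move=> /clsE Xc fX mn hm i j im mj; rewrite Xc (fX m) ?mulr0 ?oppr0 //=.
  by have := ltn_ord j; case/andP: Nn => n1 n2; lia.
lia.
Qed.

Lemma ncomb_cons pi beta a : ncomb J pi beta -> pi a -> ncomb J pi (fun H => a H + beta H).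
Proof.
move=> [k [b [c [hb hE]]]] pia.
exists k.+1, (fun i => if unlift ord0 i is Some j then b j else a),
  (fun i => if unlift ord0 i is Some j then c j else 1%N); split.
  by move=> i; case: unliftP => [j _|_] //; exact: hb.
move=> H Hc; rewrite big_ord_recl unlift_none mul1r hE //; congr (_ + _).
by apply: eq_bigr => i _; rewrite liftK.
Qed.

Lemma ncomb_ext pi beta beta' : (forall H, cartan J H -> beta' H = beta H) -> ncomb J pi beta -> ncomb J pi beta'.
Proof. by move=> h [k [b [c [hb hE]]]]; exists k, b, c; split=> // H Hc; rewrite h // hE. Qed.

(** The weight is the sum of the consecutive differences between i and j. If one of them were
    missing from pi, a flag condition or its orthogonal version [flagU_perp] would force X i j =
    0. *)
Lemma ncomb_wt pi X (i j : 'I_N) (beta : weight F N) : simple_subset J pi -> X \in cls J -> flagU pi X ->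
  (i < j)%N -> X i j != 0 -> (forall H, cartan J H -> beta H = H i i - H j j) -> ncomb J pi beta.
Proof.
move=> sp Xc fX ij X0.
have step (k k1 : 'I_N) : k1 = k.+1 :> nat -> (i <= k)%N -> (k < j)%N ->
    exists a, pi a /\ forall H, cartan J H -> a H = H k k - H k1 k1.
  move=> k1E ik kj; have kN := ltn_ord k1; case/andP: Nn => n1 n2; have jN := ltn_ord j.
  have [m [mn mk]] : exists m, (0 < m <= n)%N /\ (m = k.+1 \/ m = (N - k.+1)%N).
    case: (leqP k.+1 n) => kn; first by exists k.+1; split; [lia | left].
    by exists (N - k.+1)%N; split; [lia | right].
  apply: (eps_in sp k1E _ mk); first by case/andP: mn.
  apply: NNPP => no; case/negP: X0; apply/eqP.
  have hm a : pi a -> a (Hm m) = 0 by move=> pia; apply: NNPP => h; apply: no; exists a.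
  case: mk => mk; first by apply: (flagU_perp Xc fX mn hm); lia.
  by apply: (fX m mn hm); lia.
move: beta; have [d dE] : exists d, (j = i + d :> nat)%N by exists (j - i)%N; lia.
have {X0 ij} : forall d (k : 'I_N), (i <= k)%N -> (j = k + d :> nat)%N -> forall beta : weight F N,
  (forall H, cartan J H -> beta H = H k k - H j j) -> ncomb J pi beta.
  elim=> [|d' IH] k ik jk beta bE.
    have kj : k = j by apply: val_inj; rewrite /= jk addn0.
    exists 0%N, (fun i => beta), (fun i => 0%N); split; first by case.
    by move=> H Hc; rewrite bE // kj subrr big_ord0.
  have k1N : (k.+1 < N)%N by have := ltn_ord j; lia.
  have [a [pia aE]] : exists a, pi a /\ forall H, cartan J H -> a H = H k k - H (Ordinal k1N) (Ordinal k1N).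
    by apply: step => //; lia.
  have nc : ncomb J pi (fun H => H (Ordinal k1N) (Ordinal k1N) - H j j) by apply: (IH (Ordinal k1N)) => //=; lia.
  apply: ncomb_ext (ncomb_cons nc pia) => H Hc.
  by rewrite bE // aE // addrA subrK.
by apply; [exact: leqnn | exact: dE].
Qed.

(** Transposition exchanges positive and negative roots, so the statements about pi2 reduce to those
    for positive roots. *)
Lemma rootsp_tr beta Y : rootsp J beta Y -> rootsp J (fun H => - beta H) Y^T.
Proof.
move=> [Yc h]; split.
  apply/clsE => i j; rewrite !mxE; have /clsE -> := Yc; congr (- _).
  by rewrite [ss j * _]mulrC.
move=> H Hc; apply/matrixP => i j; rewrite lie_cartan // !mxE.
have := congr1 (fun M : 'M_N => M j i) (h H Hc); rewrite lie_cartan // mxE mulNr => <-.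
by ring.
Qed.

Lemma ncomb_Hm pi m beta : ncomb J pi beta -> (m <= n)%N -> (forall a, pi a -> a (Hm m) = 0) -> beta (Hm m) = 0.
Proof.
move=> [k [b [c [hb hE]]]] mn hm; rewrite hE; last exact: Hm_cartan.
by rewrite big1 // => i _; rewrite hm ?mulr0.
Qed.

Lemma root_flag pi beta Y : pos_root J beta -> ncomb J pi beta -> rootsp J beta Y ->
  forall i j, Y i j != 0 -> (i < j)%N /\
    forall m, (m <= n)%N -> (forall a, pi a -> a (Hm m) = 0) -> Hm m i i = Hm m j j.
Proof.
move=> [_ up] nc Yr i j Y0; split.
  by rewrite ltnNge; apply/negP => ji; rewrite (up _ Yr) ?eqxx // in Y0.
move=> m mn hm; have := rootspE Yr (Hm_cartan mn) Y0; rewrite (ncomb_Hm nc mn hm).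
by move/esym/eqP; rewrite subr_eq0 => /eqP.
Qed.

Lemma Hm_low m (i j : 'I_N) : (m <= n)%N -> (i < N - m)%N -> (N - m <= j)%N -> Hm m i i <> Hm m j j.
Proof.
move=> mn im jm; rewrite !HmE; case/andP: Nn => n1 n2; have jN := ltn_ord j.
have -> : (j < m)%N = false by apply/negP; lia.
have -> : (N - m <= i)%N = false by apply/negP; lia.
rewrite jm; case: ifP => _ /eqP; last by rewrite eq_sym oppr_eq0 oner_eq0.
by rewrite -subr_eq0 opprK -[1 + 1]/(2%:R) pnatr_eq0.
Qed.

Lemma Hm_high m (i j : 'I_N) : (m <= n)%N -> (i < m)%N -> (m <= j)%N -> Hm m i i <> Hm m j j.
Proof.
move=> mn im jm; rewrite !HmE im; have -> : (j < m)%N = false by apply/negP; lia.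
case: ifP => _ /eqP; last by rewrite oner_eq0.
by rewrite -subr_eq0 opprK -[1 + 1]/(2%:R) pnatr_eq0.
Qed.

Definition flagT (pi : weight F N -> Prop) (X : 'M[F]_N) : Prop :=
  forall m, (0 < m <= n)%N -> (forall a, pi a -> a (Hm m) = 0) ->
  forall i j : 'I_N, (j < m)%N -> (m <= i)%N -> X i j = 0.

Lemma flagT_tr pi X : X \in cls J -> flagT pi X -> X^T \in cls J /\ flagU pi X^T.
Proof.
move=> Xc fX; have /clsE XE := Xc.
have Tc : X^T \in cls J.
  by apply/clsE => i j; rewrite !mxE XE [ss j * _]mulrC.
split=> // m mn hm i j im jm; rewrite mxE XE (fX m mn hm) ?mulr0 ?oppr0 //=.
  by have := ltn_ord j; case/andP: Nn => n1 n2; lia.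
lia.
Qed.

Lemma cartan_add H1 H2 : cartan J H1 -> cartan J H2 -> cartan J (H1 + H2).
Proof.
move=> [c1 /is_diag_mxP d1] [c2 /is_diag_mxP d2]; split; first exact: memvD.
by apply/is_diag_mxP => i j ij; rewrite mxE d1 // d2 // addr0.
Qed.

Lemma cartan0 : cartan J 0.
Proof. by split; [exact: mem0v | apply/is_diag_mxP => i j _; rewrite mxE]. Qed.

Lemma std_cartan pi1 pi2 H : cartan J H -> std_seaweed J pi1 pi2 H.
Proof.
move=> Hc; exists H, 0%N, (fun _ _ => 0), (fun _ => 0); split=> //; split; first by case.
by rewrite big_ord0 addr0.
Qed.

Lemma std_add pi1 pi2 X Y : std_seaweed J pi1 pi2 X -> std_seaweed J pi1 pi2 Y -> std_seaweed J pi1 pi2 (X + Y).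
Proof.
move=> [H1 [k1 [b1 [Y1 [c1 [r1 ->]]]]]] [H2 [k2 [b2 [Y2 [c2 [r2 ->]]]]]].
exists (H1 + H2), (k1 + k2)%N, (fun i => match split i with inl j => b1 j | inr j => b2 j end),
  (fun i => match split i with inl j => Y1 j | inr j => Y2 j end); split; first exact: cartan_add.
split; first by move=> i; case: (split i).
rewrite big_split_ord /= addrACA; congr (_ + (_ + _)); apply: eq_bigr => i _.
  by rewrite (unsplitK (inl i)).
by rewrite (unsplitK (inr i)).
Qed.

Lemma std_root pi1 pi2 beta Y : rootsp J beta Y ->
  ((pos_root J beta /\ ncomb J pi1 beta) \/ (neg_root J beta /\ ncomb J pi2 (fun H => - beta H))) ->
  std_seaweed J pi1 pi2 Y.
Proof.
move=> Yr hb; exists 0, 1%N, (fun _ => beta), (fun _ => Y); split; first exact: cartan0.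
by split=> //; rewrite big_ord1 add0r.
Qed.

(** The factor 1/2 appears because the positions (i, j) and (rev j, rev i) give the same root vector
    and both occur in the sum. *)
Lemma cls_decomp X : X \in cls J ->
  X = diag_mx (\row_i X i i) + \sum_(p : 'I_N * 'I_N | p.1 != p.2) elt p.1 p.2 (2^-1 * X p.1 p.2).
Proof.
move=> /clsE Xc; apply/matrixP => k l; rewrite mxE summxE.
have -> : \sum_(p : 'I_N * 'I_N | p.1 != p.2) elt p.1 p.2 (2^-1 * X p.1 p.2) k l =
    \sum_(p : 'I_N * 'I_N | p.1 != p.2) (if p == (k, l) then 2^-1 * X k l else 0) +
    \sum_(p : 'I_N * 'I_N | p.1 != p.2) (if p == (rev_ord l, rev_ord k) then 2^-1 * X k l else 0).
  rewrite -big_split /=; apply: eq_bigr => -[i j] /= ij; rewrite !mxE !xpair_eqE.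
  have e1 : (i == rev_ord l) && (j == rev_ord k) = (k == rev_ord j) && (l == rev_ord i).
    by rewrite andbC; congr (_ && _); apply/eqP/eqP => ->; rewrite rev_ordK.
  rewrite e1 [i == k]eq_sym [j == l]eq_sym; congr (_ + _).
    by case: (boolP (_ && _)) => [/andP [/eqP -> /eqP ->]|_]; rewrite ?mulr1 ?mulr0.
  case: (boolP (_ && _)) => [/andP [/eqP -> /eqP ->]|_]; last by rewrite mulr0 oppr0.
  rewrite mulr1 (Xc (rev_ord j)) !rev_ordK !ssr.
  have -> : eps * ss j * (eps * ss i) = (eps * eps) * (ss i * ss j) by ring.
  by rewrite eps2; ring.
rewrite !mxE; case: (eqVneq k l) => [->|kl].
  rewrite mulr1n !big1 ?addr0 //.
    by move=> [i j] /= ij; case: eqP => // -[iE jE]; rewrite iE jE eqxx in ij.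
  by move=> [i j] /= ij; case: eqP => // -[iE jE]; rewrite iE jE eqxx in ij.
have one q (c : F) : q.1 != q.2 -> \sum_(p : 'I_N * 'I_N | p.1 != p.2) (if p == q then c else 0) = c.
  by move=> hq; rewrite (bigD1 q) //= eqxx big1 ?addr0 // => p /andP [_ /negPf ->].
rewrite !one //=; first by rewrite mulr0n; field.
by rewrite (inj_eq rev_ord_inj) eq_sym.
Qed.

Lemma std_iff pi1 pi2 X : simple_subset J pi1 -> simple_subset J pi2 ->
  std_seaweed J pi1 pi2 X <-> [/\ X \in cls J, flagU pi1 X & flagT pi2 X].
Proof.
move=> sp1 sp2; split.
  move=> [H [k [b [Y [Hc [Yr ->]]]]]].
  have Hd (i j : 'I_N) : i != j -> H i j = 0 by move: Hc => [_ /is_diag_mxP h]; exact: h.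
  split.
  - rewrite memvD //; first by case: Hc.
    by apply: memv_suml => i _; case: (Yr i) => [[]].
  - move=> m mn hm i j im jm; rewrite mxE summxE Hd; last by apply/eqP => ij; move: im jm; rewrite ij; lia.
    rewrite add0r big1 // => l _; apply/eqP/negPn/negP => Y0; have [Yl] := Yr l; case/andP: mn => _ mn.
    case=> [[pr nc]|[nr nc]].
      have [_ /(_ m mn hm)] := root_flag pr nc Yl Y0; exact: Hm_low.
    have Y0' : (Y l)^T j i != 0 by rewrite mxE.
    by have [ji _] := root_flag nr nc (rootsp_tr Yl) Y0'; lia.
  - move=> m mn hm i j im jm; rewrite mxE summxE Hd; last by apply/eqP => ij; move: im jm; rewrite ij; lia.
    rewrite add0r big1 // => l _; apply/eqP/negPn/negP => Y0; have [Yl] := Yr l; case/andP: mn => _ mn.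
    case=> [[pr nc]|[nr nc]].
      by have [ij _] := root_flag pr nc Yl Y0; lia.
    have Y0' : (Y l)^T j i != 0 by rewrite mxE.
    by have [_ /(_ m mn hm)] := root_flag nr nc (rootsp_tr Yl) Y0'; exact: Hm_high.
move=> [Xc fU fT]; rewrite (cls_decomp Xc).
apply: std_add.
  apply: std_cartan; apply: diag_cartan => i; have /clsE h := Xc; rewrite !mxE (h i i).
  by rewrite ss2 mul1r opprK.
apply: (big_ind (std_seaweed J pi1 pi2)); [exact: std_cartan cartan0 | exact: std_add |].
move=> [i j] /= ij; case: (eqVneq (X i j) 0) => [->|X0].
  have -> : elt i j (2^-1 * 0) = 0 by rewrite /elt !mulr0 !scale0r subrr.
  exact: std_cartan cartan0.
have rt : e = true \/ j <> rev_ord i.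
  case: (boolP e) => [|/negPf e0]; [by left | right => jE].
  by move: X0; rewrite jE (cls_antidiag _ e0) ?eqxx.
apply: (@std_root _ _ (fun H => H i i - H j j)); first exact: elt_root.
case: (ltngtP i j) => ltij; last by rewrite (val_inj ltij) eqxx in ij.
  left; split; first exact: (@pos_root_wt _ i j).
  exact: (ncomb_wt sp1 Xc fU ltij).
have [Tc fT'] := flagT_tr Xc fT.
right; split.
  apply: (@pos_root_wt _ j i) => //; last by move=> H _; rewrite opprB.
  by case: rt => [|h]; [left | right => iE; apply: h; rewrite iE rev_ordK].
apply: (ncomb_wt sp2 Tc fT' ltij); first by rewrite mxE.
by move=> H _; rewrite opprB.
Qed.

End Std.

(** * Weakly opposite flags and the spectrum of a seaweed *)

Section Flags.
Variables (F : numClosedFieldType) (e : bool) (N n : nat) (J : 'M[F]_N) (ss : 'I_N -> F).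
Local Notation eps := (sg F e).
Hypothesis JE : forall i j, J i j = if j == rev_ord i then ss i else 0.
Hypothesis ss2 : forall i, ss i * ss i = 1.
Hypothesis ssr : forall i, ss (rev_ord i) = eps * ss i.
Hypothesis Nn : (n.*2 <= N <= n.*2.+1)%N.
Hypothesis Nodd : e = false -> N = n.*2.+1.
Local Notation w := (w J).
Local Notation vs := ({vspace 'cV[F]_N}).

Let JT := std_JT JE ssr.
Let Ju := std_Ju JE ss2 ssr.

(** Whether a simple root is missing from pi is an arbitrary proposition, so the increasing list of
    flag dimensions is built classically. *)
Lemma sorted_list (P : nat -> Prop) d k :
  exists s, path ltn k s /\ forall m, m \in s <-> (k < m <= k + d)%N /\ P m.
Proof.
elim: d k => [|d IH] k; first by exists [::]; split=> // m; rewrite in_nil; split=> // -[]; lia.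
have [s [ps sE]] := IH k.+1.
have ps' : path ltn k s.
  by case: s ps {sE} => //= a s /andP [ka ->]; rewrite andbT; apply: ltn_trans ka.
case: (classic (P k.+1)) => [Pk|nP].
  exists (k.+1 :: s); split; first by rewrite /= ltnSn.
  move=> m; rewrite inE; split=> [/predU1P [->|/sE [hm Pm]]|[hm Pm]]; [by split=> //; lia | by split=> //; lia |].
  case: (eqVneq m k.+1) => [//|mk] /=; apply/sE; split=> //; lia.
exists s; split=> // m; rewrite sE; split=> -[hm Pm]; split=> //; first by lia.
case: (eqVneq m k.+1) => [mk|mk]; last by lia.
by case: nP; rewrite -mk.
Qed.

Lemma chain_map (f : nat -> vs) k s : path ltn k s -> (forall m, m \in s -> (m <= n)%N) ->
  (forall a b, (a < b)%N -> (b <= n)%N -> (f a <= f b)%VS /\ ~~ (f b <= f a)%VS) ->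
  chain (f k) [seq f m | m <- s].
Proof.
move=> ps sn fE; elim: s k ps sn => //= a s IH k /andP [ka pa] sn.
have [h1 h2] := fE _ _ ka (sn _ (mem_head _ _)); split=> //; apply: IH => // m ms.
by apply: sn; rewrite inE ms orbT.
Qed.

Lemma w_sum (a b : 'cV[F]_N) : w a b = \sum_i a i 0 * (ss i * b (rev_ord i) 0).
Proof. by rewrite /w -mulmxA mxE; apply: eq_bigr => i _; rewrite mxE (mulJE JE). Qed.

Section Conj.
Variable P : 'M[F]_N.
Hypothesis PJ : P^T *m J *m P = J.
Local Notation Q := (invmx P).

Lemma Pu : P \in unitmx.
Proof. by have := Ju; rewrite -{1}PJ unitmx_mul => /andP []. Qed.

Lemma wP a b : w (P *m a) (P *m b) = w a b.
Proof.
have -> : w a b = (a^T *m (P^T *m J *m P) *m b) 0 0 by rewrite PJ.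
by rewrite /w trmx_mul !mulmxA.
Qed.

Lemma conj_cls Y : P *m Y *m Q \in cls J <-> Y \in cls J.
Proof.
split=> h; apply: cls_of_w => a b.
  have := cls_w (P *m a) (P *m b) h; rewrite -!(mulmxA _ Q) !(mulmxA Q P) !mulVmx ?Pu // !mul1mx.
  by rewrite -!mulmxA !wP.
rewrite -{1}(mulKVmx Pu b) -{2}(mulKVmx Pu a) -!(mulmxA P Y) -!(mulmxA P (Y *m Q)) !wP -!mulmxA.
exact: cls_w.
Qed.

Lemma coord_lin (p : pred 'I_N) a (x y : 'cV[F]_N) :
  \col_i (if p i then (Q *m (a *: x + y)) i 0 else 0) =
  a *: (\col_i (if p i then (Q *m x) i 0 else 0)) + (\col_i (if p i then (Q *m y) i 0 else 0)).
Proof.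
rewrite mulmxDr -scalemxAr; move: (Q *m x) (Q *m y) => x' y'.
by apply/colP => i; rewrite !mxE; case: (p i) => //; rewrite mulr0 addr0.
Qed.

(** The span of the columns of P with index outside p: coordinates in p are those required to
    vanish. *)
Definition crd (p : pred 'I_N) : vs :=
  lker (linfun (fun v : 'cV[F]_N => \col_i (if p i then (Q *m v) i 0 else 0))).

Lemma crdP p v : v \in crd p <-> forall i, p i -> (Q *m v) i 0 = 0.
Proof.
rewrite memv_ker linfun_linE; last exact: coord_lin.
move: (Q *m v) => v'; split=> [/eqP h i pi|h].
  by have /colP/(_ i) := h; rewrite !mxE pi.
by apply/eqP/colP => i; rewrite !mxE; case: ifP => // /h.
Qed.

Lemma crd_basis p (j : 'I_N) : P *m delta_mx j 0 \in crd p = ~~ p j.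
Proof.
apply/idP/idP => [/crdP h|pj].
  apply/negP => pj; have := h j pj; rewrite mulKmx ?Pu // mxE !eqxx => /eqP; by rewrite oner_eq0.
apply/crdP => i pi; rewrite mulKmx ?Pu // mxE; case: eqP => // ij.
by rewrite -ij pi in pj.
Qed.

Lemma crd_stable p Y : stable (P *m Y *m Q) (crd p) <-> forall i j, p i -> ~~ p j -> Y i j = 0.
Proof.
split=> [h i j pi pj|h v /crdP vp].
  have /h /crdP/(_ i pi) : P *m delta_mx j 0 \in crd p by rewrite crd_basis.
  rewrite -!mulmxA (mulmxA Q P) mulVmx ?Pu // mul1mx (mulmxA Q P) mulVmx ?Pu // mul1mx -colE mxE //.
apply/crdP => i pi; rewrite -!mulmxA (mulmxA Q P) mulVmx ?Pu // mul1mx mxE big1 // => j _.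
by have [/vp ->|/(h i j pi) ->] := boolP (p j); rewrite ?mulr0 ?mul0r.
Qed.

Lemma crd_sub (p p' : pred 'I_N) : (forall i, p' i -> p i) -> (crd p <= crd p')%VS.
Proof. by move=> h; apply/subvP => v /crdP vp; apply/crdP => i /h; exact: vp. Qed.

Definition Uf m := crd (fun i => (i < N - m)%N).
Definition Tf m := crd (fun i => (m <= i)%N).

Lemma Uf_mono a b : (a < b)%N -> (b <= n)%N -> (Uf a <= Uf b)%VS /\ ~~ (Uf b <= Uf a)%VS.
Proof.
move=> ab bn; case/andP: Nn => n1 n2; split; first by apply: crd_sub => i; lia.
have jN : (N - b < N)%N by lia.
apply/subvPn; exists (P *m delta_mx (Ordinal jN) 0); rewrite crd_basis /= -?leqNgt ?negbK //; lia.
Qed.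

Lemma Tf_mono a b : (a < b)%N -> (b <= n)%N -> (Tf a <= Tf b)%VS /\ ~~ (Tf b <= Tf a)%VS.
Proof.
move=> ab bn; case/andP: Nn => n1 n2; split; first by apply: crd_sub => i; lia.
have jN : (a < N)%N by lia.
apply/subvPn; exists (P *m delta_mx (Ordinal jN) 0); rewrite crd_basis /= -?ltnNge ?negbK //; lia.
Qed.

Lemma Uf0 : Uf 0 = 0%VS.
Proof.
apply/eqP; rewrite -subv0; apply/subvP => v /crdP h; rewrite memv0; apply/eqP.
rewrite -(mulKVmx Pu v); have -> : Q *m v = 0 by apply/colP => i; rewrite [RHS]mxE h // subn0 ltn_ord.
by rewrite mulmx0.
Qed.

Lemma Tf0 : Tf 0 = 0%VS.
Proof.
apply/eqP; rewrite -subv0; apply/subvP => v vT.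
have h i : (Q *m v) i 0 = 0 by exact: (proj1 (crdP (fun i : 'I_N => (0 <= i)%N) v) vT i (leq0n i)).
rewrite memv0 -(mulKVmx Pu v); have -> : Q *m v = 0 by apply/colP => i; rewrite [RHS]mxE; exact: h.
by rewrite mulmx0.
Qed.

Lemma wQ a b : w a b = \sum_i (Q *m a) i 0 * (ss i * (Q *m b) (rev_ord i) 0).
Proof. by rewrite -w_sum -(wP (Q *m a)) !mulKVmx ?Pu. Qed.

Lemma crd_iso p : (forall i, p i || p (rev_ord i)) -> isotropic J (crd p).
Proof.
move=> h a b /crdP ap /crdP bp; rewrite wQ big1 // => i _.
by case/orP: (h i) => [/ap|/bp] ->; rewrite ?mul0r ?mulr0.
Qed.

Lemma w_delta a (j : 'I_N) : w a (P *m delta_mx j 0) = (Q *m a) (rev_ord j) 0 * ss (rev_ord j).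
Proof.
have dE i : (delta_mx j 0 : 'cV[F]_N) i 0 = (i == j)%:R by rewrite mxE eqxx andbT.
rewrite wQ mulKmx ?Pu // (bigD1 (rev_ord j)) //= rev_ordK dE eqxx mulr1 big1 ?addr0 // => i ij.
rewrite dE; case: eqP => [ji|]; last by rewrite !mulr0.
by rewrite -ji rev_ordK eqxx in ij.
Qed.

Lemma ss_neq0 i : ss i != 0.
Proof. by apply/eqP => h; have := ss2 i; rewrite h mulr0 => /eqP; rewrite eq_sym oner_eq0. Qed.

(** [w] pairs the basis vector of index i only with the one of index rev i, and the condition places
    the partner of every free coordinate of u in [crd p']. *)
Lemma crd_inj (p p' : pred 'I_N) u : (forall i, p i || ~~ p' (rev_ord i)) -> u \in crd p ->
  (forall z, z \in crd p' -> w u z = 0) -> u = 0.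
Proof.
move=> h /crdP up hz; rewrite -(mulKVmx Pu u); have -> : Q *m u = 0; last by rewrite mulmx0.
apply/colP => i; rewrite [RHS]mxE; case/orP: (h i) => [/up //|pi].
have := hz _ (etrans (crd_basis _ _) pi); rewrite w_delta rev_ordK => /eqP.
by rewrite mulf_eq0 (negPf (ss_neq0 _)) orbF => /eqP.
Qed.

Lemma flags_wf s1 s2 : path ltn 0 s1 -> path ltn 0 s2 -> (forall m, m \in s1 -> (m <= n)%N) ->
  (forall m, m \in s2 -> (m <= n)%N) ->
  wf e J fullv [seq Uf m | m <- s1] [seq Tf m | m <- s2].
Proof.
move=> p1 p2 n1 n2; have [N1 N2] := andP Nn; split.
- by move=> v _ h; apply: (w_nondeg Ju) => z; apply: h; exact: memvf.
- move=> Y; rewrite mem_cat => /orP [] /mapP [m ms ->]; split; rewrite ?subvf //; apply: crd_iso => i /=.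
    by have := n1 _ ms; have := ltn_ord i; lia.
  by have := n2 _ ms; have := ltn_ord i; lia.
- split; first by rewrite -Uf0; apply: chain_map => //; exact: Uf_mono.
  by rewrite -Tf0; apply: chain_map => //; exact: Tf_mono.
- move=> _ _ /mapP [m ms ->] /mapP [m' ms' ->]; have := n1 _ ms; have := n2 _ ms' => h' h.
  (* The member of smaller dimension embeds in the dual of the other. *)
  case: (leqP m m') => mm; [left | right].
    by move=> u uU hu; apply: (crd_inj _ uU hu) => i /=; have := ltn_ord i; lia.
  move=> z zT hz; apply: (crd_inj _ zT (p' := fun i : 'I_N => (i < N - m)%N)) => [i /=|u uU].
    by have := ltn_ord i; lia.
  by apply: (wC0 JT); exact: hz.
by move=> /Nodd; rewrite dimvf /dim /= muln1 => ->; rewrite /= odd_double.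
Qed.

Lemma flags_Reg pi1 pi2 s1 s2 :
  (forall m, m \in s1 <-> (0 < m <= 0 + n)%N /\ (forall a, pi1 a -> a (Hm F N m) = 0)) ->
  (forall m, m \in s2 <-> (0 < m <= 0 + n)%N /\ (forall a, pi2 a -> a (Hm F N m) = 0)) ->
  forall X, Reg J fullv [seq Uf m | m <- s1] [seq Tf m | m <- s2] X <->
    exists Y, [/\ Y \in cls J, flagU n pi1 Y & flagT n pi2 Y] /\ X = P *m Y *m Q.
Proof.
move=> s1E s2E X; split.
  have [Y ->] : exists Y, X = P *m Y *m Q.
    by exists (Q *m X *m P); rewrite -!mulmxA mulmxV ?Pu // mulmx1 mulKVmx ?Pu.
  move=> [Yc _ hU hT]; exists Y; split=> //; split.
  - exact/conj_cls.
  - move=> m mn hm i j im jm; have : Uf m \in [seq Uf m | m <- s1] by apply/map_f/s1E; split.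
    by move=> /hU/crd_stable; apply=> //=; rewrite -leqNgt.
  - move=> m mn hm i j jm im; have : Tf m \in [seq Tf m | m <- s2] by apply/map_f/s2E; split.
    by move=> /hT/crd_stable; apply=> //=; rewrite -ltnNge.
move=> [Y [[Yc fU fT] ->]]; split.
- exact/conj_cls.
- move=> v h; have -> : v = 0 by apply: (w_nondeg Ju) => z; apply: h; exact: memvf.
  by rewrite mulmx0.
- move=> _ /mapP [m /s1E [mn hm] ->]; apply/crd_stable => i j /= im; rewrite -leqNgt; exact: fU.
- move=> _ /mapP [m /s2E [mn hm] ->]; apply/crd_stable => i j /= im; rewrite -ltnNge => jm; exact: (fT m mn hm).
Qed.

End Conj.

Lemma flags_spectrum : (0 < n)%N -> spectrum_claim J.
Proof.
move=> n0 g f h [pi1 [pi2 [P [sp1 sp2 PJ gE]]]] [f_lin f_nd] [hg hf].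
have [s1 [ps1 s1E]] := sorted_list (fun m => forall a, pi1 a -> a (Hm F N m) = 0) n 0.
have [s2 [ps2 s2E]] := sorted_list (fun m => forall a, pi2 a -> a (Hm F N m) = 0) n 0.
have Wf : wf e J fullv [seq Uf P m | m <- s1] [seq Tf P m | m <- s2].
  by apply: flags_wf => // m; [move/s1E | move/s2E] => -[]; lia.
have gR X : X \in g <-> Reg J fullv [seq Uf P m | m <- s1] [seq Tf P m | m <- s2] X.
  rewrite gE (flags_Reg PJ s1E s2E); split=> -[Y [hY ->]]; exists Y; split=> //.
    exact/(std_iff JE ss2 ssr Nn Nodd Y sp1 sp2).
  exact/(std_iff JE ss2 ssr Nn Nodd Y sp1 sp2).
have gl := Reg_lie_closed gR.
(* f is linear only on g; composed with the projection onto g it is linear on all matrices, as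
   [trace_repr] requires. *)
have [A AE] : exists A, forall x, \tr (A *m x) = f (projv g x).
  by apply: trace_repr => a x y; rewrite linearP f_lin ?memv_proj.
have AE' x : x \in g -> \tr (A *m x) = f x by move=> xg; rewrite AE projv_id.
have fr : frob g A.
  by move=> x xg hx; apply: f_nd => // y yg; rewrite -AE' ?hx //; exact: gl.
have hp : prin g A h.
  by split=> // x xg; rewrite !AE' ?hf //; exact: gl.
have [_ _ [m um]] := claim_all JT Ju (leqnn _) Wf gR fr hp.
split.
  exists m; split=> //.
  (* g contains a nonzero Cartan element, so 0 is an eigenvalue; this excludes m = 0, for which the
     interval is empty. *)
  have [x [xg x0]] : exists x, x \in g /\ x != 0.
    have N0 : (0 < N)%N by case/andP: Nn; lia.
    have rc := rho_cartan JE ss2 ssr.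
    exists (P *m rho F N *m invmx P); split.
      apply/gE; exists (rho F N); split=> //; exact: std_cartan.
    apply/eqP => r0; have Pu := Pu PJ.
    have : rho F N = 0.
      by rewrite -[LHS](mulKmx Pu) -[P *m _](mulmxKV Pu) r0 mul0mx mulmx0.
    move/matrixP/(_ (Ordinal N0) (Ordinal N0)); rewrite !mxE eqxx mulr1n mul0r subr0 => /eqP.
    by rewrite subr_eq0 -[1]/(1%:R) eqr_nat; case/andP: Nn; lia.
  have /um [i [hi /eqP]] := frob_eig0 gl fr hp xg x0.
  by rewrite eq_sym intr_eq0 => /eqP i0; move: hi; rewrite i0; lia.
move=> i; have -> : (1 - i)%:~R = 1 - i%:~R :> F by rewrite intrB.
have h1 := eigenspace_sym i%:~R gl fr hp.
have h2 := eigenspace_sym (1 - i%:~R) gl fr hp.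
have ii : 1 - (1 - i%:~R) = i%:~R :> F by rewrite opprB addrC subrK.
rewrite ii in h2; apply: anti_leq; apply/andP; split; [exact: h2 | exact: h1].
Qed.

End Flags.

Theorem theorem1 (R : realType) (n : nat) :
  (0 < n)%N ->
  spectrum_claim (J_so R[i] n) /\ spectrum_claim (J_sp R[i] n).
Proof.
move=> n0; split.
  apply: (@flags_spectrum _ false _ n _ (fun _ => 1)) => //.
  - move=> i j; rewrite mxE -val_eqE /=; have := ltn_ord i; have := ltn_ord j => jN iN.
    have -> : (i + j == n.*2)%N = (j == n.*2.+1 - i.+1 :> nat)%N by apply/eqP/eqP; lia.
    by case: eqP.
  - by move=> i; rewrite mulr1.
  - by move=> i; rewrite mulr1.
  - lia.
apply: (@flags_spectrum _ true _ n _ (fun i => if (i < n)%N then 1 else -1)) => //.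
- move=> i j; rewrite mxE -val_eqE /=; have := ltn_ord i; have := ltn_ord j => jN iN.
  by have -> : ((i + j).+1 == n.*2)%N = (j == n.*2 - i.+1 :> nat)%N by apply/eqP/eqP; lia.
- by move=> i; case: ifP; rewrite ?mulrNN mulr1.
- move=> i /=; have := ltn_ord i => iN; have -> : (n.*2 - i.+1 < n)%N = ~~ (i < n)%N by apply/idP/idP; lia.
  by case: (i < n)%N => /=; rewrite mulN1r ?opprK.
- lia.
Qed.
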